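(* Let $f$ be a holomorphic function on the open unit disc $\Delta\subset\mathbb{C}$ such that its cluster set $C(f)$ satisfies $\Lambda(C(f))<\infty$ and such that $\mathbb{C}\setminus C(f)$ has finitely many connected components. Then the derivative $f'$ belongs to the Hardy space $H^1$, that is, $$\sup_{0<r<1}\int_0^{2\pi}|f'(re^{i\theta})|\,d\theta<\infty .$$
   Context: $\Delta=\{z\in\mathbb{C}: |z|<1\}$. The cluster set $C(f)$ of a function $f:\Delta\to\mathbb{C}$ is the set of all $w\in\mathbb{C}$ for which there is a sequence $z_n\in\Delta$ with $\lim_{n\to\infty}|z_n|=1$ and $\lim_{n\to\infty}f(z_n)=w$. For $E\subset\mathbb{C}$, the linear measure $\Lambda(E)$ is the one-dimensional Hausdorff measure of $E$, that is, $\Lambda(E)=\lim_{\varepsilon\to 0}\inf_{(D_n)}\sum_n \operatorname{diam} D_n$, where the infimum is taken over all systems (sequences) of discs $(D_n)$ with $\operatorname{diam} D_n<\varepsilon$ that cover $E$. *)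

(* Defs.v *)
From HB Require Import structures.
From mathcomp Require Import all_boot all_order all_algebra.
From mathcomp Require Import all_classical all_reals all_analysis.
From mathcomp Require Import complex.

Set Implicit Arguments.
Unset Strict Implicit.
Unset Printing Implicit Defensive.
Import Order.TTheory GRing.Theory Num.Theory.
Import numFieldNormedType.Exports.
Import ComplexField.Normc.
Local Open Scope classical_set_scope.
Local Open Scope ring_scope.

(* R[i] as a numFieldType: through this key it gets its norm topology and its
   structure of normed space over itself. The norm `|z| lies in R[i]; normc z
   is the same number as an element of R. *)
Definition Cplx (R : realType) : numFieldType := R[i].

Section Defs.
Variable R : realType.
Local Notation C := (Cplx R).
Implicit Types (f g : C -> C) (E : set C).

Definition unit_disc : set C := [set z | normc z < 1].

(* The increments range over R[i], so derivable in the direction 1 is complex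
   differentiability. The disc is open, so the values of f outside it are
   irrelevant. *)
Definition holomorphic_on_disc f : Prop :=
  forall z, unit_disc z -> derivable f z 1.

Definition cluster_set f : set C :=
  [set w | exists z_ : nat -> C,
    [/\ forall n, unit_disc (z_ n),
        normc (z_ n) @[n --> \oo] --> (1 : R)
      & f (z_ n) @[n --> \oo] --> w]].

(* A sequence of open discs is given by centres c and radii rho, the n-th disc
   having diameter 2 * rho n. A null radius gives the empty disc, so finite
   systems of discs are included. *)
Definition disc_cover E (eps : R) (c : nat -> C) (rho : nat -> R) : Prop :=
  (forall n, 0 <= rho n /\ 2 * rho n < eps) /\
  E `<=` \bigcup_n [set z | normc (z - c n) < rho n].

Definition linear_premeasure E (eps : R) : \bar R :=
  ereal_inf [set s | exists (c : nat -> C) (rho : nat -> R),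
    disc_cover E eps c rho /\ s = (\sum_(0 <= n <oo) (2 * rho n)%:E)%E].

Definition linear_measure E : \bar R :=
  lim (linear_premeasure E eps @[eps --> 0^'+]).

Definition components E : set (set C) :=
  [set connected_component E x | x in E].

Definition expi (t : R) : C := (cos t +i* sin t)%C.

Definition circle_integral g (r : R) : \bar R :=
  (\int[lebesgue_measure]_(t in `[0%R, (2 * pi)%R])
     (normc (g (r%:C%C * expi t)))%:E)%E.

Definition hardy_H1 g : Prop :=
  holomorphic_on_disc g /\
  (ereal_sup [set circle_integral g r | r in `]0%R, 1%R[%classic] < +oo)%E.

End Defs.

(* Main.v *)
(* Write C(f) for the cluster set, F(z) = f(e^z) on the half-plane Re z < 0, and V(w)
   for the number of preimages of w, smoothed at a scale below dist(w, C(f)). By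
   Stokes' theorem V is finite and locally constant off C(f), hence bounded by some N
   since the complement of C(f) has finitely many components. The finiteness of the
   linear measure makes f bounded and covers C(f) by finitely many arbitrarily small
   discs D_k with sum of radii at most M. Let chi be a cut-off vanishing on the discs,
   equal to 1 away from their doubles, with dbar chi = O(1/rho_k) near D_k.

   The values of F in the double of D_k and off C(f) cover an area O(N rho_k^2),
   counted with multiplicity, and C(f) has zero area; hence f has finite Dirichlet integral and
   the integral of (1 - chi(F)) |F'|^2 is as small as desired, uniformly in the strip,
   while that of |dbar chi (F)| |F'|^2 is O(N M). Near the boundary chi(F) = 0, so for
   a smooth bounded G Stokes' theorem applied to (1 - chi(F)) G F' bounds the integral
   of G F' over circles close to the unit circle by a constant depending only on
   sup |G|, N, M and on F' on one fixed circle. Take for G a discrete Poisson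
   integral of unimodular weights: by Cauchy's formula the circle integral becomes a
   Riemann sum of |z f'(z)| over a circle of radius r < 1, so these sums, and with
   them the means of |f'|, are bounded independently of r. *)

Require Import Defs.
From mathcomp Require Import all_boot all_order all_algebra.
From mathcomp Require Import all_classical all_reals all_analysis.
From mathcomp Require Import complex ring lra.
Set Implicit Arguments.
Unset Strict Implicit.
Unset Printing Implicit Defensive.
Import Order.TTheory GRing.Theory Num.Theory.
Import numFieldNormedType.Exports.
Import ComplexField.Normc.
Local Open Scope ring_scope.
Local Open Scope classical_set_scope.

(** * Wirtinger derivatives *)

(** The dbar derivative of (1 - chi(F)) G F' has two terms. In the one with dbar chi, a factor
    1/rho_k meets an image area of order N rho_k^2, and the products N rho_k are summable exactly
    because the measure is linear. The one with dbar G is the obstacle: dbar G has no bound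
    independent of G, while the final constant must have one. The order of the choices removes it: G
    comes first, then a cover so fine that the energy left under 1 - chi is small compared with sup
    |dbar G|, uniformly up to the circle. This uniformity is the reason for bounding the Dirichlet
    integral beforehand. V is locally constant because the derivatives of its kernel in the centre
    and in the scale are, up to real parts and constants, dbar derivatives of functions supported in
    a disc that f leaves near the circle; what remains is the contribution of Re z = T, which
    vanishes as T tends to -oo. In the coordinate log z circles become vertical segments and
    periodicity cancels the horizontal sides, so that Stokes' theorem on rectangles suffices. *)

Section ComplexModulus.
Variable R : realType.
Local Notation C := R[i].
Implicit Types (z w : C) (x y : R).

Lemma normc_ge0 z : 0 <= normc z.
Proof. by case: z => a b; rewrite /normc sqrtr_ge0. Qed.

Lemma normc_eq0 z : (normc z == 0) = (z == 0).
Proof.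
by apply/eqP/eqP => [/eq0_normc //|->]; rewrite normc0.
Qed.

Lemma normc_gt0 z : (0 < normc z) = (z != 0).
Proof. by rewrite lt_neqAle normc_ge0 andbT eq_sym normc_eq0. Qed.

Lemma normcN z : normc (- z) = normc z.
Proof. by case: z => a b; rewrite /normc /= !sqrrN. Qed.

Lemma normcD z w : normc (z + w) <= normc z + normc w.
Proof. exact: le_normcD. Qed.

Lemma normcBC z w : normc (z - w) = normc (w - z).
Proof. by rewrite -normcN opprB. Qed.

Lemma normcB z w : normc (z - w) <= normc z + normc w.
Proof. by rewrite (le_trans (normcD _ _))// normcN. Qed.

Lemma normc_lerB z w : normc z - normc w <= normc (z - w).
Proof. by rewrite lerBlDr (le_trans _ (normcD _ _))// subrK. Qed.

Lemma sqr_normc z : normc z ^+ 2 = complex.Re z ^+ 2 + complex.Im z ^+ 2.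
Proof. by case: z => a b; rewrite /normc sqr_sqrtr// addr_ge0// sqr_ge0. Qed.

Lemma normc_real x : normc x%:C%C = `|x|.
Proof. by rewrite /normc /= expr0n/= addr0 sqrtr_sqr. Qed.

Lemma normc_conj z : normc z^*%C = normc z.
Proof. by case: z => a b; rewrite /normc /= sqrrN. Qed.

Lemma normcX z n : normc (z ^+ n) = normc z ^+ n.
Proof.
by elim: n => [|n IH]; rewrite ?expr0 ?normc1// !exprS normcM IH.
Qed.

Lemma normc_i : normc 'i%C = 1 :> R.
Proof. by rewrite /normc /= expr0n/= expr1n add0r sqrtr1. Qed.

Lemma normc_nat n : normc (n%:R : C) = n%:R.
Proof. by rewrite -(rmorph_nat (real_complex R)) normc_real normr_nat. Qed.

Lemma normRe_le z : `|complex.Re z| <= normc z.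
Proof.
rewrite -(@ler_pXn2r _ 2)// ?nnegrE ?normc_ge0// sqr_normc real_normK ?num_real//.
by rewrite lerDl sqr_ge0.
Qed.

Lemma normIm_le z : `|complex.Im z| <= normc z.
Proof.
rewrite -(@ler_pXn2r _ 2)// ?nnegrE ?normc_ge0// sqr_normc real_normK ?num_real//.
by rewrite lerDr sqr_ge0.
Qed.

Lemma normc_le_ReIm z : normc z <= `|complex.Re z| + `|complex.Im z|.
Proof.
rewrite -(@ler_pXn2r _ 2)// ?nnegrE ?normc_ge0 ?addr_ge0// sqr_normc.
rewrite -(real_normK (num_real (complex.Re z))) -(real_normK (num_real (complex.Im z))).
by rewrite sqrrD -addrA lerD2l lerDr mulrn_wge0// mulr_ge0.
Qed.

Lemma mulcconj z : z * z^*%C = (normc z ^+ 2)%:C%C.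
Proof.
by case: z => a b; rewrite sqr_normc /= ; apply/eqP; rewrite eq_complex/=;
  apply/andP; split; apply/eqP; ring.
Qed.

Lemma normc_sum_le (I : Type) (s : seq I) (P : pred I) (F : I -> C) :
  normc (\sum_(i <- s | P i) F i) <= \sum_(i <- s | P i) normc (F i).
Proof.
elim/big_ind2: _ => [|x1 x2 y1 y2 h1 h2|//]; first by rewrite normc0.
by rewrite (le_trans (normcD _ _))// lerD.
Qed.

Lemma ReD z w : complex.Re (z + w) = complex.Re z + complex.Re w.
Proof. by case: z w => [a b] [c d]. Qed.
Lemma ImD z w : complex.Im (z + w) = complex.Im z + complex.Im w.
Proof. by case: z w => [a b] [c d]. Qed.
Lemma ReN z : complex.Re (- z) = - complex.Re z.
Proof. by case: z. Qed.
Lemma ImN z : complex.Im (- z) = - complex.Im z.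
Proof. by case: z. Qed.
Lemma ReM z w : complex.Re (z * w) =
  complex.Re z * complex.Re w - complex.Im z * complex.Im w.
Proof. by case: z w => [a b] [c d]. Qed.
Lemma ImM z w : complex.Im (z * w) =
  complex.Re z * complex.Im w + complex.Im z * complex.Re w.
Proof. by case: z w => [a b] [c d]. Qed.

Lemma complexP z w : complex.Re z = complex.Re w ->
  complex.Im z = complex.Im w -> z = w.
Proof. by case: z w => [a b] [c d] /= -> ->. Qed.

Definition mkc x y : C := (x +i* y)%C.

Lemma mkcB x y x' y' : mkc x y - mkc x' y' = mkc (x - x') (y - y').
Proof. by []. Qed.

Lemma normc_mkc_le x y : normc (mkc x y) <= `|x| + `|y|.
Proof. exact: normc_le_ReIm. Qed.

End ComplexModulus.

Section SmallRemainders.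
Variable R : realType.
Local Notation C := R[i].
Implicit Types (r s : C -> C) (k : C -> R).

(* r = o(k) at 0; used with k = 1 for continuity and k = normc for
   differentiability *)
Definition small k r := forall e : R, 0 < e ->
  exists2 d : R, 0 < d & forall h, normc h < d -> normc (r h) <= e * k h.

Lemma small0 k : (forall h, 0 <= k h) -> small k (fun=> 0).
Proof.
move=> k0 e e0; exists 1 => // h _; rewrite normc0 mulr_ge0// ltW//.
Qed.

Lemma smallD k r s : small k r -> small k s -> small k (fun h => r h + s h).
Proof.
move=> hr hs e e0.
have [|d1 d10 h1] := hr (e / 2); first by rewrite divr_gt0.
have [|d2 d20 h2] := hs (e / 2); first by rewrite divr_gt0.
exists (Num.min d1 d2); first by rewrite lt_min d10.
move=> h; rewrite lt_min => /andP[/h1 k1 /h2 k2].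
rewrite (le_trans (normcD _ _))//.
have -> : e * k h = e / 2 * k h + e / 2 * k h by field.
by rewrite lerD.
Qed.

(** [B] may have any sign; [|B| + 1] is a positive number above it by which one can divide. *)
Lemma small_bound k r s (B : R) (d : R) : 0 < d ->
  (forall h, normc h < d -> normc (r h) <= B * normc (s h)) ->
  small k s -> small k r.
Proof.
move=> d0 hB hs e e0.
have B1 : 0 < `|B| + 1 by rewrite ltr_pwDr.
have [|d1 d10 h1] := hs (e / (`|B| + 1)); first by rewrite divr_gt0.
exists (Num.min d1 d); first by rewrite lt_min d10.
move=> h; rewrite lt_min => /andP[/h1 k1 /hB k2].
rewrite (le_trans k2)// (@le_trans _ _ ((`|B| + 1) * normc (s h)))//.
  by rewrite ler_wpM2r ?normc_ge0// (le_trans (ler_norm _))// lerDl.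
rewrite (le_trans (ler_wpM2l (ltW B1) k1))// mulrA.
by rewrite mulrCA divff ?mulr1// gt_eqF.
Qed.

Lemma smallMl k r (c : C) : small k r -> small k (fun h => c * r h).
Proof.
move=> hr; apply: (@small_bound _ _ r (normc c) 1) => // h _.
by rewrite normcM.
Qed.

Lemma small_ext k r s : r =1 s -> small k r -> small k s.
Proof. by move=> /funext ->. Qed.

Lemma small_conj k r : small k r -> small k (fun h => (r h)^*%C).
Proof.
by move=> hr; apply: (@small_bound _ _ r 1 1) => // h _; rewrite normc_conj mul1r.
Qed.

Lemma small_quadratic r (L d : R) : 0 < d ->
  (forall h, normc h < d -> normc (r h) <= L * normc h ^+ 2) ->
  small (@normc R) r.
Proof.
move=> d0 hL e e0.
have L1 : 0 < `|L| + 1 by rewrite ltr_pwDr.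
exists (Num.min d (e / (`|L| + 1))).
  by rewrite lt_min d0 divr_gt0.
move=> h; rewrite lt_min => /andP[/hL k1 k2].
rewrite (le_trans k1)// expr2 mulrA ler_wpM2r ?normc_ge0//.
rewrite (@le_trans _ _ ((`|L| + 1) * normc h))//.
  by rewrite ler_wpM2r ?normc_ge0// (le_trans (ler_norm _))// lerDl.
by rewrite mulrC -ler_pdivlMr// ltW.
Qed.

(** For the chain rule: [D] is the increment of the inner function, which is O(h), so the remainder
    of the outer function stays o(h). *)
Lemma small_comp r (D : C -> C) (L d : R) : 0 < d ->
  (forall h, normc h < d -> normc (D h) <= L * normc h) ->
  small (@normc R) r -> small (@normc R) (fun h => r (D h)).
Proof.
move=> d0 hD hr e e0.
have L1 : 0 < `|L| + 1 by rewrite ltr_pwDr.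
have hD' h : normc h < d -> normc (D h) <= (`|L| + 1) * normc h.
  move=> /hD /le_trans; apply.
  by rewrite ler_wpM2r ?normc_ge0// (le_trans (ler_norm _))// lerDl.
have [|d1 d10 h1] := hr (e / (`|L| + 1)); first by rewrite divr_gt0.
exists (Num.min d (d1 / (`|L| + 1))).
  by rewrite lt_min d0 divr_gt0.
move=> h; rewrite lt_min => /andP[/hD' k1 k2].
have /h1 k3 : normc (D h) < d1.
  by rewrite (le_lt_trans k1)// mulrC -ltr_pdivlMr.
rewrite (le_trans k3)// -mulrA ler_wpM2l ?(ltW e0)//.
by rewrite mulrC ler_pdivrMr// mulrC.
Qed.

End SmallRemainders.

Section WirtingerDerivatives.
Variable R : realType.
Local Notation C := R[i].
Implicit Types (f g : C -> C) (z a b : C).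

Definition contc f z := small (fun=> 1) (fun h => f (z + h) - f z).

(* a and b are the Wirtinger derivatives of f at z with respect to z and to
   the conjugate of z *)
Definition wirtinger f z a b :=
  small (@normc R) (fun h => f (z + h) - f z - (a * h + b * h^*%C)).

Lemma contcP f z : contc f z <-> forall e : R, 0 < e -> exists2 d : R, 0 < d &
  forall w, normc (w - z) < d -> normc (f w - f z) < e.
Proof.
split=> hf e e0.
  have [|d d0 h] := hf (e / 2); first by rewrite divr_gt0.
  exists d => // w /h; rewrite [z + _]addrC subrK mulr1 => /le_lt_trans; apply.
  by rewrite ltr_pdivrMr// ltr_pMr// ltr1n.
have [d d0 h] := hf _ e0.
by exists d => // k kd; rewrite mulr1 ltW// h// [z + k]addrC addrK.
Qed.

Lemma contc_ext f g z : f =1 g -> contc f z -> contc g z.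
Proof. by move=> /funext ->. Qed.

Lemma contc_cst c z : contc (fun=> c) z.
Proof.
apply: small_ext (small0 (fun=> ler01)) => h /=; by rewrite subrr.
Qed.

Lemma contc_id z : contc id z.
Proof. by apply/contcP => e e0; exists e. Qed.

Lemma contc_add f g z : contc f z -> contc g z -> contc (fun w => f w + g w) z.
Proof.
move=> hf hg; apply: small_ext (smallD hf hg) => h /=; ring.
Qed.

Lemma contc_opp f z : contc f z -> contc (fun w => - f w) z.
Proof. by move=> hf; apply: small_ext (smallMl (-1) hf) => h /=; ring. Qed.

Lemma contc_sub f g z : contc f z -> contc g z -> contc (fun w => f w - g w) z.
Proof. by move=> hf /contc_opp; exact: contc_add. Qed.

Lemma contc_bounded f z : contc f z ->
  exists2 d : R, 0 < d & forall h, normc h < d -> normc (f (z + h)) <= normc (f z) + 1.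
Proof.
move=> /(_ 1 ltr01) [d d0 h]; exists d => // k /h.
rewrite mulr1 => h1; have := normc_lerB (f (z + k)) (f z); lra.
Qed.

Lemma contc_mul f g z : contc f z -> contc g z -> contc (fun w => f w * g w) z.
Proof.
move=> hf hg; have [d d0 hb] := contc_bounded hg.
have h1 : small (fun=> 1) (fun h => (f (z + h) - f z) * g (z + h)).
  apply: (@small_bound _ _ _ (fun h => f (z + h) - f z) (normc (g z) + 1) d) => //.
  move=> h hd; rewrite normcM mulrC ler_wpM2r ?normc_ge0//; exact: hb.
apply: small_ext (smallD h1 (smallMl (f z) hg)) => h /=; ring.
Qed.

Lemma contc_comp f g z : contc f z -> contc g (f z) -> contc (fun w => g (f w)) z.
Proof.
move=> /contcP hf /contcP hg; apply/contcP => e /hg[d d0 h].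
by have [d1 d10 h1] := hf _ d0; exists d1 => // w /h1 /h.
Qed.

Lemma contc_conj f z : contc f z -> contc (fun w => (f w)^*%C) z.
Proof. by move=> /small_conj; apply: small_ext => h; rewrite rmorphB. Qed.

Lemma contc_lip f z (L : R) (d : R) : 0 < d ->
  (forall w, normc (w - z) < d -> normc (f w - f z) <= L * normc (w - z)) ->
  contc f z.
Proof.
move=> d0 hL; apply: (@small_bound _ _ _ id L d) => //.
  move=> h hd; have := hL (z + h); rewrite [z + h]addrC addrK => /(_ hd).
  by rewrite addrC.
by move=> e e0; exists e => // h; rewrite mulr1 => /ltW.
Qed.

Lemma contc_real1 (p : R -> R) f z :
  (forall x y, `|p x - p y| <= `|x - y|) ->
  contc f z -> contc (fun w => (p (complex.Re (f w)))%:C%C) z.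
Proof.
move=> hp /contcP hf; apply/contcP => e /hf[d d0 h]; exists d => // w /h.
apply: le_lt_trans; rewrite -rmorphB normc_real (le_trans (hp _ _))//.
by rewrite -ReN -ReD normRe_le.
Qed.

Lemma contc_normc f z : contc f z -> contc (fun w => (normc (f w))%:C%C) z.
Proof.
move=> /contcP hf; apply/contcP => e /hf[d d0 h]; exists d => // w /h.
apply: le_lt_trans; rewrite -rmorphB normc_real ler_norml; apply/andP; split.
  rewrite normcBC; have := normc_lerB (f z) (f w); lra.
exact: normc_lerB.
Qed.

Lemma contc_inv f z : f z != 0 -> contc f z -> contc (fun w => (f w)^-1) z.
Proof.
move=> fz0 hf; have fz : 0 < normc (f z) by rewrite normc_gt0.
have [|d d0 h] := hf (normc (f z) / 2); first by rewrite divr_gt0.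
have hb k : normc k < d -> normc (f z) / 2 <= normc (f (z + k)).
  move=> /h; rewrite mulr1 normcBC => h1.
  have := normc_lerB (f z) (f (z + k)); lra.
(* The denominator f(z) f(z + k) has modulus at least |f(z)|^2 / 2 by [hb]. *)
apply: (@small_bound _ _ _ (fun h => f (z + h) - f z) (2 / normc (f z) ^+ 2) d) => //.
move=> k /hb hk.
have fk : 0 < normc (f (z + k)) by apply: lt_le_trans hk; rewrite divr_gt0.
have fk0 : f (z + k) != 0 by rewrite -normc_gt0.
have -> : (f (z + k))^-1 - (f z)^-1 = (f z - f (z + k)) / (f z * f (z + k)).
  by field; apply/andP.
rewrite normcM normcBC mulrC ler_wpM2r ?normc_ge0// normcV normcM.
rewrite -[leRHS]invrK lef_pV2 ?posrE ?mulr_gt0 ?invr_gt0 ?divr_gt0 ?exprn_gt0//.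
rewrite invfM invrK [_ ^-1 * _]mulrC expr2 -mulrA ler_wpM2l ?(ltW fz)//.
Qed.

Lemma wirtinger_ext f g z a b : f =1 g -> wirtinger f z a b -> wirtinger g z a b.
Proof. by move=> /funext ->. Qed.

Lemma wirtinger_near f g z a b (d : R) : 0 < d ->
  (forall w, normc (w - z) < d -> f w = g w) ->
  wirtinger f z a b -> wirtinger g z a b.
Proof.
move=> d0 fg fz; apply: (@small_bound _ _ _ _ 1 d) fz => // h hd.
by rewrite mul1r -!fg// ?subrr ?normc0// [z + h]addrC addrK.
Qed.

Lemma wirtinger_eq f z a b a' b' : a = a' -> b = b' ->
  wirtinger f z a b -> wirtinger f z a' b'.
Proof. by move=> -> ->. Qed.

Lemma wirtinger_lip f z a b : wirtinger f z a b ->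
  exists L, exists2 d, 0 < d & forall h, normc h < d ->
  normc (f (z + h) - f z) <= L * normc h.
Proof.
move=> /(_ 1 ltr01) [d d0 h]; exists (1 + normc a + normc b), d => // k /h.
rewrite mul1r => h1.
have h2 : normc (a * k + b * k^*%C) <= (normc a + normc b) * normc k.
  by rewrite (le_trans (normcD _ _))// !normcM normc_conj mulrDl.
have := normc_lerB (f (z + k) - f z) (a * k + b * k^*%C); lra.
Qed.

Lemma wirtinger_cont f z a b : wirtinger f z a b -> contc f z.
Proof.
move=> /wirtinger_lip[L [d d0 h]]; apply: (@contc_lip _ _ L d) => // w hw.
by have := h _ hw; rewrite [z + _]addrC subrK.
Qed.

Lemma wirtinger_cst c z : wirtinger (fun=> c) z 0 0.
Proof.
apply: small_ext (small0 (@normc_ge0 R)) => h /=; ring.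
Qed.

Lemma wirtinger_id z : wirtinger id z 1 0.
Proof. apply: small_ext (small0 (@normc_ge0 R)) => h /=; ring. Qed.

Lemma wirtinger_add f g z a b a' b' : wirtinger f z a b -> wirtinger g z a' b' ->
  wirtinger (fun w => f w + g w) z (a + a') (b + b').
Proof.
by move=> hf hg; apply: small_ext (smallD hf hg) => h /=; ring.
Qed.

Lemma wirtinger_sum (I : Type) (s : seq I) (f : I -> C -> C) (a b : I -> C) z :
  (forall i, wirtinger (f i) z (a i) (b i)) ->
  wirtinger (fun w => \sum_(i <- s) f i w) z (\sum_(i <- s) a i) (\sum_(i <- s) b i).
Proof.
move=> h; elim: s => [|i s IH].
  rewrite !big_nil; apply: wirtinger_ext (wirtinger_cst 0 z) => w.
  by rewrite big_nil.
rewrite !big_cons; apply: wirtinger_ext (wirtinger_add (h i) IH) => w.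
by rewrite big_cons.
Qed.

Lemma wirtinger_mul f g z a b a' b' : wirtinger f z a b -> wirtinger g z a' b' ->
  wirtinger (fun w => f w * g w) z (a * g z + f z * a') (b * g z + f z * b').
Proof.
move=> hf hg.
have [L1 [d1 d10 h1]] := wirtinger_lip hf.
have [L2 [d2 d20 h2]] := wirtinger_lip hg.
(* The product of the two increments is O(|h|^2); everything else is linear in one of the two
   remainders. *)
have h3 : small (@normc R) (fun h => (f (z + h) - f z) * (g (z + h) - g z)).
  apply: (@small_quadratic _ _ (L1 * L2) (Num.min d1 d2)).
    by rewrite lt_min d10.
  move=> h; rewrite lt_min => /andP[/h1 k1 /h2 k2].
  rewrite normcM expr2 mulrACA; apply: ler_pM => //; exact: normc_ge0.
apply: small_ext (smallD (smallD (smallMl (g z) hf) (smallMl (f z) hg)) h3) => h /=.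
ring.
Qed.

Lemma wirtinger_scale c f z a b : wirtinger f z a b ->
  wirtinger (fun w => c * f w) z (c * a) (c * b).
Proof.
by move=> hf; apply: small_ext (smallMl c hf) => h /=; ring.
Qed.

Lemma wirtinger_sub f g z a b a' b' : wirtinger f z a b -> wirtinger g z a' b' ->
  wirtinger (fun w => f w - g w) z (a - a') (b - b').
Proof.
move=> hf /(wirtinger_scale (-1)) hg.
by apply: wirtinger_ext (wirtinger_eq _ _ (wirtinger_add hf hg)) => [w||]; ring.
Qed.

Lemma wirtinger_conj f z a b : wirtinger f z a b ->
  wirtinger (fun w => (f w)^*%C) z b^*%C a^*%C.
Proof.
move=> /small_conj; apply: small_ext => h.
by rewrite !(rmorphB, rmorphD, rmorphM)/= conjcK; ring.
Qed.

(** The coefficient b' of g multiplies the conjugate of the increment of f, and conjugation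
    exchanges the two coefficients of f. *)
Lemma wirtinger_comp f g z a b a' b' : wirtinger f z a b ->
  wirtinger g (f z) a' b' ->
  wirtinger (fun w => g (f w)) z (a' * a + b' * b^*%C) (a' * b + b' * a^*%C).
Proof.
move=> hf hg; have [L [d d0 hL]] := wirtinger_lip hf.
have h1 := small_comp d0 hL hg.
apply: small_ext (smallD h1 (smallD (smallMl a' hf) (smallMl b' (small_conj hf)))).
move=> h /=; rewrite [f z + _]addrC subrK.
by rewrite !(rmorphB, rmorphD, rmorphM)/= conjcK; ring.
Qed.

Lemma wirtinger_inv z : z != 0 -> wirtinger (fun w => w^-1) z (- z ^- 2) 0.
Proof.
move=> z0; have nz : 0 < normc z by rewrite normc_gt0.
(* The remainder is h^2 / (z^2 (z + h)), and |z + h| >= |z| / 2 when |h| < |z| / 2. *)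
apply: (@small_quadratic _ _ (2 / normc z ^+ 3) (normc z / 2)).
  by rewrite divr_gt0.
move=> h hd; have hzh : normc z / 2 <= normc (z + h).
  have := normc_lerB z (- h); rewrite opprK normcN; lra.
have nzh : 0 < normc (z + h) by apply: lt_le_trans hzh; rewrite divr_gt0.
have zh0 : z + h != 0 by rewrite -normc_gt0.
have -> : (z + h)^-1 - z^-1 - (- z ^- 2 * h + 0 * h^*%C) =
  h ^+ 2 / (z ^+ 2 * (z + h)) by field; apply/andP.
rewrite normcM normcX mulrC ler_wpM2r ?exprn_ge0 ?normc_ge0//.
rewrite normcV normcM normcX.
rewrite -[leRHS]invrK lef_pV2 ?posrE ?mulr_gt0 ?invr_gt0 ?divr_gt0 ?exprn_gt0//.
by rewrite invfM invrK [_ ^-1 * _]mulrC exprSr -mulrA ler_wpM2l ?exprn_ge0 ?normc_ge0.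
Qed.

End WirtingerDerivatives.

(** * Integrals over rectangles and Stokes' theorem *)

Section RectangleInduction.
Variable R : realType.

Lemma exp2_unbounded (w d : R) : 0 < d -> exists n, w / 2 ^+ n < d.
Proof.
move=> d0; exists (Num.bound `|w / d|).
rewrite ltr_pdivrMr ?exprn_gt0// mulrC -ltr_pdivrMr//.
apply: (@lt_trans _ _ (Num.bound `|w / d|)%:R).
  by rewrite (le_lt_trans (ler_norm _))// archi_boundP.
by rewrite -natrX ltr_nat ltn_expl.
Qed.

(** The supremum of the left ends works, since every left end lies below every right end. *)
Lemma nested_point (x s : nat -> R) :
  (forall n, x n <= x n.+1) -> (forall n, x n.+1 + s n.+1 <= x n + s n) ->
  (forall n, 0 <= s n) ->
  exists p, forall n, x n <= p <= x n + s n.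
Proof.
move=> hx hs s0.
have mx m n : (m <= n)%N -> x m <= x n.
  elim: n => [|n IH]; first by rewrite leqn0 => /eqP ->.
  by rewrite leq_eqVlt => /predU1P[->//|/IH h]; exact: le_trans h (hx _).
have ms m n : (m <= n)%N -> x n + s n <= x m + s m.
  elim: n => [|n IH]; first by rewrite leqn0 => /eqP ->.
  by rewrite leq_eqVlt => /predU1P[->//|/IH h]; exact: le_trans (hs _) h.
have ub m n : x m <= x n + s n.
  have [mn|nm] := leqP m n.
    by rewrite (le_trans (mx _ _ mn))// lerDl.
  by rewrite (le_trans _ (ms _ _ (ltnW nm)))// lerDl.
have hsup : has_sup (range x).
  by split; [exists (x 0%N), 0%N|exists (x 0%N + s 0%N) => _ [m _ <-]].
exists (sup (range x)) => n; apply/andP; split.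
  by apply: ub_le_sup; [case: hsup|exists n].
by apply: ge_sup; [case: hsup|move=> _ [m _ <-]].
Qed.

(* A property of rectangles that passes from the four quarters to the whole and
   holds for all small homothetic copies around each point holds globally. *)
Lemma rectangle_ind (Q : R -> R -> R -> R -> Prop) (a b c d : R) :
  a <= b -> c <= d ->
  (forall x1 x2 y1 y2, a <= x1 -> x1 <= x2 -> x2 <= b ->
    c <= y1 -> y1 <= y2 -> y2 <= d ->
    let mx := (x1 + x2) / 2 in let my := (y1 + y2) / 2 in
    Q x1 mx y1 my -> Q mx x2 y1 my -> Q x1 mx my y2 -> Q mx x2 my y2 ->
    Q x1 x2 y1 y2) ->
  (forall px py, a <= px <= b -> c <= py <= d ->
    exists2 e : R, 0 < e & forall x1 x2 y1 y2, a <= x1 -> x2 <= b ->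
      c <= y1 -> y2 <= d -> x1 <= px <= x2 -> y1 <= py <= y2 ->
      x2 - x1 < e -> y2 - y1 < e ->
      (x2 - x1) * (d - c) = (y2 - y1) * (b - a) -> Q x1 x2 y1 y2) ->
  Q a b c d.
Proof.
move=> ab cd hsplit hloc; apply/not_notP => nQ.
pose w n : R := (b - a) / 2 ^+ n; pose h n : R := (d - c) / 2 ^+ n.
have w0 n : 0 <= w n by rewrite divr_ge0 ?subr_ge0// exprn_ge0.
have h0 n : 0 <= h n by rewrite divr_ge0 ?subr_ge0// exprn_ge0.
have wS n : w n = w n.+1 + w n.+1.
  by rewrite /w exprS; field; rewrite expf_neq0.
have hS n : h n = h n.+1 + h n.+1.
  by rewrite /h exprS; field; rewrite expf_neq0.
pose P n (p : R * R) := [/\ a <= p.1, p.1 + w n <= b, c <= p.2, p.2 + h n <= d &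
  ~ Q p.1 (p.1 + w n) p.2 (p.2 + h n)].
(* If [Q] fails on a rectangle it fails on one of the quarters. The sigma types turn this into a
   function that can be iterated. *)
have step n (p : {p | P n p}) : {p' : {p | P n.+1 p} |
   [/\ (sval p).1 <= (sval p').1, (sval p').1 + w n.+1 <= (sval p).1 + w n,
       (sval p).2 <= (sval p').2 & (sval p').2 + h n.+1 <= (sval p).2 + h n]}.
  apply: cid; case: p => -[x y] /= [/= ax xb cy yd nq].
  have mxE : (x + (x + w n)) / 2 = x + w n.+1 by rewrite wS; field.
  have myE : (y + (y + h n)) / 2 = y + h n.+1 by rewrite hS; field.
  have [hw hh] := (w0 n.+1, h0 n.+1).
  have [wn hn] := (wS n, hS n).
  apply/not_notP => hN; apply: nq; apply: hsplit => //; rewrite ?lerDl// /= mxE myE.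
  - apply/not_notP => nq.
    have p' : P n.+1 (x, y) by split => //=; lra.
    by apply: hN; exists (exist _ _ p'); split => /=; lra.
  - apply/not_notP => nq.
    have p' : P n.+1 (x + w n.+1, y).
      split => /=; [lra|lra|lra|lra|].
      by rewrite -addrA -wS.
    by apply: hN; exists (exist _ _ p'); split => /=; lra.
  - apply/not_notP => nq.
    have p' : P n.+1 (x, y + h n.+1).
      split => /=; [lra|lra|lra|lra|].
      by rewrite -addrA -hS.
    by apply: hN; exists (exist _ _ p'); split => /=; lra.
  - apply/not_notP => nq.
    have p' : P n.+1 (x + w n.+1, y + h n.+1).
      split => /=; [lra|lra|lra|lra|].
      by rewrite -!addrA -hS -wS.
    by apply: hN; exists (exist _ _ p'); split => /=; lra.
have P0 : P 0%N (a, c).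
  have w0E : w 0%N = b - a by rewrite /w expr0 divr1.
  have h0E : h 0%N = d - c by rewrite /h expr0 divr1.
  by split => //=; rewrite ?w0E ?h0E ?(addrC a) ?(addrC c) ?subrK.
pose sq := nat_rect (fun n => {p | P n p}) (exist _ _ P0) (fun n p => sval (step n p)).
have sqS n := svalP (step n (sq n)).
have [px hpx] : exists px, forall n, (sval (sq n)).1 <= px <= (sval (sq n)).1 + w n.
  by apply: nested_point => // n; have [] := sqS n.
have [py hpy] : exists py, forall n, (sval (sq n)).2 <= py <= (sval (sq n)).2 + h n.
  by apply: nested_point => // n; have [] := sqS n.
have [||e e0 he] := hloc px py.
  have [h1 h2 h3 h4 _] := svalP (sq 0%N); have := hpx 0%N; lra.
  have [h1 h2 h3 h4 _] := svalP (sq 0%N); have := hpy 0%N; lra.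
have [n1 hn1] := exp2_unbounded (b - a) e0.
have [n2 hn2] := exp2_unbounded (d - c) e0.
pose n := maxn n1 n2.
have wn : w n < e.
  apply: le_lt_trans hn1; rewrite /w ler_wpM2l ?subr_ge0// lef_pV2 ?posrE ?exprn_gt0//.
  by rewrite ler_eXn2l ?ltr1n// leq_maxl.
have hn : h n < e.
  apply: le_lt_trans hn2; rewrite /h ler_wpM2l ?subr_ge0// lef_pV2 ?posrE ?exprn_gt0//.
  by rewrite ler_eXn2l ?ltr1n// leq_maxr.
have [/= h1 h2 h3 h4 h5] := svalP (sq n).
apply: h5; apply: he; rewrite ?[_ + w n - _]addrAC ?[_ + h n - _]addrAC ?subrr ?add0r//.
by rewrite /w /h; ring.
Qed.

End RectangleInduction.

Section SegmentIntegral.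
Variable R : realType.
Local Notation mu := (@lebesgue_measure R).
Implicit Types (a b c d : R) (g : R -> R).

Definition cont_itv a b g := forall x, a <= x <= b -> forall e, 0 < e ->
  exists2 d, 0 < d & forall y, a <= y <= b -> `|y - x| < d -> `|g y - g x| < e.

Definition rint a b g : R := \int[mu]_(x in `[a, b]) g x.

Lemma cont_itv_within a b g : cont_itv a b g -> {within `[a, b], continuous g}.
Proof.
move=> hg; apply/subspace_continuousP => x; rewrite /= in_itv/= => xab.
apply/cvgrPdist_lt => e e0; have [d d0 h] := hg x xab e e0.
rewrite near_withinE; apply/nbhs_ballP; exists d => //= y.
rewrite /ball/= => xy; rewrite in_itv/= => yab.
by rewrite distrC h// distrC.
Qed.

Lemma cont_itv_integrable a b g : cont_itv a b g ->
  mu.-integrable `[a, b] (EFin \o g).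
Proof.
move=> /cont_itv_within; apply: continuous_compact_integrable.
exact: segment_compact.
Qed.
Hint Resolve cont_itv_integrable : core.

Lemma cont_itv_sub a b a' b' g : a <= a' -> b' <= b ->
  cont_itv a b g -> cont_itv a' b' g.
Proof.
move=> aa bb hg x /andP[x1 x2] e e0.
have [|d d0 h] := hg x _ e e0; first by rewrite (le_trans aa)//= (le_trans _ bb).
exists d => // y /andP[y1 y2]; apply: h.
by rewrite (le_trans aa)//= (le_trans _ bb).
Qed.

Lemma cont_itv_cst a b c : cont_itv a b (fun=> c).
Proof. by move=> x _ e e0; exists 1 => // y _ _; rewrite subrr normr0. Qed.

Lemma cont_itv_scale a b k g : cont_itv a b g -> cont_itv a b (fun x => k * g x).
Proof.
move=> hg x xab e e0; have k1 : 0 < `|k| + 1 by rewrite ltr_pwDr.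
have [|d d0 h] := hg x xab (e / (`|k| + 1)); first by rewrite divr_gt0.
exists d => // y yab /(h _ yab); rewrite -mulrBr normrM ltr_pdivlMr// mulrC.
apply: le_lt_trans; rewrite ler_wpM2r// lerDl//.
Qed.

Lemma rint_ge0 a b g : (forall x, a <= x <= b -> 0 <= g x) -> 0 <= rint a b g.
Proof. by move=> h; apply: Rintegral_ge0 => x; rewrite /= in_itv; exact: h. Qed.

Lemma rint_ext a b f g : (forall x, a <= x <= b -> f x = g x) ->
  rint a b f = rint a b g.
Proof. by move=> h; apply: eq_Rintegral => x; rewrite inE/= in_itv; exact: h. Qed.

Lemma rint_cst a b k : a <= b -> rint a b (fun=> k) = (b - a) * k.
Proof.
move=> ab; rewrite /rint Rintegral_cst; last exact: measurable_itv.
have := @lebesgue_measure_itv R (Interval (BLeft a) (BRight b)); rewrite /= lte_fin => ->.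
rewrite mulrC; congr (_ * _); case: ltgtP ab => //= -> _.
by rewrite subrr.
Qed.

Lemma rintD a b f g : cont_itv a b f -> cont_itv a b g ->
  rint a b (fun x => f x + g x) = rint a b f + rint a b g.
Proof. by move=> hf hg; rewrite /rint RintegralD//; exact: cont_itv_integrable. Qed.

Lemma rintZ a b k g : cont_itv a b g ->
  rint a b (fun x => k * g x) = k * rint a b g.
Proof. by move=> hg; rewrite /rint RintegralZl//; exact: cont_itv_integrable. Qed.

Lemma rint_le a b f g : cont_itv a b f -> cont_itv a b g ->
  (forall x, a <= x <= b -> f x <= g x) -> rint a b f <= rint a b g.
Proof.
move=> hf hg h; apply: le_Rintegral; first exact: measurable_itv.
- exact: cont_itv_integrable.
- exact: cont_itv_integrable.
by move=> x; rewrite /= in_itv; exact: h.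
Qed.

Lemma rint_cat a m b g : a <= m -> m <= b -> cont_itv a b g ->
  rint a b g = rint a m g + rint m b g.
Proof.
move=> am mb hg; have := @Rintegral_itvB R g (BLeft a) (BRight b) m.
rewrite !bnd_simp => /(_ (cont_itv_integrable hg) am mb) h.
rewrite /rint -(@Rintegral_itv_obnd_cbnd _ m).
  by rewrite -h addrC subrK.
apply: (@integrableS _ _ _ mu `[a, b]) => //; last exact: cont_itv_integrable.
by apply: subset_itvr; rewrite bnd_simp.
Qed.

Lemma rint_bound a b g k e : a <= b -> cont_itv a b g ->
  (forall x, a <= x <= b -> `|g x - k| <= e) ->
  `|rint a b g - (b - a) * k| <= (b - a) * e.
Proof.
move=> ab hg h.
have h1 : rint a b g <= (b - a) * (k + e).
  rewrite -rint_cst//; apply: rint_le => //; first exact: cont_itv_cst.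
  by move=> x /h; rewrite ler_distl => /andP[].
have h2 : (b - a) * (k - e) <= rint a b g.
  rewrite -rint_cst//; apply: rint_le => //; first exact: cont_itv_cst.
  by move=> x /h; rewrite ler_distl => /andP[].
by rewrite ler_distl -mulrBr -mulrDr h1 h2.
Qed.

(** Cutting at x0 - r and x0 + r, as far as these lie inside [a, b], leaves one piece of length at
    most 2 r where g may be nonzero. The cases are the positions of the two cuts. *)
Lemma rint_small_support a b g x0 r B : 0 <= B -> 0 <= r -> cont_itv a b g ->
  (forall x, a <= x <= b -> g x <= B) ->
  (forall x, a <= x <= b -> r <= `|x - x0| -> g x = 0) ->
  a <= b -> rint a b g <= 2 * r * B.
Proof.
move=> B0 r0 hg gB gs ab.
have zero u v : a <= u -> u <= v -> v <= b ->
    (forall x, u <= x <= v -> r <= `|x - x0|) -> rint u v g = 0.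
  move=> au uv vb h; rewrite (@rint_ext _ _ _ (fun=> 0)).
    by rewrite rint_cst// mulr0.
  move=> x xuv; apply: gs; last exact: h.
  by have /andP[xu xv] := xuv; rewrite (le_trans au)//= (le_trans xv).
have rB : 0 <= 2 * r * B by rewrite !mulr_ge0.
have mid u v : a <= u -> u <= v -> v <= b -> v - u <= 2 * r ->
    rint u v g <= 2 * r * B.
  move=> au uv vb h; apply: (@le_trans _ _ ((v - u) * B)); last by rewrite ler_wpM2r.
  rewrite -rint_cst//; apply: rint_le; [exact: cont_itv_sub hg|exact: cont_itv_cst|].
  by move=> x /andP[xu xv]; apply: gB; rewrite (le_trans au)//= (le_trans xv).
have right u : a <= u -> u <= b -> x0 - r <= u -> rint u b g <= 2 * r * B.
  move=> au ub hu; have [h|h] := leP b (x0 + r).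
    by apply: mid => //; lra.
  have [h'|h'] := leP u (x0 + r).
    rewrite (rint_cat h' (ltW h) (cont_itv_sub au (lexx b) hg)).
    rewrite (zero (x0 + r) b) ?addr0//; last first.
      by move=> x xx; rewrite ger0_norm; lra.
    - exact: ltW.
    - lra.
    by apply: mid => //; [exact: ltW|lra].
  rewrite zero// => x xx; rewrite ger0_norm; lra.
have [h|h] := leP (x0 - r) a; first exact: right.
have [h'|h'] := leP (x0 - r) b.
  rewrite (rint_cat (ltW h) h' hg) (zero a (x0 - r)) ?add0r//.
  - by apply: right => //; exact: ltW.
  - exact: ltW.
  by move=> x xx; rewrite ler0_norm; lra.
by rewrite zero// => x xx; rewrite ler0_norm; lra.
Qed.

End SegmentIntegral.

Section PlaneIntegrals.
Variable R : realType.
Local Notation C := R[i].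
Implicit Types (a b c d : R).

Definition rect a b c d : set C :=
  [set z | a <= complex.Re z <= b /\ c <= complex.Im z <= d].

Definition cont_rect a b c d (f : C -> C) := forall z, rect a b c d z -> contc f z.

Lemma rect_mkc a b c d x y : a <= x <= b -> c <= y <= d -> rect a b c d (mkc x y).
Proof. by []. Qed.

Lemma rect_sub a b c d a' b' c' d' z : a <= a' -> b' <= b -> c <= c' -> d' <= d ->
  rect a' b' c' d' z -> rect a b c d z.
Proof.
by move=> h1 h2 h3 h4 [/andP[h5 h6] /andP[h7 h8]]; split; apply/andP; split;
  [exact: le_trans h5|exact: le_trans h2|exact: le_trans h7|exact: le_trans h4].
Qed.

Lemma cont_rect_sub a b c d a' b' c' d' f : a <= a' -> b' <= b -> c <= c' -> d' <= d ->
  cont_rect a b c d f -> cont_rect a' b' c' d' f.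
Proof. by move=> h1 h2 h3 h4 hf z hz; apply: hf; exact: rect_sub hz. Qed.

Lemma normc_rect_lt a b c d p z (e : R) : rect a b c d p -> rect a b c d z ->
  b - a < e / 2 -> d - c < e / 2 -> normc (z - p) < e.
Proof.
move=> [p1 p2] [z1 z2] h1 h2; rewrite (le_lt_trans (normc_le_ReIm _))//.
rewrite ReD ImD ReN ImN.
have k1 : `|complex.Re z - complex.Re p| <= b - a by rewrite ler_norml; lra.
have k2 : `|complex.Im z - complex.Im p| <= d - c by rewrite ler_norml; lra.
lra.
Qed.

(** This form takes the place of compactness of the rectangle: uniform continuity, boundedness and
    the extraction of finite covers are all derived from it. *)
Lemma rect_ind a b c d (Q : R -> R -> R -> R -> Prop) : a <= b -> c <= d ->
  (forall x1 x2 y1 y2, a <= x1 -> x1 <= x2 -> x2 <= b ->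
    c <= y1 -> y1 <= y2 -> y2 <= d ->
    let mx := (x1 + x2) / 2 in let my := (y1 + y2) / 2 in
    Q x1 mx y1 my -> Q mx x2 y1 my -> Q x1 mx my y2 -> Q mx x2 my y2 ->
    Q x1 x2 y1 y2) ->
  (forall p, rect a b c d p ->
    exists2 e : R, 0 < e & forall x1 x2 y1 y2, a <= x1 -> x2 <= b ->
      c <= y1 -> y2 <= d -> rect x1 x2 y1 y2 p ->
      (forall z, rect x1 x2 y1 y2 z -> normc (z - p) < e) ->
      Q x1 x2 y1 y2) ->
  Q a b c d.
Proof.
move=> ab cd hs hl; apply: (rectangle_ind ab cd hs) => px py hx hy.
have [e e0 h] := hl (mkc px py) (rect_mkc hx hy).
exists (e / 2); first by rewrite divr_gt0.
move=> x1 x2 y1 y2 h1 h2 h3 h4 h5 h6 h7 h8 _; apply: h => // z hz.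
exact: (normc_rect_lt (rect_mkc h5 h6) hz).
Qed.

Lemma rect_quarters (P : C -> Prop) x1 x2 y1 y2 :
  let mx := (x1 + x2) / 2 in let my := (y1 + y2) / 2 in
  (forall z, rect x1 mx y1 my z -> P z) -> (forall z, rect mx x2 y1 my z -> P z) ->
  (forall z, rect x1 mx my y2 z -> P z) -> (forall z, rect mx x2 my y2 z -> P z) ->
  forall z, rect x1 x2 y1 y2 z -> P z.
Proof.
move=> mx my h1 h2 h3 h4 z [/andP[z1 z2] /andP[z3 z4]].
have [k1|k1] := leP (complex.Re z) mx; have [k2|k2] := leP (complex.Im z) my.
- by apply: h1; split; apply/andP.
- by apply: h3; split; apply/andP => //; split => //; exact: ltW.
- by apply: h2; split; apply/andP => //; split => //; exact: ltW.
- by apply: h4; split; apply/andP => //; split => //; exact: ltW.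
Qed.

(** [contc] is continuity in the whole plane, so [w] may lie outside the rectangle. Locally, both
    points are compared with the centre p at tolerance e / 2. *)
Lemma uniform_cont_rect a b c d f (e : R) : a <= b -> c <= d ->
  cont_rect a b c d f -> 0 < e ->
  exists2 r : R, 0 < r & forall z w, rect a b c d z -> normc (w - z) < r ->
    normc (f w - f z) < e.
Proof.
move=> ab cd hf e0; pose Q x1 x2 y1 y2 := exists2 r : R, 0 < r &
  forall z, rect x1 x2 y1 y2 z -> forall w, normc (w - z) < r -> normc (f w - f z) < e.
suff [r r0 h] : Q a b c d by exists r => // z w hz; exact: h.
apply: rect_ind => //.
  move=> x1 x2 y1 y2 _ _ _ _ _ _ mx my [r1 r10 h1] [r2 r20 h2] [r3 r30 h3] [r4 r40 h4].
  exists (Num.min (Num.min r1 r2) (Num.min r3 r4)); first by rewrite !lt_min r10 r20 r30.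
  apply: rect_quarters => z hz w; rewrite !lt_min => /andP[/andP[? ?] /andP[? ?]];
    by [exact: h1|exact: h2|exact: h3|exact: h4].
move=> p hp; have e2 : 0 < e / 2 by rewrite divr_gt0.
have /contcP/(_ _ e2)[r r0 h] := hf p hp.
exists (r / 2); first by rewrite divr_gt0.
move=> x1 x2 y1 y2 _ _ _ _ _ hs; exists (r / 2); first by rewrite divr_gt0.
move=> z /hs hz w hw.
have -> : f w - f z = (f w - f p) - (f z - f p) by ring.
have k1 : normc (f w - f p) < e / 2.
  apply: h; have -> : w - p = (w - z) + (z - p) by ring.
  by rewrite (le_lt_trans (normcD _ _))//; lra.
have k2 : normc (f z - f p) < e / 2 by apply: h; lra.
by rewrite (le_lt_trans (normcB _ _))//; lra.
Qed.

Lemma bounded_rect a b c d f : a <= b -> c <= d -> cont_rect a b c d f ->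
  exists2 B : R, 0 <= B & forall z, rect a b c d z -> normc (f z) <= B.
Proof.
move=> ab cd hf; pose Q x1 x2 y1 y2 := exists2 B : R, 0 <= B &
  forall z, rect x1 x2 y1 y2 z -> normc (f z) <= B.
suff : Q a b c d by [].
apply: rect_ind => //.
  move=> x1 x2 y1 y2 _ _ _ _ _ _ mx my [r1 r10 h1] [r2 r20 h2] [r3 r30 h3] [r4 r40 h4].
  exists (r1 + r2 + r3 + r4); first by rewrite !addr_ge0.
  apply: rect_quarters => z; [move=> /h1|move=> /h2|move=> /h3|move=> /h4]; lra.
move=> p hp; have /contc_bounded[r r0 h] := hf p hp.
exists r => // x1 x2 y1 y2 _ _ _ _ _ hs; exists (normc (f p) + 1).
  by rewrite addr_ge0// normc_ge0.
by move=> z /hs /h; rewrite [p + _]addrC subrK.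
Qed.

Implicit Types (g : R -> C).

Definition cont_seg a b g := forall x, a <= x <= b -> forall e : R, 0 < e ->
  exists2 r : R, 0 < r & forall y, a <= y <= b -> `|y - x| < r ->
    normc (g y - g x) < e.

Definition cint a b g : C :=
  mkc (rint a b (fun x => complex.Re (g x))) (rint a b (fun x => complex.Im (g x))).

Lemma cont_seg_Re a b g : cont_seg a b g -> cont_itv a b (fun x => complex.Re (g x)).
Proof.
move=> hg x xab e e0; have [r r0 h] := hg x xab e e0; exists r => // y yab /(h _ yab).
by apply: le_lt_trans; rewrite -ReN -ReD normRe_le.
Qed.

Lemma cont_seg_Im a b g : cont_seg a b g -> cont_itv a b (fun x => complex.Im (g x)).
Proof.
move=> hg x xab e e0; have [r r0 h] := hg x xab e e0; exists r => // y yab /(h _ yab).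
by apply: le_lt_trans; rewrite -ImN -ImD normIm_le.
Qed.

Lemma cont_seg_sub a b a' b' g : a <= a' -> b' <= b ->
  cont_seg a b g -> cont_seg a' b' g.
Proof.
move=> aa bb hg x /andP[x1 x2] e e0.
have [|d d0 h] := hg x _ e e0; first by rewrite (le_trans aa)//= (le_trans _ bb).
exists d => // y /andP[y1 y2]; apply: h.
by rewrite (le_trans aa)//= (le_trans _ bb).
Qed.

Lemma cont_seg_add a b f g : cont_seg a b f -> cont_seg a b g ->
  cont_seg a b (fun x => f x + g x).
Proof.
move=> hf hg x xab e e0; have e2 : 0 < e / 2 by rewrite divr_gt0.
have [d d0 h] := hf x xab _ e2; have [d' d0' h'] := hg x xab _ e2.
exists (Num.min d d'); first by rewrite lt_min d0.
move=> y yab; rewrite lt_min => /andP[/(h _ yab) h1 /(h' _ yab) h2].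
have -> : f y + g y - (f x + g x) = (f y - f x) + (g y - g x) by ring.
by rewrite (le_lt_trans (normcD _ _))//; lra.
Qed.

Lemma cont_seg_scale a b k g : cont_seg a b g -> cont_seg a b (fun x => k * g x).
Proof.
move=> hg x xab e e0; have k1 : 0 < normc k + 1 by rewrite ltr_pwDr ?normc_ge0.
have [|d d0 h] := hg x xab (e / (normc k + 1)); first by rewrite divr_gt0.
exists d => // y yab /(h _ yab); rewrite -mulrBr normcM ltr_pdivlMr// mulrC.
by apply: le_lt_trans; rewrite ler_wpM2r ?normc_ge0// lerDl.
Qed.

Lemma cont_seg_sub2 a b f g : cont_seg a b f -> cont_seg a b g ->
  cont_seg a b (fun x => f x - g x).
Proof.
move=> hf /(cont_seg_scale (-1)) hg.
have := cont_seg_add hf hg; congr (cont_seg _ _ _).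
by apply/funext => x; rewrite mulN1r.
Qed.

Lemma cont_seg_cst a b k : cont_seg a b (fun=> k).
Proof. by move=> x _ e e0; exists 1 => // y _ _; rewrite subrr normc0. Qed.

Lemma cint_ext a b f g : (forall x, a <= x <= b -> f x = g x) -> cint a b f = cint a b g.
Proof. by move=> h; rewrite /cint; congr mkc; apply: rint_ext => x /h ->. Qed.

Lemma cintD a b f g : cont_seg a b f -> cont_seg a b g ->
  cint a b (fun x => f x + g x) = cint a b f + cint a b g.
Proof.
move=> hf hg; rewrite /cint /mkc; apply: complexP => /=.
  under rint_ext do rewrite ReD.
  by apply: rintD; exact: cont_seg_Re.
under rint_ext do rewrite ImD.
by apply: rintD; exact: cont_seg_Im.
Qed.

Lemma cintZ a b k g : cont_seg a b g -> cint a b (fun x => k * g x) = k * cint a b g.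
Proof.
move=> hg; have h1 := cont_seg_Re hg; have h2 := cont_seg_Im hg.
rewrite /cint /mkc; apply: complexP; rewrite ?ReM ?ImM/=.
  under rint_ext do rewrite ReM -mulNr.
  by rewrite rintD ?rintZ ?mulNr//; exact: cont_itv_scale.
under rint_ext do rewrite ImM.
by rewrite rintD ?rintZ//; exact: cont_itv_scale.
Qed.

Lemma cintB a b f g : cont_seg a b f -> cont_seg a b g ->
  cint a b (fun x => f x - g x) = cint a b f - cint a b g.
Proof.
move=> hf hg.
rewrite (@cint_ext _ _ _ (fun x => f x + (-1) * g x)); last by move=> x _; ring.
rewrite cintD ?cintZ//; first by ring.
exact: cont_seg_scale.
Qed.

Lemma cint_cst a b k : a <= b -> cint a b (fun=> k) = (b - a)%:C%C * k.
Proof.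
by move=> ab; rewrite /cint !rint_cst//; apply: complexP; rewrite ?ReM ?ImM/= mul0r ?subr0 ?addr0.
Qed.

Lemma cint_cat a m b g : a <= m -> m <= b -> cont_seg a b g ->
  cint a b g = cint a m g + cint m b g.
Proof.
move=> am mb hg; apply: complexP; rewrite ?ReD ?ImD/=; apply: rint_cat => //.
  exact: cont_seg_Re.
exact: cont_seg_Im.
Qed.

(** The factor 2 comes from estimating the real and the imaginary part separately; in [dint_bound]
    it occurs twice. *)
Lemma cint_bound a b g k (e : R) : a <= b -> cont_seg a b g ->
  (forall x, a <= x <= b -> normc (g x - k) <= e) ->
  normc (cint a b g - (b - a)%:C%C * k) <= 2 * (b - a) * e.
Proof.
move=> ab hg h; rewrite (le_trans (normc_le_ReIm _))// ReD ImD ReN ImN ReM ImM/=.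
rewrite !mul0r subr0 addr0.
have h1 : `|rint a b (fun x => complex.Re (g x)) - (b - a) * complex.Re k| <= (b - a) * e.
  apply: rint_bound => //; first exact: cont_seg_Re.
  by move=> x /h; apply: le_trans; rewrite -ReN -ReD normRe_le.
have h2 : `|rint a b (fun x => complex.Im (g x)) - (b - a) * complex.Im k| <= (b - a) * e.
  apply: rint_bound => //; first exact: cont_seg_Im.
  by move=> x /h; apply: le_trans; rewrite -ImN -ImD normIm_le.
lra.
Qed.

Lemma cint_le a b g (e : R) : a <= b -> cont_seg a b g ->
  (forall x, a <= x <= b -> normc (g x) <= e) -> normc (cint a b g) <= 2 * (b - a) * e.
Proof.
move=> ab hg h; have := @cint_bound a b g 0 e ab hg.
by rewrite mulr0 subr0; apply => x /h; rewrite subr0.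
Qed.

Lemma cint_sum (I : Type) (s : seq I) a b (g : I -> R -> C) : a <= b ->
  (forall i, cont_seg a b (g i)) ->
  cont_seg a b (fun x => \sum_(i <- s) g i x) /\
  cint a b (fun x => \sum_(i <- s) g i x) = \sum_(i <- s) cint a b (g i).
Proof.
move=> ab hg; elim: s => [|i s [IH1 IH2]].
  have -> : (fun x => \sum_(i <- [::]) g i x) = (fun=> 0).
    by apply/funext => x; rewrite big_nil.
  by rewrite big_nil cint_cst// mulr0; split => //; exact: cont_seg_cst.
have -> : (fun x => \sum_(j <- i :: s) g j x) =
          (fun x => g i x + \sum_(j <- s) g j x).
  by apply/funext => x; rewrite big_cons.
split; first exact: cont_seg_add.
by rewrite cintD// IH2 big_cons.
Qed.


Lemma cont_hor a b c d f y : cont_rect a b c d f -> c <= y <= d ->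
  cont_seg a b (fun x => f (mkc x y)).
Proof.
move=> hf yc x xab e e0; have /contcP/(_ _ e0)[r r0 h] := hf _ (rect_mkc xab yc).
exists r => // x' _ xx; apply: h; rewrite mkcB subrr.
by rewrite (le_lt_trans (normc_mkc_le _ _))// normr0 addr0.
Qed.

Lemma cont_ver a b c d f x : cont_rect a b c d f -> a <= x <= b ->
  cont_seg c d (fun y => f (mkc x y)).
Proof.
move=> hf xab y ycd e e0; have /contcP/(_ _ e0)[r r0 h] := hf _ (rect_mkc xab ycd).
exists r => // y' _ yy; apply: h; rewrite mkcB subrr.
by rewrite (le_lt_trans (normc_mkc_le _ _))// normr0 add0r.
Qed.

Lemma cont_cint_ver a b c d f : a <= b -> c <= d -> cont_rect a b c d f ->
  cont_seg a b (fun x => cint c d (fun y => f (mkc x y))).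
Proof.
move=> ab cd hf x xab e e0.
have k0 : 0 < 2 * (d - c) + 1 by have := cd; lra.
have e1 : 0 < e / (2 * (d - c) + 1) by rewrite divr_gt0.
have [r r0 h] := uniform_cont_rect ab cd hf e1; exists r => // x' x'ab xx.
rewrite -cintB; try exact: cont_ver hf _.
apply: (@le_lt_trans _ _ (2 * (d - c) * (e / (2 * (d - c) + 1)))).
  apply: cint_le => //; first by apply: cont_seg_sub2; exact: cont_ver hf _.
  move=> y ycd; apply/ltW/h; first exact: rect_mkc.
  by rewrite mkcB subrr (le_lt_trans (normc_mkc_le _ _))// normr0 addr0.
rewrite mulrA ltr_pdivrMr// mulrC ltr_pM2l//; lra.
Qed.

Definition dint a b c d (f : C -> C) : C :=
  cint a b (fun x => cint c d (fun y => f (mkc x y))).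

Lemma dintZ a b c d k f : a <= b -> c <= d -> cont_rect a b c d f ->
  dint a b c d (fun z => k * f z) = k * dint a b c d f.
Proof.
move=> ab cd hf; rewrite /dint -cintZ; last exact: cont_cint_ver.
by apply: cint_ext => x xab; apply: cintZ; exact: cont_ver hf _.
Qed.

Lemma dint_catx a m b c d f : a <= m -> m <= b -> c <= d -> cont_rect a b c d f ->
  dint a b c d f = dint a m c d f + dint m b c d f.
Proof.
move=> am mb cd hf; apply: cint_cat => //; apply: cont_cint_ver => //.
exact: le_trans mb.
Qed.

Lemma dint_caty a b c m d f : a <= b -> c <= m -> m <= d -> cont_rect a b c d f ->
  dint a b c d f = dint a b c m f + dint a b m d f.
Proof.
move=> ab cm md hf; have cd := le_trans cm md.
rewrite /dint -cintD; last 2 first.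
- by apply: cont_cint_ver => //; apply: cont_rect_sub hf.
- by apply: cont_cint_ver => //; apply: cont_rect_sub hf.
by apply: cint_ext => x xab; apply: cint_cat => //; exact: cont_ver hf _.
Qed.

Lemma dint_bound a b c d f (k : C) (e : R) : a <= b -> c <= d -> cont_rect a b c d f ->
  (forall z, rect a b c d z -> normc (f z - k) <= e) ->
  normc (dint a b c d f - ((b - a) * (d - c))%:C%C * k) <= 4 * ((b - a) * (d - c)) * e.
Proof.
move=> ab cd hf h.
have -> : ((b - a) * (d - c))%:C%C * k = (b - a)%:C%C * ((d - c)%:C%C * k).
  by rewrite rmorphM mulrA.
have -> : 4 * ((b - a) * (d - c)) * e = 2 * (b - a) * (2 * (d - c) * e) by ring.
apply: cint_bound => //; first exact: cont_cint_ver.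
move=> x xab; apply: cint_bound => //; first exact: cont_ver hf _.
by move=> y ycd; apply: h.
Qed.

End PlaneIntegrals.

Section RealPlaneIntegrals.
Variable R : realType.
Local Notation C := R[i].
Implicit Types (a b c d : R) (g : C -> R).

Definition rdint a b c d g : R := rint a b (fun x => rint c d (fun y => g (mkc x y))).

Definition cont_rectR a b c d g := cont_rect a b c d (fun z => (g z)%:C%C).

Lemma rdintE a b c d g : rdint a b c d g = complex.Re (dint a b c d (fun z => (g z)%:C%C)).
Proof. by []. Qed.

Lemma cont_rectR_add a b c d g h : cont_rectR a b c d g -> cont_rectR a b c d h ->
  cont_rectR a b c d (fun z => g z + h z).
Proof.
move=> hg hh z hz; apply: contc_ext (contc_add (hg z hz) (hh z hz)) => w.
by rewrite -rmorphD.
Qed.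

Lemma cont_rectR_mul a b c d g h : cont_rectR a b c d g -> cont_rectR a b c d h ->
  cont_rectR a b c d (fun z => g z * h z).
Proof.
move=> hg hh z hz; apply: contc_ext (contc_mul (hg z hz) (hh z hz)) => w.
by rewrite -rmorphM.
Qed.

Lemma cont_rectR_cst a b c d k : cont_rectR a b c d (fun=> k).
Proof. by move=> z _; exact: contc_cst. Qed.

Lemma cont_rectR_sum (I : Type) (s : seq I) a b c d (g : I -> C -> R) :
  (forall i, cont_rectR a b c d (g i)) ->
  cont_rectR a b c d (fun z => \sum_(i <- s) g i z).
Proof.
move=> hg; elim: s => [|i s IH].
  have -> : (fun z => \sum_(i <- [::]) g i z) = (fun=> 0).
    by apply/funext => x; rewrite big_nil.
  exact: cont_rectR_cst.
have -> : (fun x => \sum_(j <- i :: s) g j x) =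
          (fun x => g i x + \sum_(j <- s) g j x).
  by apply/funext => x; rewrite big_cons.
exact: cont_rectR_add.
Qed.

Lemma cont_rectR_ver a b c d g x : cont_rectR a b c d g -> a <= x <= b ->
  cont_itv c d (fun y => g (mkc x y)).
Proof. by move=> hg xab; have := cont_seg_Re (cont_ver hg xab). Qed.

Lemma cont_rectR_rint a b c d g : a <= b -> c <= d -> cont_rectR a b c d g ->
  cont_itv a b (fun x => rint c d (fun y => g (mkc x y))).
Proof. by move=> ab cd hg; have := cont_seg_Re (cont_cint_ver ab cd hg). Qed.

Lemma cont_rectR_normc a b c d f : cont_rect a b c d f ->
  cont_rectR a b c d (fun z => normc (f z)).
Proof. by move=> hf z hz; apply: contc_normc; exact: hf. Qed.

Lemma rdint_le a b c d g h : a <= b -> c <= d -> cont_rectR a b c d g ->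
  cont_rectR a b c d h -> (forall z, rect a b c d z -> g z <= h z) ->
  rdint a b c d g <= rdint a b c d h.
Proof.
move=> ab cd hg hh gh; apply: rint_le; try exact: cont_rectR_rint.
move=> x xab; apply: rint_le; [exact: cont_rectR_ver hg _|exact: cont_rectR_ver hh _|].
by move=> y ycd; apply: gh.
Qed.

Lemma rdint_ge0 a b c d g : (forall z, rect a b c d z -> 0 <= g z) ->
  0 <= rdint a b c d g.
Proof. by move=> h; apply: rint_ge0 => x xab; apply: rint_ge0 => y ycd; apply: h. Qed.

Lemma rdint_ext a b c d g h : (forall z, rect a b c d z -> g z = h z) ->
  rdint a b c d g = rdint a b c d h.
Proof. by move=> e; apply: rint_ext => x xab; apply: rint_ext => y ycd; apply: e. Qed.

Lemma rdint_cst a b c d k : a <= b -> c <= d ->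
  rdint a b c d (fun=> k) = (b - a) * (d - c) * k.
Proof. by move=> ab cd; rewrite /rdint rint_cst// rint_cst// mulrA. Qed.

Lemma rdintD a b c d g h : a <= b -> c <= d -> cont_rectR a b c d g ->
  cont_rectR a b c d h ->
  rdint a b c d (fun z => g z + h z) = rdint a b c d g + rdint a b c d h.
Proof.
move=> ab cd hg hh; rewrite /rdint -rintD; try exact: cont_rectR_rint.
apply: rint_ext => x xab; apply: rintD; [exact: cont_rectR_ver hg _|exact: cont_rectR_ver hh _].
Qed.

Lemma rdintZ a b c d k g : a <= b -> c <= d -> cont_rectR a b c d g ->
  rdint a b c d (fun z => k * g z) = k * rdint a b c d g.
Proof.
move=> ab cd hg; rewrite /rdint -rintZ; last exact: cont_rectR_rint.
by apply: rint_ext => x xab; apply: rintZ; exact: cont_rectR_ver hg _.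
Qed.

Lemma rdint_sum (I : Type) (s : seq I) a b c d (g : I -> C -> R) : a <= b -> c <= d ->
  (forall i, cont_rectR a b c d (g i)) ->
  rdint a b c d (fun z => \sum_(i <- s) g i z) = \sum_(i <- s) rdint a b c d (g i).
Proof.
move=> ab cd hg; elim: s => [|i s IH].
  have -> : (fun z => \sum_(i <- [::]) g i z) = (fun=> 0).
    by apply/funext => x; rewrite big_nil.
  by rewrite big_nil rdint_cst// mulr0.
have -> : (fun x => \sum_(j <- i :: s) g j x) =
          (fun x => g i x + \sum_(j <- s) g j x).
  by apply/funext => x; rewrite big_cons.
by rewrite rdintD ?IH ?big_cons//; exact: cont_rectR_sum.
Qed.

Lemma rdint_catx a m b c d g : a <= m -> m <= b -> c <= d -> cont_rectR a b c d g ->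
  rdint a b c d g = rdint a m c d g + rdint m b c d g.
Proof. by move=> am mb cd hg; rewrite !rdintE -ReD -dint_catx. Qed.

Lemma rdint_caty a b c m d g : a <= b -> c <= m -> m <= d -> cont_rectR a b c d g ->
  rdint a b c d g = rdint a b c m g + rdint a b m d g.
Proof. by move=> ab cm md hg; rewrite !rdintE -ReD -dint_caty. Qed.

Lemma rdint_small_support a b c d g p (r B : R) : a <= b -> c <= d -> 0 <= r -> 0 <= B ->
  cont_rectR a b c d g -> (forall z, rect a b c d z -> g z <= B) ->
  (forall z, rect a b c d z -> r <= normc (z - p) -> g z = 0) ->
  rdint a b c d g <= 2 * r * (2 * r * B).
Proof.
move=> ab cd r0 B0 hg gB gs; apply: (@rint_small_support _ _ _ _ (complex.Re p)) => //.
- by rewrite !mulr_ge0.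
- exact: cont_rectR_rint.
- move=> x xab; apply: (@rint_small_support _ _ _ _ (complex.Im p)) => //.
  + exact: cont_rectR_ver hg _.
  + by move=> y ycd; apply: gB.
  + move=> y ycd h; apply: gs => //; rewrite (le_trans h)//.
    by have := normIm_le (mkc x y - p); rewrite ImD ImN.
move=> x xab h; rewrite (@rint_ext _ _ _ _ (fun=> 0)); first by rewrite rint_cst// mulr0.
move=> y ycd; apply: gs => //; rewrite (le_trans h)//.
by have := normRe_le (mkc x y - p); rewrite ReD ReN.
Qed.

Lemma normc_dint_le a b c d f : a <= b -> c <= d -> cont_rect a b c d f ->
  normc (dint a b c d f) <= 2 * rdint a b c d (fun z => normc (f z)).
Proof.
move=> ab cd hf; rewrite (le_trans (normc_le_ReIm _))// mulr2n mulrDl mul1r.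
have hn := cont_rectR_normc hf.
(* [p] stands for the real or the imaginary part. *)
have main (p : C -> R) : (forall z w, `|p z - p w| <= normc (z - w)) ->
    (forall z, `|p z| <= normc z) ->
    `|rdint a b c d (fun z => p (f z))| <= rdint a b c d (fun z => normc (f z)).
  move=> hp hp'; have hc : cont_rectR a b c d (fun z => p (f z)).
    move=> z hz; have /contcP h := hf z hz; apply/contcP => e /h[r r0 k].
    exists r => // w /k; apply: le_lt_trans.
    by rewrite -rmorphB normc_real.
  rewrite ler_norml; apply/andP; split.
    rewrite -mulN1r -rdintZ//; apply: rdint_le => //.
      by apply: cont_rectR_mul => //; exact: cont_rectR_cst.
    by move=> z _; have := hp' (f z); rewrite ler_norml mulN1r => /andP[].
  apply: rdint_le => // z _; exact: le_trans (ler_norm _) (hp' _).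
apply: lerD.
  by apply: (main (@complex.Re R)) => [z w|]; [rewrite -ReN -ReD|]; exact: normRe_le.
by apply: (main (@complex.Im R)) => [z w|]; [rewrite -ImN -ImD|]; exact: normIm_le.
Qed.

End RealPlaneIntegrals.

Section Green.
Variable R : realType.
Local Notation C := R[i].

(** The integral of f dz over the positively oriented boundary minus 2i times the area integral of
    [bet], the candidate for dbar f. *)
Definition green_defect (f bet : C -> C) (a b c d : R) : C :=
  cint a b (fun x => f (mkc x c) - f (mkc x d)) +
  'i%C * cint c d (fun y => f (mkc b y) - f (mkc a y)) - 2 * 'i%C * dint a b c d bet.

Variables (f al bet : C -> C) (a b c d : R).
Hypothesis (ab : a < b) (cd : c < d).
Hypothesis fw : forall z, rect a b c d z -> wirtinger f z (al z) (bet z).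
Hypothesis bc : cont_rect a b c d bet.

Let fc : cont_rect a b c d f.
Proof. by move=> z /fw; exact: wirtinger_cont. Qed.

Let J := green_defect f bet.

Lemma green_defect_catx x1 m x2 y1 y2 : a <= x1 -> x1 <= m -> m <= x2 -> x2 <= b ->
  c <= y1 -> y1 <= y2 -> y2 <= d -> J x1 x2 y1 y2 = J x1 m y1 y2 + J m x2 y1 y2.
Proof.
move=> ax xm mx xb cy yy yd.
have y1d := le_trans yy yd; have y2c := le_trans cy yy.
have am := le_trans ax xm; have mb := le_trans mx xb.
have x2a := le_trans am mx; have x1b := le_trans xm mb.
have hor y u v : c <= y <= d -> a <= u -> v <= b -> cont_seg u v (fun x => f (mkc x y)).
  by move=> hy au vb; apply: cont_seg_sub (cont_hor fc hy).
have ver x u v : a <= x <= b -> c <= u -> v <= d -> cont_seg u v (fun y => f (mkc x y)).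
  by move=> hx cu vd; apply: cont_seg_sub (cont_ver fc hx).
rewrite /J /green_defect (@cint_cat _ x1 m x2)//; last first.
  by apply: cont_seg_sub2; apply: hor => //; apply/andP.
rewrite (@dint_catx _ x1 m x2)//; last exact: cont_rect_sub bc.
rewrite !cintB; try by [apply: ver => //; apply/andP|apply: hor => //; apply/andP].
set I1 := cint x1 m _; set I2 := cint m x2 _; set D1 := dint _ _ _ _ _; set D2 := dint _ _ _ _ _.
set V1 := cint y1 y2 _; set V2 := cint y1 y2 _; set V3 := cint y1 y2 _.
set I3 := cint x1 m _; set I4 := cint m x2 _.
by ring.
Qed.

Lemma green_defect_caty x1 x2 y1 m y2 : a <= x1 -> x1 <= x2 -> x2 <= b ->
  c <= y1 -> y1 <= m -> m <= y2 -> y2 <= d -> J x1 x2 y1 y2 = J x1 x2 y1 m + J x1 x2 m y2.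
Proof.
move=> ax xx xb cy ym my yd.
have cm := le_trans cy ym; have md := le_trans my yd.
have x2a := le_trans ax xx; have x1b := le_trans xx xb.
have y2c := le_trans cm my; have y1d := le_trans ym md.
have hor y u v : c <= y <= d -> a <= u -> v <= b -> cont_seg u v (fun x => f (mkc x y)).
  by move=> hy au vb; apply: cont_seg_sub (cont_hor fc hy).
have ver x u v : a <= x <= b -> c <= u -> v <= d -> cont_seg u v (fun y => f (mkc x y)).
  by move=> hx cu vd; apply: cont_seg_sub (cont_ver fc hx).
rewrite /J /green_defect (@cint_cat _ y1 m y2)//; last first.
  by apply: cont_seg_sub2; apply: ver => //; apply/andP.
rewrite (@dint_caty _ x1 x2 y1 m y2)//; last exact: cont_rect_sub bc.
rewrite !cintB; try by [apply: ver => //; apply/andP|apply: hor => //; apply/andP].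
set I1 := cint y1 m _; set I2 := cint m y2 _; set D1 := dint _ _ _ _ _; set D2 := dint _ _ _ _ _.
set V1 := cint x1 x2 _; set V2 := cint x1 x2 _; set V3 := cint x1 x2 _.
set I3 := cint y1 m _; set I4 := cint m y2 _.
by ring.
Qed.

(** Replacing f by its first-order expansion at p, and [bet] by its value there, kills the defect.
    The errors are 4 e (w + h)^2 on the boundary and 8 e (w + h)^2 in the area term, together 12. *)
Lemma green_defect_local p (e : R) : rect a b c d p -> 0 < e ->
  exists2 r : R, 0 < r & forall x1 x2 y1 y2, a <= x1 -> x2 <= b -> c <= y1 -> y2 <= d ->
    rect x1 x2 y1 y2 p -> x2 - x1 < r -> y2 - y1 < r ->
    normc (J x1 x2 y1 y2) <= 12 * e * (x2 - x1 + (y2 - y1)) ^+ 2.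
Proof.
move=> hp e0; have [r1 r10 h1] := fw hp e0.
have /contcP/(_ _ e0)[r2 r20 h2] := bc hp.
pose r := Num.min r1 r2; have r0 : 0 < r by rewrite lt_min r10.
exists (r / 2); first by rewrite divr_gt0.
move=> x1 x2 y1 y2 ax xb cy yd hq hw hh.
have [/andP[q1 q2] /andP[q3 q4]] := hq.
have x12 := le_trans q1 q2; have y12 := le_trans q3 q4.
set w := x2 - x1 in hw *; set h := y2 - y1 in hh *.
have w0 : 0 <= w by rewrite subr_ge0.
have h0 : 0 <= h by rewrite subr_ge0.
have diam z : rect x1 x2 y1 y2 z -> normc (z - p) <= w + h.
  move=> [z1 z2]; rewrite (le_trans (normc_le_ReIm _))// ReD ImD ReN ImN.
  by apply: lerD; rewrite ler_norml /w /h; lra.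
have near1 z : rect x1 x2 y1 y2 z -> normc (z - p) < r1.
  move=> /diam k; have rr : r <= r1 by rewrite ge_min lexx.
  by rewrite (le_lt_trans k)// (lt_le_trans _ rr)//; lra.
have near2 z : rect x1 x2 y1 y2 z -> normc (z - p) < r2.
  move=> /diam k; have rr : r <= r2 by rewrite ge_min lexx orbT.
  by rewrite (le_lt_trans k)// (lt_le_trans _ rr)//; lra.
pose A := al p; pose B := bet p.
have lin z z' : rect x1 x2 y1 y2 z -> rect x1 x2 y1 y2 z' ->
    normc (f z - f z' - (A * (z - z') + B * (z - z')^*%C)) <= 2 * (e * (w + h)).
  move=> hz hz'; have k1 := h1 _ (near1 _ hz); have k2 := h1 _ (near1 _ hz').
  rewrite ![p + _]addrC !subrK in k1 k2.
  have -> : f z - f z' - (A * (z - z') + B * (z - z')^*%C) =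
    (f z - f p - (A * (z - p) + B * (z - p)^*%C)) -
    (f z' - f p - (A * (z' - p) + B * (z' - p)^*%C)).
    by rewrite !rmorphB/=; ring.
  rewrite (le_trans (normcB _ _))// mulrDl mul1r; apply: lerD.
    by rewrite (le_trans k1)// ler_wpM2l ?(ltW e0)// diam.
  by rewrite (le_trans k2)// ler_wpM2l ?(ltW e0)// diam.
pose k1 : C := A * mkc 0 (- h) + B * (mkc 0 (- h))^*%C.
pose k2 : C := A * mkc w 0 + B * (mkc w 0)^*%C.
have y1d := le_trans y12 yd; have y2c := le_trans cy y12.
have x2a := le_trans ax x12; have x1b := le_trans x12 xb.
have e1 : normc (cint x1 x2 (fun x => f (mkc x y1) - f (mkc x y2)) - w%:C%C * k1) <=
    2 * w * (2 * (e * (w + h))).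
  apply: cint_bound => //.
    by apply: cont_seg_sub2; apply: cont_seg_sub (cont_hor fc _) => //; apply/andP.
  move=> x hx; rewrite /k1; have -> : mkc 0 (- h) = mkc x y1 - mkc x y2.
    by rewrite mkcB subrr opprB.
  by apply: lin; split => //=; apply/andP.
have e2 : normc (cint y1 y2 (fun y => f (mkc x2 y) - f (mkc x1 y)) - h%:C%C * k2) <=
    2 * h * (2 * (e * (w + h))).
  apply: cint_bound => //.
    by apply: cont_seg_sub2; apply: cont_seg_sub (cont_ver fc _) => //; apply/andP.
  move=> y hy; rewrite /k2; have -> : mkc w 0 = mkc x2 y - mkc x1 y.
    by rewrite mkcB subrr.
  by apply: lin; split => //=; apply/andP.
have e3 : normc (dint x1 x2 y1 y2 bet - (w * h)%:C%C * B) <= 4 * (w * h) * e.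
  apply: dint_bound => //; first exact: cont_rect_sub bc.
  by move=> z /near2 /h2 /ltW.
rewrite /J /green_defect.
set I1 := cint x1 x2 _ in e1 *; set I2 := cint y1 y2 _ in e2 *.
set I3 := dint _ _ _ _ _ in e3 *.
have -> : I1 + 'i%C * I2 - 2 * 'i%C * I3 = (I1 - w%:C%C * k1) +
   'i%C * (I2 - h%:C%C * k2) - 2 * 'i%C * (I3 - (w * h)%:C%C * B).
  (* The defect of A z + B conj z with constant dbar derivative B is 0, by direct computation. *)
  have z0 : w%:C%C * k1 + 'i%C * (h%:C%C * k2) - 2 * 'i%C * ((w * h)%:C%C * B) = 0.
    have hiE : mkc 0 (- h) = - ('i%C * h%:C%C).
      by apply: complexP; rewrite ?ReN ?ImN ?ReM ?ImM/=; ring.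
    have hiE' : (mkc 0 (- h))^*%C = 'i%C * h%:C%C.
      by apply: complexP; rewrite ?ReM ?ImM/=; ring.
    have wE' : (mkc w 0)^*%C = w%:C%C by rewrite /mkc/= oppr0.
    rewrite /k1 /k2 hiE' hiE wE' rmorphM/=.
    rewrite (_ : mkc w 0 = w%:C%C)//; ring.
  by rewrite -[LHS]subr0 -z0; ring.
rewrite (le_trans (normcB _ _))// (le_trans (lerD (normcD _ _) (lexx _)))//.
rewrite !normcM normc_i !mul1r mulr1 (normc_nat R 2).
have wh : w * h <= (w + h) ^+ 2 by nra.
have -> : 12 * e * (w + h) ^+ 2 = 2 * w * (2 * (e * (w + h))) +
   2 * h * (2 * (e * (w + h))) + 2 * (4 * (w + h) ^+ 2 * e) by ring.
apply: lerD; first exact: lerD.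
rewrite ler_pM2l// (le_trans e3)// ler_wpM2r ?(ltW e0)//.
by rewrite ler_pM2l.
Qed.

(** Goursat's argument: the defect is additive under subdivision and o(area) on small rectangles of
    fixed shape, so pointwise differentiability with a continuous dbar derivative is enough; [al]
    may be discontinuous. *)
Theorem green : J a b c d = 0.
Proof.
apply/eqP; rewrite -normc_eq0 eq_le normc_ge0 andbT.
pose W := b - a; pose H := d - c.
have W0 : 0 < W by rewrite subr_gt0.
have H0 : 0 < H by rewrite subr_gt0.
apply/ler_addgt0Pr => e e0; rewrite add0r.
have main : normc (J a b c d) <= e / (W * H) * (W * H).
  pose Q x1 x2 y1 y2 := normc (J x1 x2 y1 y2) <= e / (W * H) * ((x2 - x1) * (y2 - y1)).
  apply: (@rectangle_ind _ Q); [exact: ltW|exact: ltW| |].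
    move=> x1 x2 y1 y2 ax xx xb cy yy yd mx my q1 q2 q3 q4; rewrite /Q.
    have hx1 : x1 <= mx by rewrite /mx; lra.
    have hx2 : mx <= x2 by rewrite /mx; lra.
    have hy1 : y1 <= my by rewrite /my; lra.
    have hy2 : my <= y2 by rewrite /my; lra.
    rewrite (green_defect_catx (m := mx))// (green_defect_caty (m := my))//; last first.
      exact: le_trans hx2 xb.
    rewrite (green_defect_caty (x1 := mx) (m := my))//; last exact: le_trans ax hx1.
    rewrite (le_trans (normcD _ _))//.
    rewrite (le_trans (lerD (normcD _ _) (normcD _ _)))//.
    have -> : e / (W * H) * ((x2 - x1) * (y2 - y1)) =
      e / (W * H) * ((mx - x1) * (my - y1)) + e / (W * H) * ((mx - x1) * (y2 - my)) +
      (e / (W * H) * ((x2 - mx) * (my - y1)) + e / (W * H) * ((x2 - mx) * (y2 - my))).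
      by ring.
    by apply: lerD; apply: lerD; [exact: q1|exact: q3|exact: q2|exact: q4].
  (* For a rectangle of the same shape as the whole, 12 e' (w + k)^2 equals e w k / (W H)
     exactly. *)
  move=> px py hx hy; pose e' := e / 12 / (W + H) ^+ 2.
  have WH0 : 0 < W + H by rewrite addr_gt0.
  have e'0 : 0 < e' by rewrite !divr_gt0 ?exprn_gt0.
  have [r r0 h] := green_defect_local (rect_mkc hx hy) e'0.
  exists r => // x1 x2 y1 y2 ax xb cy yd h1 h2 hw hh asp.
  rewrite /Q (le_trans (h _ _ _ _ _ _ _ _ _ hw hh))//.
  set w := x2 - x1 in asp *; set k := y2 - y1 in asp *.
  rewrite le_eqVlt; apply/orP; left; apply/eqP.
  have kE : k = w * H / W by rewrite asp mulfK// gt_eqF.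
  rewrite /e' kE; field; rewrite !gt_eqF//.
by rewrite (le_trans main)// divfK// mulf_neq0// gt_eqF.
Qed.

End Green.

Section Flux.
Variable R : realType.
Local Notation C := R[i].

(** For f a function of log z, this is the integral over the circle of radius e^t with respect to
    the angle. *)
Definition circ (f : C -> C) (t : R) : C := cint 0 (2 * pi) (fun y => f (mkc t y)).

Lemma pi2_gt0 : 0 < 2 * pi :> R.
Proof. by rewrite mulr_gt0// pi_gt0. Qed.

(** Periodicity cancels the horizontal sides in [green]; the common factor i is then divided out. *)
Theorem flux (f al bet : C -> C) (T s : R) : T < s ->
  (forall z, T <= complex.Re z <= s -> wirtinger f z (al z) (bet z)) ->
  (forall z, T <= complex.Re z <= s -> contc bet z) ->
  (forall x, T <= x <= s -> f (mkc x 0) = f (mkc x (2 * pi))) ->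
  circ f s - circ f T = 2 * dint T s 0 (2 * pi) bet.
Proof.
move=> Ts fw bc per.
have fw' z : rect T s 0 (2 * pi) z -> wirtinger f z (al z) (bet z) by case=> /fw.
have bc' : cont_rect T s 0 (2 * pi) bet by move=> z [/bc].
have fc : cont_rect T s 0 (2 * pi) f by move=> z /fw'; exact: wirtinger_cont.
have := green Ts pi2_gt0 fw' bc'; rewrite /green_defect.
rewrite (@cint_ext _ T s _ (fun=> 0)); last by move=> x /per ->; rewrite subrr.
rewrite cint_cst ?(ltW Ts)// mulr0 add0r cintB; last 2 first.
- by apply: cont_ver fc _; rewrite lexx ltW.
- by apply: cont_ver fc _; rewrite lexx ltW.
rewrite -/(circ f s) -/(circ f T) => /eqP; rewrite subr_eq0 => /eqP h.
have i0 : 'i%C != 0 :> C by rewrite -normc_gt0 normc_i.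
by apply: (mulfI i0); rewrite h; ring.
Qed.

Lemma circ_le (f : C -> C) t (e : R) :
  (forall y, 0 <= y <= 2 * pi -> contc f (mkc t y)) ->
  (forall y, 0 <= y <= 2 * pi -> normc (f (mkc t y)) <= e) ->
  normc (circ f t) <= 2 * (2 * pi) * e.
Proof.
move=> fc h; have := @cint_le _ 0 (2 * pi) (fun y => f (mkc t y)) e (ltW pi2_gt0).
rewrite subr0; apply => //; apply: (@cont_ver _ t t 0 (2 * pi)); last by rewrite lexx.
move=> [x y] [/= hx hy]; have -> : x = t by apply/eqP; rewrite eq_le andbC.
exact: fc.
Qed.

End Flux.

(** * Cauchy's formula *)

Section DerivativeRemainder.
Variable K : numFieldType.

(** A general field [K] lets the same lemma serve real functions and holomorphic ones. *)
Lemma derivable_remainder (f : K -> K) (x : K) : derivable f x 1 ->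
  forall e : K, 0 < e -> exists2 d : K, 0 < d & forall h, `|h| < d ->
    `|f (x + h) - f x - 'D_1 f x * h| <= e * `|h|.
Proof.
move=> df e e0; have : (fun h => h^-1 *: ((f \o shift x) (h *: (1 : K)) - f x)) @ 0^' -->
  'D_1 f x by exact: df.
move=> /cvgrPdist_le/(_ e e0); rewrite near_withinE => /nbhs_ballP[d /= d0 hd].
exists d => // h hh; have [->|h0] := eqVneq h 0.
  by rewrite addr0 subrr mulr0 subrr normr0 mulr0.
have := hd h; rewrite /ball/= sub0r normrN => /(_ hh h0).
rewrite /= /GRing.scale/= mulr1 [h + x]addrC => k.
have -> : f (x + h) - f x - 'D_1 f x * h = - (('D_1 f x - h^-1 * (f (x + h) - f x)) * h).
  by field.
by rewrite normrN normrM ler_wpM2r.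
Qed.

Lemma remainder_derive (f : K -> K) (x l : K) :
  (forall e : K, 0 < e -> exists2 d : K, 0 < d & forall h, `|h| < d ->
    `|f (x + h) - f x - l * h| <= e * `|h|) -> derivable f x 1 /\ 'D_1 f x = l.
Proof.
move=> hf; have cv : (fun h => h^-1 *: ((f \o shift x) (h *: (1 : K)) - f x)) @ 0^' --> l.
  apply/cvgrPdist_le => e e0; rewrite near_withinE; have [d d0 hd] := hf e e0.
  apply/nbhs_ballP; exists d => //= h; rewrite /ball/= sub0r normrN => hh h0.
  rewrite /= /GRing.scale/= mulr1 [h + x]addrC.
  have -> : l - h^-1 * (f (x + h) - f x) = - ((f (x + h) - f x - l * h) / h) by field.
  by rewrite normrN normrM normfV ler_pdivrMr ?normr_gt0// hd.
by split; [apply/cvg_ex; exists l|exact: cvg_lim cv].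
Qed.

End DerivativeRemainder.

(** * The complex exponential *)

Section ComplexExponential.
Variable R : realType.
Local Notation C := R[i].

Lemma wirtinger_Re (g : R -> R) (z : C) (l : R) : is_derive (complex.Re z) 1 g l ->
  wirtinger (fun w => (g (complex.Re w))%:C%C) z (l / 2)%:C%C (l / 2)%:C%C.
Proof.
move=> [dg gl]; move=> e e0; have [d d0 h] := derivable_remainder dg e0.
exists d => // k kd.
have -> : (g (complex.Re (z + k)))%:C%C - (g (complex.Re z))%:C%C -
   ((l / 2)%:C%C * k + (l / 2)%:C%C * k^*%C) =
   (g (complex.Re z + complex.Re k) - g (complex.Re z) - l * complex.Re k)%:C%C :> C.
  rewrite ReD; case: k {kd} => x y; apply: complexP; rewrite ?(ReD, ImD, ReN, ImN, ReM, ImM)/=.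
    by field.
  by field.
rewrite normc_real -gl (le_trans (h _ _))//.
  by rewrite (le_lt_trans (normRe_le k)).
by rewrite ler_wpM2l ?(ltW e0)// normRe_le.
Qed.

Lemma wirtinger_Im (g : R -> R) (z : C) (l : R) : is_derive (complex.Im z) 1 g l ->
  wirtinger (fun w => (g (complex.Im w))%:C%C) z
    (- 'i%C * (l / 2)%:C%C) ('i%C * (l / 2)%:C%C).
Proof.
move=> [dg gl]; move=> e e0; have [d d0 h] := derivable_remainder dg e0.
exists d => // k kd.
have -> : (g (complex.Im (z + k)))%:C%C - (g (complex.Im z))%:C%C -
   (- 'i%C * (l / 2)%:C%C * k + 'i%C * (l / 2)%:C%C * k^*%C) =
   (g (complex.Im z + complex.Im k) - g (complex.Im z) - l * complex.Im k)%:C%C :> C.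
  rewrite ImD; case: k {kd} => x y; apply: complexP; rewrite ?(ReD, ImD, ReN, ImN, ReM, ImM)/=.
    by field.
  by field.
rewrite normc_real -gl (le_trans (h _ _))//.
  by rewrite (le_lt_trans (normIm_le k)).
by rewrite ler_wpM2l ?(ltW e0)// normIm_le.
Qed.

Definition cexp (z : C) : C := (expR (complex.Re z))%:C%C * expi (complex.Im z).

Lemma expi0 : expi 0 = 1 :> C.
Proof. by rewrite /expi cos0 sin0. Qed.

Lemma expiD (t u : R) : expi (t + u) = expi t * expi u :> C.
Proof. by apply: complexP; rewrite ?ReM ?ImM/= ?cosD ?sinD// addrC. Qed.

Lemma normc_expi (t : R) : normc (expi t : C) = 1.
Proof. by rewrite /normc/= cos2Dsin2 sqrtr1. Qed.

Lemma expi_2pi : expi (2 * pi) = 1 :> C.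
Proof. by rewrite /expi mulr_natl cos2pi sin2pi. Qed.

Lemma normc_cexp z : normc (cexp z) = expR (complex.Re z).
Proof. by rewrite normcM normc_real normc_expi mulr1 ger0_norm// expR_ge0. Qed.

Lemma cexp_neq0 z : cexp z != 0.
Proof. by rewrite -normc_gt0 normc_cexp expR_gt0. Qed.

Lemma cexpD z w : cexp (z + w) = cexp z * cexp w.
Proof. by rewrite /cexp ReD ImD expRD expiD rmorphM/=; ring. Qed.

Lemma cexp_per x : cexp (mkc x 0) = cexp (mkc x (2 * pi)).
Proof. by rewrite /cexp/= expi0 expi_2pi. Qed.

Lemma cexp_mkc x y : cexp (mkc x y) = (expR x)%:C%C * expi y.
Proof. by []. Qed.

Lemma cexp_conj z : (cexp z)^*%C = ((expR (complex.Re z)) ^+ 2)%:C%C / cexp z.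
Proof. by apply: (mulIf (cexp_neq0 z)); rewrite divfK ?cexp_neq0// mulrC mulcconj normc_cexp. Qed.

Lemma wirtinger_cexp z : wirtinger cexp z (cexp z) 0.
Proof.
have h1 := wirtinger_Re (is_derive_expR (complex.Re z)).
have h2 := wirtinger_Im (is_derive_cos (complex.Im z)).
have h3 := wirtinger_scale 'i%C (wirtinger_Im (is_derive_sin (complex.Im z))).
apply: wirtinger_ext (wirtinger_eq _ _ (wirtinger_mul h1 (wirtinger_add h2 h3))).
- by move=> w; apply: complexP; rewrite ?(ReD, ImD, ReN, ImN, ReM, ImM)/=; ring.
- by apply: complexP; rewrite ?(ReD, ImD, ReN, ImN, ReM, ImM)/=; field.
- by apply: complexP; rewrite ?(ReD, ImD, ReN, ImN, ReM, ImM)/=; field.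
Qed.

Lemma wirtinger_holo_comp (f g : C -> C) z a b a' : wirtinger f z a b ->
  wirtinger g (f z) a' 0 -> wirtinger (fun w => g (f w)) z (a' * a) (a' * b).
Proof.
by move=> hf hg; apply: wirtinger_eq (wirtinger_comp hf hg); rewrite mul0r addr0.
Qed.

Lemma wirtinger_precomp_holo (f g : C -> C) z a a' b' : wirtinger f z a 0 ->
  wirtinger g (f z) a' b' -> wirtinger (fun w => g (f w)) z (a' * a) (b' * a^*%C).
Proof.
move=> hf hg; apply: wirtinger_eq (wirtinger_comp hf hg).
  by rewrite rmorph0; ring.
by ring.
Qed.

Lemma wirtinger_uniq (f : C -> C) z a a' b : wirtinger f z a b ->
  wirtinger f z a' b -> a = a'.
Proof.
move=> h1 h2; apply/eqP; rewrite -subr_eq0 -normc_eq0 eq_le normc_ge0 andbT.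
apply/ler_addgt0Pr => e e0; rewrite add0r.
have e2 : 0 < e / 2 by rewrite divr_gt0.
have [d d0 k1] := h1 _ e2; have [d' d0' k2] := h2 _ e2.
(* A real increment t suffices: the two remainders then differ by (a - a') t. *)
pose t := Num.min d d' / 2.
have t0 : 0 < t by rewrite divr_gt0// lt_min d0.
have tt : t < Num.min d d' by rewrite ltr_pdivrMr// ltr_pMr ?lt_min ?d0// ltr1n.
move: tt; rewrite lt_min => /andP[td td'].
have nt : normc t%:C%C = t by rewrite normc_real gtr0_norm.
have := k1 t%:C%C; rewrite nt => /(_ td) {}k1.
have := k2 t%:C%C; rewrite nt => /(_ td') {}k2.
rewrite -(ler_pM2r t0) -{1}nt -normcM.
have -> : (a - a') * t%:C%C = (f (z + t%:C%C) - f z - (a' * t%:C%C + b * (t%:C%C)^*%C)) -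
  (f (z + t%:C%C) - f z - (a * t%:C%C + b * (t%:C%C)^*%C)) by ring.
rewrite (le_trans (normcB _ _))//; lra.
Qed.

End ComplexExponential.

Section HolomorphicInterface.
Variable R : realType.
Local Notation C := R[i].

Lemma normC_def (z : Cplx R) : `|z| = (normc z)%:C%C.
Proof. by []. Qed.

Lemma derivable_wirtinger (f : Cplx R -> Cplx R) (z : Cplx R) :
  derivable f z 1 -> wirtinger (f : C -> C) z (f^`() z) 0.
Proof.
move=> df e e0; rewrite derive1E.
have ec0 : 0 < (e%:C%C : Cplx R) by rewrite ltcR.
have [d d0 h] := derivable_remainder df ec0.
(* Positivity in R[i] forces the imaginary part to be 0. *)
have dE : d = (complex.Re d)%:C%C.
  by case: d d0 {h} => x y; rewrite ltcE/= => /andP[/eqP -> _].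
exists (complex.Re d); first by move: d0; rewrite dE ltcR.
move=> k kd; have := h k; rewrite dE !normC_def ltcR => /(_ kd).
rewrite -rmorphM lecR mul0r addr0; apply: le_trans.
by rewrite le_eqVlt eqxx.
Qed.

Lemma wirtinger_derivable (f : Cplx R -> Cplx R) (z a : Cplx R) :
  wirtinger (f : C -> C) z a 0 -> derivable f z 1 /\ f^`() z = a.
Proof.
move=> hf; rewrite derive1E; apply: remainder_derive => e e0.
have eE : e = (complex.Re e)%:C%C.
  by case: e e0 => x y; rewrite ltcE/= => /andP[/eqP -> _].
have [|d d0 h] := hf (complex.Re e); first by move: e0; rewrite eE ltcR.
exists (d%:C%C : Cplx R); first by rewrite ltcR.
move=> k; rewrite normC_def ltcR => /h; rewrite mul0r addr0 eE !normC_def -rmorphM lecR.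
done.
Qed.

End HolomorphicInterface.

Section CircleMeans.
Variable R : realType.
Local Notation C := R[i].
Implicit Types (q dq f : C -> C) (a w z : C) (s t T : R).

Lemma contc_cexp z : contc (@cexp R) z.
Proof. exact: wirtinger_cont (wirtinger_cexp z). Qed.

Lemma circ_ext f g t : (forall y, f (mkc t y) = g (mkc t y)) -> circ f t = circ g t.
Proof. by move=> h; apply: cint_ext => y _. Qed.

Lemma circ_cst (k : C) t : circ (fun=> k) t = (2 * pi)%:C%C * k.
Proof. by rewrite /circ cint_cst ?subr0// ltW// pi2_gt0. Qed.

Lemma circ_cont_seg f t : (forall y, contc f (mkc t y)) ->
  cont_seg 0 (2 * pi) (fun y => f (mkc t y)).
Proof.
move=> fc; apply: (@cont_ver _ t t 0 (2 * pi)); last by rewrite lexx.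
move=> [x y] [/= hx hy]; have -> : x = t by apply/eqP; rewrite eq_le andbC.
exact: fc.
Qed.

Lemma circD f g t : (forall y, contc f (mkc t y)) -> (forall y, contc g (mkc t y)) ->
  circ (fun z => f z + g z) t = circ f t + circ g t.
Proof. by move=> hf hg; apply: cintD; exact: circ_cont_seg. Qed.

Lemma circZ (k : C) f t : (forall y, contc f (mkc t y)) ->
  circ (fun z => k * f z) t = k * circ f t.
Proof. by move=> hf; apply: cintZ; exact: circ_cont_seg. Qed.

Lemma circB f g t : (forall y, contc f (mkc t y)) -> (forall y, contc g (mkc t y)) ->
  circ (fun z => f z - g z) t = circ f t - circ g t.
Proof. by move=> hf hg; apply: cintB; exact: circ_cont_seg. Qed.

Lemma circ_conj f t : (forall y, contc f (mkc t y)) ->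
  circ (fun z => (f z)^*%C) t = (circ f t)^*%C.
Proof.
move=> hf; have hc := cont_seg_Im (circ_cont_seg hf).
have e1 : rint 0 (2 * pi) (fun y => complex.Re (f (mkc t y))^*%C) =
          rint 0 (2 * pi) (fun y => complex.Re (f (mkc t y))).
  by apply: rint_ext => y _; case: (f _).
have e2 : rint 0 (2 * pi) (fun y => complex.Im (f (mkc t y))^*%C) =
          - rint 0 (2 * pi) (fun y => complex.Im (f (mkc t y))).
  rewrite -mulN1r -rintZ//; apply: rint_ext => y _; case: (f _) => u v /=; ring.
by rewrite /circ /cint e1 e2.
Qed.

Lemma circ_cont f t1 t2 : t1 <= t2 -> (forall z, t1 <= complex.Re z <= t2 -> contc f z) ->
  cont_seg t1 t2 (circ f).
Proof.
move=> t12 hf; apply: (cont_cint_ver t12 (ltW (pi2_gt0 R))) => z [hz _]; exact: hf.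
Qed.

Lemma cont_seg_eq_left (g : R -> C) t1 t2 (k : C) : t1 < t2 -> cont_seg t1 t2 g ->
  (forall t, t1 < t <= t2 -> g t = k) -> g t1 = k.
Proof.
move=> t12 hg hk; apply/eqP; rewrite -subr_eq0 -normc_eq0 eq_le normc_ge0 andbT.
apply/ler_addgt0Pr => e e0; rewrite add0r.
have [|r r0 h] := hg t1 _ e e0; first by rewrite lexx ltW.
pose m := Num.min (t1 + r / 2) t2.
have m1 : t1 < m by rewrite lt_min t12 ltrDl divr_gt0.
have m2 : m <= t2 by rewrite ge_min lexx orbT.
have m3 : m <= t1 + r / 2 by rewrite ge_min lexx.
rewrite normcBC -(hk m); last by rewrite m1 m2.
by apply/ltW/h; [rewrite (ltW m1) m2|rewrite gtr0_norm ?subr_gt0//; lra].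
Qed.

Lemma cont_seg_eq_right (g : R -> C) t1 t2 (k : C) : t1 < t2 -> cont_seg t1 t2 g ->
  (forall t, t1 <= t < t2 -> g t = k) -> g t2 = k.
Proof.
move=> t12 hg hk; apply/eqP; rewrite -subr_eq0 -normc_eq0 eq_le normc_ge0 andbT.
apply/ler_addgt0Pr => e e0; rewrite add0r.
have [|r r0 h] := hg t2 _ e e0; first by rewrite lexx ltW.
pose m := Num.max (t2 - r / 2) t1.
have m1 : m < t2 by rewrite gt_max t12 andbT gtrDl oppr_lt0 divr_gt0.
have m2 : t1 <= m by rewrite le_max lexx orbT.
have m3 : t2 - r / 2 <= m by rewrite le_max lexx.
rewrite normcBC -(hk m); last by rewrite m1 m2.
by apply/ltW/h; [rewrite (ltW m1) m2|rewrite ltr0_norm ?subr_lt0//; lra].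
Qed.

(** Cauchy's theorem in an annulus: q(e^z) has dbar derivative 0, so [flux] has no area term. *)
Lemma circ_holo_cst q dq T s : T < s ->
  (forall w, expR T <= normc w <= expR s -> wirtinger q w (dq w) 0) ->
  circ (fun z => q (cexp z)) s = circ (fun z => q (cexp z)) T.
Proof.
move=> Ts hq; apply/eqP; rewrite -subr_eq0; apply/eqP.
rewrite (@flux _ _ (fun z => dq (cexp z) * cexp z) (fun=> 0) T s Ts).
- by rewrite /dint (@cint_cst _ 0)// ?mulr0 ?cint_cst ?mulr0// ltW// pi2_gt0.
- move=> z /andP[z1 z2]; rewrite -(mulr0 (dq (cexp z))).
  by apply: wirtinger_holo_comp (wirtinger_cexp z) _; apply: hq; rewrite normc_cexp !ler_expR z1.
- by move=> z _; exact: contc_cst.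
by move=> x _; rewrite cexp_per.
Qed.

Lemma circ_center q : (forall w, normc w < 1 -> contc q w) -> q 0 = 0 ->
  forall e : R, 0 < e -> exists T0 : R, forall T, T <= T0 ->
  normc (circ (fun z => q (cexp z)) T) <= e.
Proof.
move=> qc q0 e e0.
have k0 : 0 < 2 * (2 * pi) :> R by rewrite mulr_gt0// pi2_gt0.
have e1 : 0 < e / (2 * (2 * pi)) by rewrite divr_gt0.
have n01 : normc (0 : C) < 1 by rewrite normc0.
have /contcP/(_ _ e1)[d d0 h] := qc 0 n01.
pose r := Num.min d 1 / 2; have r0 : 0 < r by rewrite divr_gt0// lt_min d0/=.
have rm : r < Num.min d 1 by rewrite ltr_pdivrMr// ltr_pMr ?ltr1n// lt_min d0/=.
move: rm; rewrite lt_min => /andP[rd r1].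
exists (ln r) => T hT.
have nT y : normc (cexp (mkc T y) : C) <= r.
  by rewrite normc_cexp/= -[leRHS](lnK (x := r))// ler_expR.
rewrite -[leRHS](mulrVK (unitf_gt0 k0)) mulrC; apply: circ_le => y _.
  apply: contc_comp (contc_cexp _) _; apply: qc; exact: le_lt_trans (nT y) r1.
rewrite -[q _]subr0 -[X in _ - X]q0; apply/ltW/h; rewrite subr0.
exact: le_lt_trans (nT y) rd.
Qed.

(** The means over circles are constant on either side of the radius |a|, continuous across it, and
    tend to 2 pi q(0) = 0 at the centre. Hence continuity of q at a is enough. *)
Lemma circ_removable q dq a s : s < 0 -> normc a < expR s ->
  (forall w, normc w < 1 -> contc q w) ->
  (forall w, normc w < 1 -> w != a -> wirtinger q w (dq w) 0) -> q 0 = 0 ->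
  circ (fun z => q (cexp z)) s = 0.
Proof.
move=> s0 as_ qc qw q0.
have es1 : expR s < 1 by rewrite expR_lt1.
have fc z : complex.Re z <= s -> contc (fun z => q (cexp z)) z.
  move=> zs; apply: contc_comp (contc_cexp _) _; apply: qc.
  by rewrite normc_cexp (le_lt_trans _ es1)// ler_expR.
have main : exists T1 : R, forall T, T < T1 ->
    circ (fun z => q (cexp z)) s = circ (fun z => q (cexp z)) T.
  have [a0|a0] := eqVneq a 0.
    exists s => T Ts; apply: (@circ_holo_cst q dq) => // w /andP[w1 w2].
    apply: qw; first exact: le_lt_trans w2 es1.
    rewrite a0 -normc_gt0; apply: lt_le_trans w1; exact: expR_gt0.
  have na : 0 < normc a by rewrite normc_gt0.
  pose t0 := ln (normc a); have et0 : expR t0 = normc a by rewrite lnK.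
  have t0s : t0 < s by rewrite -ltr_expR et0.
  exists t0 => T Tt0.
  have <- : circ (fun z => q (cexp z)) t0 = circ (fun z => q (cexp z)) s.
    apply: (cont_seg_eq_left t0s).
      by apply: (circ_cont (ltW t0s)) => z /andP[_]; exact: fc.
    move=> t /andP[t1 t2]; move: t2; rewrite le_eqVlt => /predU1P[->//|ts].
    apply/esym/(@circ_holo_cst q dq) => // w /andP[w1 w2].
    apply: qw; first exact: le_lt_trans w2 es1.
    apply/eqP => wa; move: w1; rewrite wa -et0 ler_expR; lra.
  apply: (cont_seg_eq_right Tt0).
    by apply: (circ_cont (ltW Tt0)) => z /andP[_ z2]; apply: fc; lra.
  move=> t /andP[]; rewrite le_eqVlt => /predU1P[->//|Tt] tt0.
  apply: (@circ_holo_cst q dq) => // w /andP[w1 w2].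
  apply: qw.
    by rewrite (le_lt_trans w2)// (lt_trans _ es1)// ltr_expR; lra.
  apply/eqP => wa; move: w2; rewrite wa -et0 ler_expR; lra.
have [T1 h1] := main.
apply/eqP; rewrite -normc_eq0 eq_le normc_ge0 andbT.
apply/ler_addgt0Pr => e e0; rewrite add0r.
have [T0 h0] := circ_center qc q0 e0.
rewrite (h1 (Num.min T0 (T1 - 1))); first by apply: h0; rewrite ge_min lexx.
by rewrite gt_min [X in _ || X](_ : _ = true) ?orbT//; lra.
Qed.

Lemma circ_holo0 q dq s : s < 0 ->
  (forall w, normc w < 1 -> wirtinger q w (dq w) 0) -> q 0 = 0 ->
  circ (fun z => q (cexp z)) s = 0.
Proof.
move=> s0 hq; apply: (@circ_removable q dq 0) => //.
- by rewrite normc0 expR_gt0.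
- by move=> w /hq; exact: wirtinger_cont.
- by move=> w /hq.
Qed.

(** The circle is moved outwards, where w / (w - a) tends to 1. *)
Lemma circ_cauchy_kernel a s : normc a < expR s ->
  circ (fun z => cexp z / (cexp z - a)) s = (2 * pi)%:C%C.
Proof.
move=> as_; pose q w := w / (w - a).
pose dq (w : C) := 1 * (w - a)^-1 + w * (- (w - a) ^- 2 * (1 - 0)).
have qw w : normc a < normc w -> wirtinger q w (dq w) 0.
  move=> aw; have wa0 : w - a != 0.
    by apply/eqP => /subr0_eq wa; move: aw; rewrite wa ltxx.
  have h1 := wirtinger_sub (wirtinger_id w) (wirtinger_cst a w).
  have := wirtinger_mul (wirtinger_id w) (wirtinger_holo_comp h1 (wirtinger_inv wa0)).
  by apply: wirtinger_eq => //; ring.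
apply/eqP; rewrite -subr_eq0 -normc_eq0 eq_le normc_ge0 andbT.
apply/ler_addgt0Pr => e e0; rewrite add0r.
have k0 : 0 < 2 * (2 * pi) :> R by rewrite mulr_gt0// pi2_gt0.
(* On |w| >= M one has |w / (w - a) - 1| = |a| / |w - a| <= e / (4 pi), the tolerance that [circ_le]
   multiplies by 4 pi. *)
pose M := 2 * (2 * pi) * normc a / e + normc a + 1.
have M0 : 0 < M.
  by rewrite /M ltr_pwDr// addr_ge0 ?normc_ge0// divr_ge0 ?(ltW e0)// mulr_ge0 ?normc_ge0// ltW.
pose S := Num.max (s + 1) (ln M).
have sS : s < S by rewrite lt_max ltrDl ltr01.
have MS : M <= expR S by rewrite -[leLHS](lnK (x := M))// ler_expR le_max lexx orbT.
have nS y : normc (cexp (mkc S y) : C) = expR S by rewrite normc_cexp.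
have aS : normc a < expR S.
  rewrite (lt_le_trans _ MS)// /M; have : 0 <= 2 * (2 * pi) * normc a / e.
    by rewrite divr_ge0 ?(ltW e0)// mulr_ge0 ?normc_ge0// ltW.
  lra.
have <- : circ (fun z => q (cexp z)) S = circ (fun z => cexp z / (cexp z - a)) s.
  by apply: (@circ_holo_cst q dq) => // w /andP[w1 _]; apply: qw; exact: lt_le_trans w1.
have qcS y : contc (fun z => q (cexp z)) (mkc S y).
  apply: contc_comp (contc_cexp _) _; apply: wirtinger_cont (qw _ _).
  by rewrite nS.
rewrite -[(2 * pi)%:C%C]mulr1 -(circ_cst 1 S) -circB//; last by move=> y; exact: contc_cst.
rewrite -[leRHS](mulrVK (unitf_gt0 k0)) mulrC; apply: circ_le => y _.
  by apply: contc_sub => //; exact: contc_cst.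
have h1 : expR S - normc a <= normc (cexp (mkc S y) - a).
  by rewrite -(nS y) normc_lerB.
have dpos : 0 < expR S - normc a by rewrite subr_gt0.
have d0 : cexp (mkc S y) - a != 0.
  by rewrite -normc_gt0 (lt_le_trans dpos).
have -> : q (cexp (mkc S y)) - 1 = a / (cexp (mkc S y) - a).
  by rewrite /q; field.
rewrite normcM normcV ler_pdivrMr ?normc_gt0//.
rewrite (le_trans _ (ler_wpM2l _ h1))//; last by rewrite divr_ge0 ?(ltW e0)// ltW.
rewrite (@le_trans _ _ (e / (2 * (2 * pi)) * (M - normc a)))//.
  have -> : M - normc a = 2 * (2 * pi) * normc a / e + 1 by rewrite /M; ring.
  rewrite mulrDr mulr1.
  have cancel (p : R) : p != 0 -> e / (2 * (2 * p)) * (2 * (2 * p) * normc a / e) = normc a.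
    by move=> p0; field; rewrite p0 gt_eqF.
  rewrite cancel; last by rewrite gt_eqF// pi_gt0.
  by rewrite lerDl divr_ge0 ?(ltW e0)// ltW.
by rewrite ler_wpM2l ?divr_ge0 ?(ltW e0) ?(ltW k0)// lerD2r.
Qed.

End CircleMeans.

Section CauchyFormula.
Variable R : realType.
Local Notation C := R[i].
Variables (h h1 : C -> C).
Hypothesis hw : forall z, normc z < 1 -> wirtinger h z (h1 z) 0.

(** The function w (h(w) - h(a)) / (w - a), completed by a h'(a) at a, is holomorphic off a,
    continuous at a and zero at 0, so [circ_removable] makes its mean vanish; the mean of the kernel
    w / (w - a) is known. *)
Theorem cauchy_formula (a : C) (s : R) : s < 0 -> normc a < expR s ->
  circ (fun z => h (cexp z) * (cexp z / (cexp z - a))) s = (2 * pi)%:C%C * h a.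
Proof.
move=> s0 as_; have es1 : expR s < 1 by rewrite expR_lt1.
have a1 : normc a < 1 by exact: lt_trans es1.
pose q w := if w == a then a * h1 a else w * ((h w - h a) / (w - a)).
pose dq w := 1 * ((h w - h a) / (w - a)) +
  w * ((h1 w - 0) * (w - a)^-1 + (h w - h a) * (- (w - a) ^- 2 * (1 - 0))).
have qw w : normc w < 1 -> w != a -> wirtinger q w (dq w) 0.
  move=> w1 wa; have wa0 : w - a != 0 by rewrite subr_eq0.
  have k1 := wirtinger_sub (wirtinger_id w) (wirtinger_cst a w).
  have k2 := wirtinger_holo_comp k1 (wirtinger_inv wa0).
  have k3 := wirtinger_sub (hw w1) (wirtinger_cst (h a) w).
  have k4 := wirtinger_mul (wirtinger_id w) (wirtinger_mul k3 k2).
  have k5 : wirtinger (fun w => w * ((h w - h a) / (w - a))) w (dq w) 0.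
    by apply: wirtinger_eq k4 => //; ring.
  have nwa : 0 < normc (w - a) by rewrite normc_gt0.
  apply: (wirtinger_near nwa _ k5).
  move=> v hv; rewrite /q; case: eqP => // va; move: hv.
  by rewrite va normcBC ltxx.
have qa : contc q a.
  apply/contcP => e e0.
  have B0 : 0 < normc a + 1 by rewrite ltr_pwDr ?normc_ge0.
  have b0 : 0 < normc (h1 a) + 1 by rewrite ltr_pwDr ?normc_ge0.
  pose e' := e / (normc a + 1) / 4.
  have e'0 : 0 < e' by rewrite !divr_gt0.
  have [d d0 hd] := hw a1 e'0.
  exists (Num.min (Num.min d 1) (e / (normc (h1 a) + 1) / 4)).
    by rewrite !lt_min d0 ltr01/= !divr_gt0.
  move=> w; rewrite !lt_min => /andP[/andP[wd w1] w2].
  rewrite /q eqxx; case: eqP => [_|/eqP wa]; first by rewrite subrr normc0.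
  have wa0 : w - a != 0 by rewrite subr_eq0.
  have nwa : 0 < normc (w - a) by rewrite normc_gt0.
  have k := hd _ wd; rewrite [a + _]addrC subrK mul0r addr0 in k.
  have -> : w * ((h w - h a) / (w - a)) - a * h1 a =
     w * ((h w - h a - h1 a * (w - a)) / (w - a)) + (w - a) * h1 a by field.
  rewrite (le_lt_trans (normcD _ _))// !normcM.
  have nw : normc w <= normc a + 1.
    have := normcD a (w - a); rewrite [a + _]addrC subrK; lra.
  have k1 : normc w * (normc (h w - h a - h1 a * (w - a)) * normc (w - a)^-1) <= e / 4.
    rewrite normcV; apply: (@le_trans _ _ ((normc a + 1) * e')).
      apply: ler_pM => //; rewrite ?normc_ge0 ?mulr_ge0 ?invr_ge0 ?normc_ge0//.
      by rewrite ler_pdivrMr.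
    by rewrite /e' le_eqVlt; apply/orP; left; apply/eqP; field; rewrite gt_eqF.
  have k2 : normc (w - a) * normc (h1 a) <= e / 4.
    apply: (@le_trans _ _ (e / (normc (h1 a) + 1) / 4 * (normc (h1 a) + 1))).
      apply: ler_pM; rewrite ?normc_ge0 ?(ltW w2)// lerDl//.
    by rewrite le_eqVlt; apply/orP; left; apply/eqP; field; rewrite gt_eqF.
  lra.
have qc w : normc w < 1 -> contc q w.
  by move=> w1; have [->//|wa] := eqVneq w a; exact: wirtinger_cont (qw _ w1 wa).
have q0 : q 0 = 0 by rewrite /q; case: eqP => [<-|_]; rewrite mul0r.
have := circ_removable s0 as_ qc qw q0.
have ca y : cexp (mkc s y) - a != 0.
  apply/eqP => /subr0_eq h0; move: as_; rewrite -h0 normc_cexp/= ltxx.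
  done.
have n1 y : normc (cexp (mkc s y) : C) < 1 by rewrite normc_cexp/=.
have c1 y : contc (fun z => (cexp z - a)^-1) (mkc s y).
  apply: contc_inv => //; apply: contc_sub (contc_cexp _) _; exact: contc_cst.
have c2 y : contc (fun z => h (cexp z)) (mkc s y).
  by apply: contc_comp (contc_cexp _) _; apply: wirtinger_cont (hw _).
have c3 y : contc (fun z => cexp z / (cexp z - a)) (mkc s y).
  exact: contc_mul (contc_cexp _) (c1 _).
rewrite (@circ_ext _ _ (fun z => h (cexp z) * (cexp z / (cexp z - a)) -
    h a * (cexp z / (cexp z - a)))); last first.
  move=> y; rewrite /q; case: eqP => [h0|_]; first by move: (ca y); rewrite h0 subrr eqxx.
  by field.
rewrite circB; last 2 first.
- by move=> y; apply: contc_mul.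
- by move=> y; apply: contc_mul => //; exact: contc_cst.
rewrite circZ// circ_cauchy_kernel// => /eqP; rewrite subr_eq0 => /eqP ->.
by rewrite mulrC.
Qed.

End CauchyFormula.

(** * Taylor estimates from Cauchy's integral *)

Section CauchyEstimates.
Variable R : realType.
Local Notation C := R[i].
Variables (h h1 : C -> C).
Hypothesis hw : forall z, normc z < 1 -> wirtinger h z (h1 z) 0.

Lemma circ_kernel_estimate (k1 k2 k3 : C -> C) (c : C) (s B M : R) : s < 0 ->
  0 <= B -> (forall y, 0 <= y <= 2 * pi -> normc (h (cexp (mkc s y))) <= B) ->
  (forall y, contc k1 (cexp (mkc s y))) -> (forall y, contc k2 (cexp (mkc s y))) ->
  (forall y, contc k3 (cexp (mkc s y))) ->
  (forall y, normc (k1 (cexp (mkc s y)) - k2 (cexp (mkc s y)) -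
                    c * k3 (cexp (mkc s y))) <= M) ->
  normc (circ (fun z => h (cexp z) * k1 (cexp z)) s -
         circ (fun z => h (cexp z) * k2 (cexp z)) s -
         c * circ (fun z => h (cexp z) * k3 (cexp z)) s) <= 2 * (2 * pi) * (B * M).
Proof.
move=> s0 B0 hB c1 c2 c3 hM.
have ch y : contc (fun z => h (cexp z)) (mkc s y).
  apply: contc_comp (contc_cexp _) _; apply: wirtinger_cont (hw _).
  by rewrite normc_cexp/= expR_lt1.
have ck k y : contc k (cexp (mkc s y)) -> contc (fun z => h (cexp z) * k (cexp z)) (mkc s y).
  by move=> kc; apply: contc_mul (ch y) _; apply: contc_comp (contc_cexp _) _.
rewrite -circZ; last by move=> y; exact: ck.
rewrite -circB; try by move=> y; exact: ck.
have cZ y : contc (fun z => c * (h (cexp z) * k3 (cexp z))) (mkc s y).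
  by apply: contc_mul (contc_cst _ _) _; exact: ck.
rewrite -circB//; last by move=> y; apply: contc_sub; exact: ck.
apply: circ_le => y hy; first by apply: contc_sub => //; apply: contc_sub; exact: ck.
have -> : h (cexp (mkc s y)) * k1 (cexp (mkc s y)) -
  h (cexp (mkc s y)) * k2 (cexp (mkc s y)) - c * (h (cexp (mkc s y)) * k3 (cexp (mkc s y))) =
  h (cexp (mkc s y)) * (k1 (cexp (mkc s y)) - k2 (cexp (mkc s y)) - c * k3 (cexp (mkc s y))).
  by ring.
by rewrite normcM; apply: ler_pM; rewrite ?normc_ge0//; exact: hB.
Qed.

(** The second-order remainder of the Cauchy kernel as a function of its pole. Integrated against h
    it gives the Taylor remainder of h; the next lemma does the same for h'. *)
Lemma taylor_kernel1 (z a b : C) : z - a != 0 -> z - b != 0 ->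
  z / (z - b) - z / (z - a) - (b - a) * (z / (z - a) ^+ 2) =
  z * ((b - a) ^+ 2 / ((z - a) ^+ 2 * (z - b))).
Proof. by move=> za zb; field; rewrite za zb. Qed.

Lemma taylor_kernel2 (z a b : C) : z - a != 0 -> z - b != 0 ->
  z / (z - b) ^+ 2 - z / (z - a) ^+ 2 - (b - a) * (z * 2 / (z - a) ^+ 3) =
  z * ((b - a) ^+ 2 * (3 * (z - a) - 2 * (b - a)) / ((z - a) ^+ 3 * (z - b) ^+ 2)).
Proof. by move=> za zb; field; rewrite za zb. Qed.

Lemma invr_pow_le (u d : R) n : 0 < d -> d <= u -> (u ^+ n)^-1 <= (d ^+ n)^-1.
Proof.
move=> d0 du; have u0 := lt_le_trans d0 du.
by rewrite lef_pV2 ?posrE ?exprn_gt0// lerXn2r ?nnegrE// ltW.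
Qed.

(** g1 and g2 are Cauchy integrals with the kernel differentiated once and twice. On the circle of
    radius (1 + r) / 2 the kernels stay at distance d from their poles, which makes L uniform. *)
Lemma taylor_cauchy (r : R) : 0 <= r -> r < 1 ->
  exists2 L : R, 0 <= L & exists g1 g2 : C -> C,
  forall a b, normc a <= r -> normc b <= r ->
    normc (h b - h a - (b - a) * g1 a) <= L * normc (b - a) ^+ 2 /\
    normc (g1 b - g1 a - (b - a) * g2 a) <= L * normc (b - a) ^+ 2.
Proof.
move=> r0 r1; pose s := ln ((1 + r) / 2).
have m0 : 0 < (1 + r) / 2 by rewrite divr_gt0// ltr_pwDl.
have es : expR s = (1 + r) / 2 by rewrite lnK.
have s0 : s < 0 by rewrite ln_lt0// m0 /=; lra.
pose d := expR s - r; have d0 : 0 < d by rewrite /d es; lra.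
have [B B0 hB] : exists2 B : R, 0 <= B & forall y, 0 <= y <= 2 * pi -> normc (h (cexp (mkc s y))) <= B.
  have [|B B0 hB] := @bounded_rect R s s 0 (2 * pi) (fun z => h (cexp z)) (lexx _) (ltW (pi2_gt0 R)).
    move=> [x y] [/= hx hy]; apply: contc_comp (contc_cexp _) _.
    apply: wirtinger_cont (hw _); rewrite normc_cexp/=.
    by rewrite (le_lt_trans (y := expR s))// ?expR_lt1// ler_expR; case/andP: hx.
  by exists B => // y hy; apply: hB; split; rewrite /= ?lexx.
pose T (k : C -> C -> C) (a : C) := circ (fun z => h (cexp z) * k (cexp z) a) s.
pose w y : C := cexp (mkc s y).
have nw y : normc (w y) = expR s by rewrite normc_cexp.
have nw1 y : normc (w y) <= 1 by rewrite nw expR_le1 ltW.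
have dist y a : normc a <= r -> d <= normc (w y - a).
  by move=> ar; rewrite /d -(nw y); have := normc_lerB (w y) a; lra.
have wa0 y a : normc a <= r -> w y - a != 0.
  by move=> ar; rewrite -normc_gt0; exact: lt_le_trans (dist _ _ ar).
have cinv y a n : normc a <= r -> contc (fun z => ((z - a) ^+ n)^-1) (w y).
  move=> ar; elim: n => [|n IH].
    by apply: contc_ext (contc_cst 1 _) => z; rewrite expr0 invr1.
  have ci := @contc_inv _ (fun z => z - a) (w y) (wa0 y _ ar)
    (contc_sub (contc_id _) (contc_cst a _)).
  apply: contc_ext (contc_mul ci IH).
  by move=> z; rewrite exprS invfM.
pose k1 z a : C := z / (z - a); pose k2 z a : C := z / (z - a) ^+ 2.
pose k3 z a : C := z * 2 / (z - a) ^+ 3.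
have c1 y a : normc a <= r -> contc (k1^~ a) (w y).
  by move=> ar; apply: contc_mul (contc_id _) _; have := cinv y a 1%N ar; apply: contc_ext.
have c2 y a : normc a <= r -> contc (k2^~ a) (w y).
  by move=> ar; apply: contc_mul (contc_id _) _; exact: cinv.
have c3 y a : normc a <= r -> contc (k3^~ a) (w y).
  by move=> ar; apply: contc_mul (contc_mul (contc_id _) (contc_cst _ _)) _; exact: cinv.
(* The 10 bounds |3 (z - a) - 2 (b - a)| in [taylor_kernel2], with both differences of modulus at
   most 2. *)
pose L := 2 * B * ((d ^+ 3)^-1 + 10 * (d ^+ 5)^-1).
have id0 n : 0 <= (d ^+ n)^-1 by rewrite invr_ge0 exprn_ge0// ltW.
have L0 : 0 <= L by rewrite !(mulr_ge0, addr_ge0).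
exists L => //; exists (fun a => (2 * pi)^-1%:C%C * T k2 a), (fun a => (2 * pi)^-1%:C%C * T k3 a).
have p2 := pi2_gt0 R; have p2n : (2 * pi)%:C%C != 0 :> C.
  by rewrite -normc_gt0 normc_real gtr0_norm.
have pV : (2 * pi)^-1%:C%C = ((2 * pi)%:C%C)^-1 :> C by rewrite fmorphV.
move=> a b ar br.
have ab2 : normc (b - a) <= 2.
  by rewrite (le_trans (normcB _ _))//; lra.
have scale (X : C) M : normc X <= 2 * (2 * pi) * (B * M) -> 2 * B * M <= L * normc (b - a) ^+ 2 ->
    normc ((2 * pi)^-1%:C%C * X) <= L * normc (b - a) ^+ 2.
  move=> hX; apply: le_trans; rewrite normcM normc_real gtr0_norm ?invr_gt0//.
  rewrite mulrC ler_pdivrMr// (le_trans hX)// le_eqVlt; apply/orP; left; apply/eqP.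
  by move: (pi : R) => p; ring.
split.
  have -> : h b - h a - (b - a) * ((2 * pi)^-1%:C%C * T k2 a) =
     (2 * pi)^-1%:C%C * (T k1 b - T k1 a - (b - a) * T k2 a).
    have k x : normc x <= r -> T k1 x = (2 * pi)%:C%C * h x.
      by move=> xr; apply: (cauchy_formula hw) => //; rewrite es; lra.
    rewrite !k// pV; move: ((2 * pi)%:C%C) p2n => p p0; by field.
  apply: (scale _ (normc (b - a) ^+ 2 * (d ^+ 3)^-1)); last first.
    have -> : 2 * B * (normc (b - a) ^+ 2 * (d ^+ 3)^-1) =
      2 * B * (d ^+ 3)^-1 * normc (b - a) ^+ 2 by ring.
    rewrite ler_wpM2r ?exprn_ge0 ?normc_ge0// /L ler_wpM2l ?mulr_ge0// lerDl.
    by rewrite mulr_ge0.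
  apply: (circ_kernel_estimate (k1 := k1^~ b) (k2 := k1^~ a) (k3 := k2^~ a)) => //; try by move=> y; exact: c1.
    by move=> y; exact: c2.
  move=> y; rewrite /k1 /k2 taylor_kernel1; try exact: wa0.
  rewrite normcM -[leRHS]mul1r.
  apply: ler_pM; [exact: normc_ge0|exact: normc_ge0|exact: nw1|].
  rewrite (normcM (_ ^+ 2)) normcX normcV (normcM (_ ^+ 2)) normcX (invfM (_ ^+ 2)).
  have -> : d ^+ 3 = d ^+ 2 * d ^+ 1 by ring.
  rewrite ler_wpM2l ?exprn_ge0 ?normc_ge0// (invfM (d ^+ 2)) -(expr1 (normc (_ - b))).
  by apply: ler_pM; rewrite ?invr_ge0 ?exprn_ge0 ?normc_ge0//;
    apply: invr_pow_le => //; exact: dist.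
have -> : (2 * pi)^-1%:C%C * T k2 b - (2 * pi)^-1%:C%C * T k2 a -
   (b - a) * ((2 * pi)^-1%:C%C * T k3 a) =
   (2 * pi)^-1%:C%C * (T k2 b - T k2 a - (b - a) * T k3 a) by ring.
apply: (scale _ (normc (b - a) ^+ 2 * 10 * (d ^+ 5)^-1)); last first.
  have -> : 2 * B * (normc (b - a) ^+ 2 * 10 * (d ^+ 5)^-1) =
    2 * B * (10 * (d ^+ 5)^-1) * normc (b - a) ^+ 2 by ring.
  rewrite ler_wpM2r ?exprn_ge0 ?normc_ge0// /L ler_wpM2l ?mulr_ge0// lerDr//.
apply: (circ_kernel_estimate (k1 := k2^~ b) (k2 := k2^~ a) (k3 := k3^~ a)) => //; try by move=> y; exact: c2.
  by move=> y; exact: c3.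
move=> y; rewrite /k2 /k3 taylor_kernel2; try exact: wa0.
rewrite normcM -[leRHS]mul1r.
apply: ler_pM; [exact: normc_ge0|exact: normc_ge0|exact: nw1|].
rewrite normcM; apply: ler_pM; [exact: normc_ge0|exact: normc_ge0| |].
  rewrite (normcM (_ ^+ 2)) normcX ler_wpM2l ?exprn_ge0 ?normc_ge0//.
  rewrite (le_trans (normcB _ _))// !normcM (normc_nat R 2) (normc_nat R 3).
  have := normcB (w y) a; have := nw1 y; rewrite -/(w y); lra.
have -> : d ^+ 5 = d ^+ 3 * d ^+ 2 by ring.
rewrite normcV (normcM (_ ^+ 3)) !normcX !(invfM (_ ^+ 3)).
apply: ler_pM; rewrite ?invr_ge0 ?exprn_ge0 ?normc_ge0//.
  by apply: invr_pow_le => //; exact: dist.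
by apply: invr_pow_le => //; exact: dist.
Qed.

(** Uniqueness of the derivative identifies g1 with h1; the radius r' > r leaves room for increments
    at points of modulus r. *)
Theorem taylor_holomorphic (r : R) : 0 <= r -> r < 1 ->
  exists2 L : R, 0 <= L & exists g2 : C -> C,
  forall a b, normc a <= r -> normc b <= r ->
    normc (h b - h a - (b - a) * h1 a) <= L * normc (b - a) ^+ 2 /\
    normc (h1 b - h1 a - (b - a) * g2 a) <= L * normc (b - a) ^+ 2.
Proof.
move=> r0 r1; pose r' := (1 + r) / 2.
have r'0 : 0 <= r' by rewrite /r'; lra.
have r'1 : r' < 1 by rewrite /r'; lra.
have rr' : r < r' by rewrite /r'; lra.
have [L L0 [g1 [g2 hL]]] := taylor_cauchy r'0 r'1.
have gE a : normc a <= r -> g1 a = h1 a.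
  move=> ar; apply: (@wirtinger_uniq _ h a _ _ 0); last first.
    by apply: hw; exact: le_lt_trans r1.
  apply: (@small_quadratic _ _ L (r' - r)); first by rewrite subr_gt0.
  move=> k hk; have ak : normc (a + k) <= r'.
    by rewrite (le_trans (normcD _ _))//; lra.
  have [|k1 _] := hL a (a + k) _ ak; first by rewrite (le_trans ar)// ltW.
  by move: k1; rewrite [a + k]addrC addrK mul0r addr0 [k * _]mulrC.
exists L => //; exists g2 => a b ar br; rewrite -!gE//.
by apply: hL; rewrite (le_trans _ (ltW rr')).
Qed.

Lemma holomorphic_deriv (a : C) : normc a < 1 -> exists l, wirtinger h1 a l 0.
Proof.
move=> a1; pose r := (1 + normc a) / 2; have na := normc_ge0 a.
have r0 : 0 <= r by rewrite /r; lra.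
have r1 : r < 1 by rewrite /r; lra.
have [L L0 [g2 hL]] := taylor_holomorphic r0 r1.
exists (g2 a); apply: (@small_quadratic _ _ L (r - normc a)); first by rewrite /r; lra.
move=> k hk; have ak : normc (a + k) <= r.
  by rewrite (le_trans (normcD _ _))//; lra.
have [|_ k1] := hL a (a + k) _ ak; first by rewrite /r; lra.
by move: k1; rewrite [a + k]addrC addrK mul0r addr0 [k * _]mulrC.
Qed.

End CauchyEstimates.

(** * The cluster set *)

Section ClusterSet.
Variable R : realType.
Local Notation C := R[i].
Variable f : Cplx R -> Cplx R.

Lemma cluster_near (w : C) : cluster_set f w ->
  forall e r : R, 0 < e -> r < 1 ->
  exists z : C, [/\ normc z < 1, r < normc z & normc (f z - w) < e].
Proof.
move=> [z_ [z1 zcv fcv]] e r e0 r1.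
have r1' : 0 < 1 - r by rewrite subr_gt0.
have /cvgrPdist_lt/(_ _ r1')[N1 _ h1] := zcv.
have ec0 : 0 < (e%:C%C : Cplx R) by rewrite ltcR.
have /cvgrPdist_lt/(_ _ ec0)[N2 _ h2] := fcv.
pose n := maxn N1 N2; exists (z_ n); split; first exact: z1.
  have := h1 n (leq_maxl _ _); rewrite /= ltr_distlC => /andP[]; lra.
have := h2 n (leq_maxr _ _); rewrite /= normC_def ltcR normcBC; exact.
Qed.

Lemma near_cluster (w : C) : (forall e r : R, 0 < e -> r < 1 ->
  exists z : C, [/\ normc z < 1, r < normc z & normc (f z - w) < e]) ->
  cluster_set f w.
Proof.
move=> hw; have hw' (n : nat) : exists z : C, [/\ normc z < 1,
    1 - n.+1%:R^-1 < normc z & normc (f z - w) < n.+1%:R^-1].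
  by apply: hw; rewrite ?invr_gt0// ltrBlDr ltrDl invr_gt0.
have [z_ hz] := choice hw'; exists (z_ : nat -> Cplx R); split.
- by move=> n; have [] := hz n.
- apply/cvgrPdist_lt => e e0; near=> n; have [h1 h2 _] := hz n.
  have k : n.+1%:R^-1 < e by near: n; exact: near_infty_natSinv_lt (PosNum e0).
  have aux (x u e' : R) : x < 1 -> 1 - u < x -> u < e' -> 1 - e' < x < 1 + e' by lra.
  by rewrite ltr_distlC; exact: aux h1 h2 k.
apply/cvgrPdist_lt => e e0; have eE : e = (complex.Re e)%:C%C.
  by case: e e0 => x y; rewrite ltcE/= => /andP[/eqP -> _].
have e0' : 0 < complex.Re e by move: e0; rewrite eE ltcR.
near=> n; have [_ _ h3] := hz n; rewrite eE normC_def ltcR normcBC.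
by rewrite (lt_trans h3)//; near: n; exact: near_infty_natSinv_lt (PosNum e0').
Unshelve. all: by end_near. Qed.

Lemma not_cluster (w : C) : ~ cluster_set f w ->
  exists2 d : R, 0 < d & exists2 r : R, 0 <= r < 1 &
  forall z : C, normc z < 1 -> r < normc z -> d <= normc (f z - w).
Proof.
move=> nw; apply/not_notP => hN; apply: nw; apply: near_cluster => e r e0 r1.
apply/not_notP => hN'; apply: hN; exists e => //; exists (Num.max r 0).
  by rewrite le_max lexx orbT gt_max r1 ltr01.
move=> z z1; rewrite gt_max => /andP[rz _]; rewrite leNgt; apply/negP => h.
by apply: hN'; exists z.
Qed.

Lemma not_cluster_open (w : C) : ~ cluster_set f w ->
  exists2 d : R, 0 < d & forall w', normc (w' - w) < d -> ~ cluster_set f w'.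
Proof.
move=> /not_cluster[d d0 [r /andP[r0 r1] h]]; exists (d / 2); first by rewrite divr_gt0.
move=> w' ww' /cluster_near/(_ (d / 2) r)[|//|z [z1 rz hz]]; first by rewrite divr_gt0.
have := h z z1 rz; have := normcD (f z - w') (w' - w); rewrite addrA subrK; lra.
Qed.

(** Each p has a neighbourhood that either contains no value of f near the unit circle or misses S;
    bisection makes the radius r uniform. *)
Lemma eventually_avoids (S : set C) (a b c d : R) : a <= b -> c <= d ->
  (forall p, rect a b c d p -> ~ cluster_set f p \/
     exists2 e : R, 0 < e & forall w, normc (w - p) < e -> ~ S w) ->
  exists2 r : R, 0 <= r < 1 & forall z : C, normc z < 1 -> r < normc z ->
    rect a b c d (f z) -> ~ S (f z).
Proof.
move=> ab cd hS.
pose Q x1 x2 y1 y2 := exists2 r : R, 0 <= r < 1 &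
  forall w, rect x1 x2 y1 y2 w ->
    forall z : C, normc z < 1 -> r < normc z -> w = f z -> ~ S w.
suff [r r1 h] : Q a b c d by exists r => // z z1 rz hz; exact: h hz z z1 rz erefl.
apply: rect_ind => //.
  move=> x1 x2 y1 y2 _ _ _ _ _ _ mx my [r1 r10 h1] [r2 r20 h2] [r3 r30 h3] [r4 r40 h4].
  exists (Num.max (Num.max r1 r2) (Num.max r3 r4)).
    by rewrite !le_max !gt_max; move: r10 r20 r30 r40 => /andP[-> ->] /andP[_ ->] /andP[_ ->] /andP[_ ->].
  apply: rect_quarters => w hw z z1; rewrite !gt_max => /andP[/andP[? ?] /andP[? ?]];
    move=> wz; by [apply: (h1 _ hw _ z1)|apply: (h2 _ hw _ z1)|apply: (h3 _ hw _ z1)|apply: (h4 _ hw _ z1)].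
move=> p hp; have [np|[e e0 h]] := hS p hp.
  have [e e0 [r r1 h]] := not_cluster np; exists e => // x1 x2 y1 y2 _ _ _ _ _ hs.
  exists r => // w /hs hw z z1 rz wz; exfalso; have := h z z1 rz.
  by rewrite -wz leNgt hw.
exists e => // x1 x2 y1 y2 _ _ _ _ _ hs; exists 0; first by rewrite lexx ltr01.
by move=> w /hs /h.
Qed.

End ClusterSet.

Section LinearMeasure.
Variable R : realType.
Local Notation C := R[i].
Implicit Types E : set (Cplx R).

Lemma linear_measure_cover E : (linear_measure E < +oo)%E ->
  exists2 M : R, 0 <= M & forall eps : R, 0 < eps -> exists (c : nat -> Cplx R) (rho : nat -> R),
    disc_cover E eps c rho /\ (\sum_(0 <= n <oo) (2 * rho n)%:E <= M%:E)%E.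
Proof.
move=> hE.
(* A smaller mesh allows fewer covers, so the premeasure is nonincreasing and its limit at 0 from
   the right is its supremum. *)
have mono : {in Interval (BRight (0 : R)) +oo%O &, {homo linear_premeasure E : x y / (y <= x)%R >-> (x <= y)%E}}.
  move=> x y _ _ yx; apply: ereal_inf_le_tmp => _ [c [rho [[h1 h2] ->]]].
  exists c, rho; split => //; split => // n; have [k1 k2] := h1 n.
  by split => //; exact: lt_le_trans yx.
have cv := @nonincreasing_at_right_cvge R (linear_premeasure E) 0 +oo%O isT.
have le_lim eps : 0 < eps -> (linear_premeasure E eps <= linear_measure E)%E.
  move=> eps0; rewrite /linear_measure (cvg_lim _ (cv _))//; last first.

    by move=> x y xI yI xy; exact: (mono y x yI xI xy).
  by apply: ereal_sup_ubound; exists eps => //=; rewrite in_itv/= eps0.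
have ge0 eps : (0 <= linear_premeasure E eps)%E.
  apply: le_ereal_inf_tmp => _ [c [rho [[h1 h2] ->]]]; apply: nneseries_ge0 => n _ _.
  by rewrite lee_fin mulr_ge0//; have [] := h1 n.
have lm0 : (0 <= linear_measure E)%E by apply: le_trans (ge0 1) _; exact: le_lim.
have lmf : linear_measure E \is a fin_num by rewrite ge0_fin_numE.
(* The added 1 puts the bound strictly above the infimum, so that an actual cover stays below it,
   for every mesh. *)
exists (fine (linear_measure E) + 1); first by rewrite addr_ge0// fine_ge0.
move=> eps eps0; have : (linear_premeasure E eps < (fine (linear_measure E) + 1)%:E)%E.
  by rewrite (le_lt_trans (le_lim _ eps0))// EFinD fineK// lteDl// lte_fin.
move=> /ereal_inf_lt[_ [c [rho [h ->]]] /ltW hs].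
by exists c, rho.
Qed.

Lemma disc_cover_sum_le (rho : nat -> R) (M : R) :
  (forall n, 0 <= rho n) -> (\sum_(0 <= n <oo) (2 * rho n)%:E <= M%:E)%E ->
  forall n, \sum_(k <- iota 0 n) 2 * rho k <= M.
Proof.
move=> r0 hM n; rewrite -lee_fin; apply: le_trans hM.
rewrite -sumEFin -[n]subn0 -/(index_iota 0 n); apply: nneseries_lim_ge => k _ _.
by rewrite lee_fin mulr_ge0.
Qed.

(** The radii of the circles about 0 that meet the n-th disc lie in an interval of length 2 rho_n.
    These lengths add up to at most M, less than the length M + 1 of [A + 1, A + 2 + M]. *)
Lemma circle_avoiding_cover (c : nat -> Cplx R) (rho : nat -> R) (M A : R) :
  0 <= M -> (forall n, 0 <= rho n) -> (\sum_(0 <= n <oo) (2 * rho n)%:E <= M%:E)%E ->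
  exists2 r : R, A < r & forall (w : C) n, normc w = r -> rho n <= normc (w - c n).
Proof.
move=> M0 r0 hM; apply/not_notP => hN.
pose I n := `](normc (c n) - rho n), (normc (c n) + rho n)[%classic : set R.
have sub : `[A + 1, A + 2 + M]%classic `<=` \bigcup_n I n.
  move=> r /=; rewrite in_itv/= => /andP[Ar _]; apply/not_notP => hr; apply: hN.
  exists r; first by lra.
  move=> w n wr; rewrite leNgt; apply/negP => hw; apply: hr; exists n => //.
  rewrite /I/= in_itv/=; have := normc_lerB w (c n); have := normc_lerB (c n) w.
  rewrite normcBC; lra.
have := @measure_sigma_subadditive _ _ _ (@lebesgue_measure R)
  `[A + 1, A + 2 + M]%classic I (fun n => measurable_itv _) (measurable_itv _) sub.
have := @lebesgue_measure_itv R (Interval (BLeft (A + 1)) (BRight (A + 2 + M))).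
rewrite /= lte_fin ifT; last by lra.
move=> ->; apply/negP; rewrite -ltNge.
apply: (@le_lt_trans _ _ M%:E); last by rewrite -EFinB lte_fin; lra.
apply: le_trans hM; apply: lee_nneseries => // n _ /=.
have := @lebesgue_measure_itv R (Interval (BRight (normc (c n) - rho n)) (BLeft (normc (c n) + rho n))).
rewrite /I /= => ->; case: ifP => _; last by rewrite lee_fin mulr_ge0.
by rewrite -EFinB lee_fin; lra.
Qed.

End LinearMeasure.

(** * The cluster set is not empty and f is bounded *)

Section Boundedness.
Variable R : realType.
Local Notation C := R[i].
Variables (f : Cplx R -> Cplx R) (f1 : C -> C).
Hypothesis fw : forall z : C, normc z < 1 -> wirtinger (f : C -> C) z (f1 z) 0.

Lemma cexp_surj (z : C) : z != 0 -> exists w, cexp w = z.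
Proof.
move=> z0; have nz : 0 < normc z by rewrite normc_gt0.
pose x := complex.Re z / normc z; pose y := complex.Im z / normc z.
have xy : x ^+ 2 + y ^+ 2 = 1.
  by rewrite /x /y !expr_div_n -mulrDl -sqr_normc divff// expf_neq0// gt_eqF.
have x1 : -1 <= x <= 1.
  have := normRe_le z; rewrite ler_norml => /andP[k1 k2].
  by rewrite /x ler_pdivlMr// ler_pdivrMr// mulN1r mul1r k1.
(* [acos] gives an angle in [0, pi]; the sign of the imaginary part selects it or its opposite. *)
pose t := if 0 <= y then acos x else - acos x.
have ct : cos t = x by rewrite /t; case: ifP => _; rewrite ?cosN acosK// in_itv.
have st : sin t = y.
  have s2 : Num.sqrt (1 - x ^+ 2) = `|y|.
    by rewrite -xy addrC addKr sqrtr_sqr.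
  rewrite /t; case: ifP => h; rewrite ?sinN sin_acos// s2; first by rewrite ger0_norm.
  by rewrite ltr0_norm ?opprK// ltNge h.
exists (mkc (ln (normc z)) t); rewrite cexp_mkc lnK// /expi ct st /x /y.
apply: complexP; rewrite ?ReM ?ImM/= mul0r ?subr0 ?addr0 mulrC divfK// gt_eqF//.
Qed.

Lemma bounded_inside (r : R) : 0 <= r -> r < 1 ->
  exists2 B : R, 0 <= B & forall z : C, normc z <= r -> normc (f z) <= B.
Proof.
move=> r0 r1; have [L L0 [g2 hL]] := taylor_holomorphic fw r0 r1.
have n0 : normc (0 : C) <= r by rewrite normc0.
exists (L + normc (f 0) + normc (f1 0)).
  by rewrite !addr_ge0 ?normc_ge0.
move=> z zr; have [h _] := hL 0 z n0 zr; rewrite subr0 in h.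
have z1 : normc z <= 1 by rewrite (le_trans zr)// ltW.
have h1 : L * normc z ^+ 2 <= L.
  by rewrite ler_piMr// exprn_ile1// normc_ge0.
have h2 : normc (z * f1 0) <= normc (f1 0).
  by rewrite normcM ler_piMl ?normc_ge0.
have -> : f z = (f z - f 0 - z * f1 0) + f 0 + z * f1 0 by ring.
rewrite (le_trans (normcD _ _))// lerD//; rewrite (le_trans (normcD _ _))// lerD//.
exact: le_trans h h1.
Qed.

Lemma contc_holo (z : C) : normc z < 1 -> contc (f : C -> C) z.
Proof. by move=> /fw; exact: wirtinger_cont. Qed.

Lemma no_cluster_escape : ~ (exists w, cluster_set f w) ->
  forall B : R, 0 < B -> exists2 r : R, 0 <= r < 1 &
  forall z : C, normc z < 1 -> r < normc z -> B <= normc (f z).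
Proof.
move=> nc B B0; have BB : - B <= B by lra.
have [|r r1 h] := @eventually_avoids _ f setT (- B) B (- B) B BB BB.
  by move=> p _; left => hp; apply: nc; exists p.
exists r => // z z1 rz; rewrite leNgt; apply/negP => hB; apply: (h z z1 rz) => //.
split; rewrite -ler_norml.
  by rewrite (le_trans (normRe_le _))// ltW.
by rewrite (le_trans (normIm_le _))// ltW.
Qed.

(** ln |f|^2 replaces the logarithm of f, for which a branch would have to be chosen; its dbar
    derivative is the conjugate of f'/f. *)
Lemma wirtinger_ln_sqr_normc (z : C) : normc z < 1 -> f z != 0 ->
  exists a, wirtinger (fun w => (ln (complex.Re (f w * (f w)^*%C)))%:C%C : C) z a
    (f1 z / f z)^*%C.
Proof.
move=> z1 fz0; have nfz : 0 < normc (f z) by rewrite normc_gt0.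
have h1 := wirtinger_mul (fw z1) (wirtinger_conj (fw z1)).
have e1 : f z * (f z)^*%C = (normc (f z) ^+ 2)%:C%C by exact: mulcconj.
have p0 : 0 < complex.Re (f z * (f z)^*%C) by rewrite e1 /= exprn_gt0.
have h2 := wirtinger_Re (is_derive1_ln p0).
have h3 := wirtinger_comp h1 h2.
eexists; apply: wirtinger_eq h3; first by reflexivity.
have cf0 : (f z)^*%C != 0 by rewrite conjc_eq0.
have -> : (f1 z / f z)^*%C = (f1 z)^*%C / (f z)^*%C by rewrite rmorphM/= conjc_inv.
have -> : ((complex.Re (f z * (f z)^*%C))^-1 / 2)%:C%C = (f z * (f z)^*%C * 2)^-1 :> C.
  rewrite {1}e1 /=.
  have -> : (normc (f z) ^+ 2)^-1 / 2 = ((normc (f z) ^+ 2) * 2)^-1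
    by rewrite (invfM (normc (f z) ^+ 2)).
  by rewrite fmorphV rmorphM/= -e1 (rmorph_nat (real_complex R) 2).
have -> : (f1 z * (f z)^*%C + f z * 0^*%C)^*%C = (f1 z)^*%C * f z.
  by rewrite rmorph0 mulr0 addr0 rmorphM/= conjcK.
by field; rewrite fz0 cf0.
Qed.

(** Otherwise |f| tends to infinity at the circle and f has no zeros in an outer annulus. There the
    mean of ln |f|^2 is an affine function of the logarithm of the radius, hence bounded up to the
    circle, which contradicts the growth of |f|. *)
Lemma cluster_nonempty : exists w, cluster_set f w.
Proof.
apply/not_notP => nc; have esc := no_cluster_escape nc.
have [r /andP[r0 r1] hr] := esc 1 ltr01.
have fn0 z : normc z < 1 -> r < normc z -> f z != 0.
  by move=> z1 rz; rewrite -normc_gt0; apply: lt_le_trans (hr z z1 rz).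
pose T := ln ((1 + r) / 2).
have m0 : 0 < (1 + r) / 2 by rewrite divr_gt0// ltr_pwDl.
have eT : expR T = (1 + r) / 2 by rewrite lnK.
have T0 : T < 0 by rewrite ln_lt0// m0 /=; lra.
have /choice[f2 hf2] : forall z, exists l, normc z < 1 -> wirtinger f1 z l 0.
  move=> z; have [z1|z1] := ltP (normc z) 1; last by exists 0.
  by have [l hl] := holomorphic_deriv fw z1; exists l.
pose q w := w * (f1 w / f w).
pose dq w := 1 * (f1 w / f w) + w * (f2 w * (f w)^-1 + f1 w * (- (f w) ^- 2 * f1 w)).
have qw w : normc w < 1 -> r < normc w -> wirtinger q w (dq w) 0.
  move=> w1 rw; have h0 := fn0 w w1 rw.
  have k1 := wirtinger_holo_comp (fw w1) (wirtinger_inv h0).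
  have k2 := wirtinger_mul (wirtinger_id w) (wirtinger_mul (hf2 _ w1) k1).
  by apply: wirtinger_eq k2 => //; ring.
have inside (s z : _) : s < 0 -> T <= complex.Re z <= s -> normc (cexp z : C) < 1 /\ r < normc (cexp z : C).
  move=> s0 /andP[z1 z2]; rewrite normc_cexp; split.
    by rewrite expR_lt1 (le_lt_trans z2).
  by rewrite (lt_le_trans _ (y := expR T)) ?ler_expR// eT; lra.
pose kap := circ (fun z => q (cexp z)) T.
pose u w : C := (ln (complex.Re (f w * (f w)^*%C)))%:C%C.
have /choice[ua hua] : forall z, exists a, normc z < 1 -> r < normc z ->
    wirtinger u z a (f1 z / f z)^*%C.
  move=> z; have [z1|z1] := ltP (normc z) 1; last by exists 0.
  have [rz|rz] := ltP r (normc z); last by exists 0.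
  by have [l hl] := wirtinger_ln_sqr_normc z1 (fn0 _ z1 rz); exists l.
pose psi z := u (cexp z).
have psiw (s : R) z : s < 0 -> T <= complex.Re z <= s ->
    wirtinger psi z (ua (cexp z) * cexp z) (q (cexp z))^*%C.
  move=> s0 hz; have [z1 z2] := inside s z s0 hz.
  apply: wirtinger_eq (wirtinger_precomp_holo (wirtinger_cexp z) (hua _ z1 z2)) => //.
  by rewrite -rmorphM mulrC.
have qcont (s : R) z : s < 0 -> T <= complex.Re z <= s -> contc (fun z => (q (cexp z))^*%C) z.
  move=> s0 hz; have [z1 z2] := inside s z s0 hz.
  apply: contc_conj; apply: contc_comp (contc_cexp _) _.
  exact: wirtinger_cont (qw _ z1 z2).
pose M := normc (circ psi T) + 2 * (- T * normc kap).
have M0 : 0 <= M by rewrite addr_ge0 ?mulr_ge0 ?normc_ge0// oppr_ge0 ltW.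
have bound s : T < s -> s < 0 -> normc (circ psi s) <= M.
  move=> Ts s0; have fl := flux Ts (fun z => psiw s z s0) (fun z => qcont s z s0).
  have {fl} := fl _; rewrite {1}/psi.
  move=> /(_ (fun x _ => congr1 u (cexp_per x))) fl.
  (* The inner integral is independent of the radius because q(w) = w f'(w) / f(w) is holomorphic in
     the annulus. *)
  have dE : dint T s 0 (2 * pi) (fun z => (q (cexp z))^*%C) = (s - T)%:C%C * kap^*%C.
    rewrite -cint_cst ?(ltW Ts)//; apply: cint_ext => x /andP[x1 x2].
    rewrite -/(circ (fun z => (q (cexp z))^*%C) x) circ_conj; last first.
      move=> y; have [|k1 k2] := inside s (mkc x y) s0; first by rewrite /= x1 x2.
      by apply: contc_comp (contc_cexp _) _; exact: wirtinger_cont (qw _ k1 k2).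
    congr (_^*%C); move: x1; rewrite le_eqVlt => /predU1P[<-//|Tx].
    apply: (@circ_holo_cst _ q dq) => // w /andP[w1 w2]; apply: qw.
      by rewrite (le_lt_trans w2)// expR_lt1 (le_lt_trans x2).
    by rewrite (lt_le_trans _ w1)// eT; lra.
  have -> : circ psi s = circ psi T + 2 * dint T s 0 (2 * pi) (fun z => (q (cexp z))^*%C).
    by rewrite -fl addrC subrK.
  rewrite (le_trans (normcD _ _))// /M lerD2l normcM (normc_nat R 2) ler_pM2l//.
  rewrite dE normcM normc_real normc_conj ger0_norm; last by rewrite subr_ge0 ltW.
  by rewrite ler_wpM2r ?normc_ge0//; lra.
(* Where |f| >= e^(M + 1) >= 1, also ln |f|^2 >= M + 1, so the integral over the circle is at least
   2 pi (M + 1) > M. *)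
have [r2 /andP[r20 r21] hr2] := esc (expR (M + 1)) (expR_gt0 _).
pose m := Num.max r2 ((1 + r) / 2).
have mm : 0 < m by rewrite lt_max m0 orbT.
have m1 : m < 1 by rewrite gt_max r21; lra.
pose s := ln ((1 + m) / 2).
have ms0 : 0 < (1 + m) / 2 by rewrite divr_gt0// ltr_pwDl// ltW.
have es : expR s = (1 + m) / 2 by rewrite lnK.
have s0 : s < 0 by rewrite ln_lt0// ms0 /=; lra.
have mes : m < expR s by rewrite es; lra.
have Ts : T < s by rewrite -ltr_expR eT (le_lt_trans _ mes)// le_max lexx orbT.
have := bound s Ts s0; apply/negP; rewrite -ltNge.
rewrite (lt_le_trans _ (normRe_le _))// (lt_le_trans _ (ler_norm _))//.
have pc y : contc psi (mkc s y).
  by apply: wirtinger_cont (psiw s _ s0 _); rewrite /= lexx ltW.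
have low : (2 * pi - 0) * (M + 1) <= complex.Re (circ psi s).
  rewrite -(rint_cst (M + 1) (ltW (pi2_gt0 R))); apply: rint_le.
  - exact: cont_itv_cst.
  - exact: cont_seg_Re (circ_cont_seg pc).
  move=> y _; rewrite /psi /u /=.
  have nz : normc (cexp (mkc s y) : C) = expR s by rewrite normc_cexp.
  have := hr2 (cexp (mkc s y)); rewrite nz expR_lt1 => /(_ s0) k.
  have {k} k : expR (M + 1) <= normc (f (cexp (mkc s y))).
    by apply: k; rewrite (le_lt_trans _ mes)// le_max lexx.
  rewrite mulcconj/= -ler_expR lnK; last first.
    by rewrite posrE exprn_gt0// (lt_le_trans _ k)// expR_gt0.
  rewrite (le_trans k)// expr2 ler_peMl ?normc_ge0//.
  by rewrite (le_trans _ k)// -expR0 ler_expR addr_ge0.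
apply: lt_le_trans low; rewrite subr0.
have := pi_ge2 R; nra.
Qed.

(** Some circle |w| = r around a cluster point misses the cluster set, so f omits its points in an
    annulus a < |z| < 1. This annulus is connected and contains a point with |f| < r, hence |f| < r
    on all of it. *)
Lemma bounded_of_linear_measure : (linear_measure (cluster_set f) < +oo)%E ->
  exists2 B : R, 0 < B & forall z : C, normc z < 1 -> normc (f z) <= B.
Proof.
move=> /linear_measure_cover[M M0 /(_ 1 ltr01) [c [rho [[h1 h2] hs]]]].
have [w0 hw0] := cluster_nonempty.
have rho0 n : 0 <= rho n by have [] := h1 n.
have [r w0r hr] := circle_avoiding_cover c (normc w0) M0 rho0 hs.
have r0 : 0 < r by rewrite (le_lt_trans _ w0r)// normc_ge0.
pose S : set C := [set w | normc w = r].
have nS p : S p -> ~ cluster_set f p.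
  move=> hp /h2[n _ /=]; rewrite ltNge => /negP; apply; exact: hr.
have rr : - r <= r by lra.
have [|a /andP[a0 a1] ha] := @eventually_avoids _ f S (- r) r (- r) r rr rr.
  move=> p _; have [pr|pr] := eqVneq (normc p) r; first by left; exact: nS.
  right; exists `|normc p - r|; first by rewrite normr_gt0 subr_eq0.
  move=> w hw wr; move: hw; rewrite /S /= in wr; rewrite -wr ltNge => /negP; apply.
  rewrite ler_norml; have := normc_lerB p w; have := normc_lerB w p.
  rewrite [normc (p - w)]normcBC; lra.
have ne z : normc z < 1 -> a < normc z -> normc (f z) <> r.
  move=> z1 az e; apply: (ha z z1 az) => //; split; rewrite -ler_norml -e.
    exact: normRe_le.
  exact: normIm_le.
have d0 : 0 < r - normc w0 by rewrite subr_gt0.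
have [z1 [z11 az1 hz1]] := cluster_near hw0 d0 a1.
have fz1 : normc (f z1) < r by have := normc_lerB (f z1) w0; lra.
have near z : normc z < 1 -> a < normc z -> normc (f z) < r.
  move=> z2 az; rewrite ltNge; apply/negP => rz.
  have zn0 : z != 0 by rewrite -normc_gt0 (le_lt_trans a0).
  have z1n0 : z1 != 0 by rewrite -normc_gt0 (le_lt_trans a0).
  have [x hx] := cexp_surj z1n0; have [y hy] := cexp_surj zn0.
  (* A segment between logarithms: its image under [cexp] stays in the annulus because ln |z| is
     interpolated linearly. *)
  pose p (t : R) := x + t%:C%C * (y - x).
  have pin t : 0 <= t <= 1 -> normc (cexp (p t)) < 1 /\ a < normc (cexp (p t)).
    move=> /andP[t0 t1]; rewrite normc_cexp /p ReD ReM ReD ReN/= mul0r subr0.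
    move: z11 az1 z2 az; rewrite -hx -hy !normc_cexp !expR_lt1 => k1 k2 k3 k4.
    have hmin : Num.min (complex.Re x) (complex.Re y) <=
       complex.Re x + t * (complex.Re y - complex.Re x).
      by rewrite ge_min; case: (leP (complex.Re x) (complex.Re y)) => k; apply/orP;
        [left|right]; nra.
    split; first by nra.
    apply: lt_le_trans (_ : expR (Num.min (complex.Re x) (complex.Re y)) <= _).
      by rewrite minEle; case: ifP.
    by rewrite ler_expR.
  have [||t] := @IVT R (fun t => normc (f (cexp (p t)))) 0 1 r ler01.
  - apply: cont_itv_within => t ht e e0; have [k1 k2] := pin t ht.
    have cc : contc (fun z => f (cexp z)) (p t).
      by apply: contc_comp (contc_cexp _) _; exact: contc_holo.
    have /contcP/(_ _ e0)[d dd h] := cc.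
    have D0 : 0 < normc (y - x) + 1 by rewrite ltr_pwDr ?normc_ge0.
    exists (d / (normc (y - x) + 1)); first by rewrite divr_gt0.
    move=> t' _ tt; have {}h : normc (f (cexp (p t')) - f (cexp (p t))) < e.
      apply: h; have -> : p t' - p t = (t' - t)%:C%C * (y - x).
        by rewrite /p rmorphB/=; ring.
      rewrite normcM normc_real (le_lt_trans (y := `|t' - t| * (normc (y - x) + 1)))//.
        by rewrite ler_wpM2l// lerDl.
      by rewrite -ltr_pdivlMr.
    apply: le_lt_trans h; rewrite ler_norml.
    have := normc_lerB (f (cexp (p t'))) (f (cexp (p t))).
    have := normc_lerB (f (cexp (p t))) (f (cexp (p t'))).
    rewrite [normc (f (cexp (p t)) - _)]normcBC; lra.
  - have -> : p 0 = x by rewrite /p rmorph0 mul0r addr0.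
    have -> : p 1 = y by rewrite /p rmorph1 mul1r addrC subrK.
    by rewrite hx hy ge_min le_max rz orbT (ltW fz1).
  rewrite in_itv/= => /pin[k1 k2]; exact: ne.
have [B B0 hB] := bounded_inside a0 a1.
exists (B + r); first by rewrite ltr_pwDr.
move=> z z2; have [za|az] := leP (normc z) a.
  by rewrite (le_trans (hB z za))// lerDl ltW.
by rewrite (le_trans (ltW (near z z2 az)))// lerDr.
Qed.

Lemma cluster_bounded (B : R) : (forall z : C, normc z < 1 -> normc (f z) <= B) ->
  forall w, cluster_set f w -> normc w <= B.
Proof.
move=> hB w hw; apply/ler_addgt0Pr => e e0.
have [z [z1 _ hz]] := cluster_near hw e0 (ltr01 : 0 < 1 :> R).
have := hB z z1; have := normc_lerB w (f z); rewrite normcBC; lra.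
Qed.

End Boundedness.

(** * The valence *)

Section PositivePartSquare.
Variable R : realType.
Local Notation C := R[i].

(** The square of the positive part has a Lipschitz derivative. This is the reason for building the
    bumps and cut-offs as such squares: they are differentiable with explicit coefficients and
    compact support. *)
Lemma pos_sqr_remainder (x h : R) :
  `|Num.max 0 (x + h) ^+ 2 - Num.max 0 x ^+ 2 - 2 * Num.max 0 x * h| <= h ^+ 2.
Proof.
rewrite ler_norml; have h0 := sqr_ge0 h.
have [x0|x0] := leP x 0; have [y0|y0] := leP (x + h) 0; apply/andP; split; nra.
Qed.

Lemma wirtinger_pos_sqr (z : C) :
  wirtinger (fun w => (Num.max 0 (complex.Re w) ^+ 2)%:C%C) z
    (Num.max 0 (complex.Re z))%:C%C (Num.max 0 (complex.Re z))%:C%C.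
Proof.
apply: (@small_quadratic _ _ 1 1) => // h _; rewrite mul1r.
have -> : (Num.max 0 (complex.Re (z + h)) ^+ 2)%:C%C - (Num.max 0 (complex.Re z) ^+ 2)%:C%C -
   ((Num.max 0 (complex.Re z))%:C%C * h + (Num.max 0 (complex.Re z))%:C%C * h^*%C) =
   (Num.max 0 (complex.Re z + complex.Re h) ^+ 2 - Num.max 0 (complex.Re z) ^+ 2 -
   2 * Num.max 0 (complex.Re z) * complex.Re h)%:C%C :> C.
  rewrite ReD; case: h => a b; apply: complexP;
    rewrite ?(ReD, ImD, ReN, ImN, ReM, ImM)/=; ring.
rewrite normc_real (le_trans (pos_sqr_remainder _ _))//.
rewrite -real_normK ?num_real// lerXn2r ?nnegrE ?normc_ge0// normRe_le//.
Qed.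

(** The support is the disc of radius lam^(-1/2) around w. The function is only continuous; its
    square [bump2] is differentiable. *)
Definition bump (lam : R) (w u : C) : R := Num.max 0 (1 - lam * normc (u - w) ^+ 2).

Lemma bump_ge0 lam w u : 0 <= bump lam w u.
Proof. by rewrite le_max lexx. Qed.

Lemma bump_le1 lam w u : 0 <= lam -> bump lam w u <= 1.
Proof.
move=> l0; rewrite ge_max ler01 /= gerBl mulr_ge0// exprn_ge0// normc_ge0//.
Qed.

Lemma bump_eq0 lam w u : 1 <= lam * normc (u - w) ^+ 2 -> bump lam w u = 0.
Proof. by move=> h; apply/max_idPl; rewrite subr_le0. Qed.

Definition bump2 lam w u : C := (bump lam w u ^+ 2)%:C%C.

Lemma wirtinger_subr (w u : C) : wirtinger (fun v => v - w) u 1 0.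
Proof.
by apply: wirtinger_eq (wirtinger_sub (wirtinger_id u) (wirtinger_cst w u)); rewrite subr0.
Qed.

Lemma wirtinger_subr_conj (w u : C) : wirtinger (fun v => (v - w)^*%C) u 0 1.
Proof.
by apply: wirtinger_eq (wirtinger_conj (wirtinger_subr w u)); rewrite ?rmorph0 ?rmorph1.
Qed.

Lemma wirtinger_bump2 lam w u :
  wirtinger (bump2 lam w) u (- (2 * lam * bump lam w u)%:C%C * (u - w)^*%C)
    (- (2 * lam * bump lam w u)%:C%C * (u - w)).
Proof.
pose P (v : C) := 1 + - lam%:C%C * ((v - w) * (v - w)^*%C).
have hP : wirtinger P u (- lam%:C%C * (u - w)^*%C) (- lam%:C%C * (u - w)).
  apply: wirtinger_eq (wirtinger_add (wirtinger_cst 1 u) (wirtinger_scale (- lam%:C%C)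
    (wirtinger_mul (wirtinger_subr w u) (wirtinger_subr_conj w u)))); ring.
have ReE v : complex.Re (P v) = 1 - lam * normc (v - w) ^+ 2.
  by rewrite /P mulcconj -rmorphN -rmorphM/= mulNr.
have h4 := wirtinger_comp hP (wirtinger_pos_sqr _).
have cl v : (- lam%:C%C * v)^*%C = - lam%:C%C * v^*%C.
  by case: v => a b; apply: complexP; rewrite /=; ring.
have e2 : (2 * lam * bump lam w u)%:C%C = 2 * lam%:C%C * (bump lam w u)%:C%C :> C.
  by rewrite !rmorphM/= (rmorph_nat (real_complex R) 2).
apply: wirtinger_ext (wirtinger_eq _ _ h4).
- by move=> v; rewrite ReE.
- by rewrite ReE -/(bump lam w u) cl e2; ring.
- by rewrite ReE -/(bump lam w u) cl conjcK e2; ring.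
Qed.

Lemma contc_bump lam w u : contc (fun v => (bump lam w v)%:C%C) u.
Proof.
have h1 : contc (fun v : C => 1 - lam%:C%C * ((v - w) * (v - w)^*%C)) u.
  apply: contc_sub; first exact: contc_cst.
  apply: contc_mul; first exact: contc_cst.
  have k : contc (fun v : C => v - w) u by apply: contc_sub (contc_id _) (contc_cst _ _).
  exact: contc_mul k (contc_conj k).
have := @contc_real1 _ (fun x => Num.max 0 x) _ u _ h1.
have lip (x y : R) : `|Num.max 0 x - Num.max 0 y| <= `|x - y|.
  rewrite ler_norml; have := ler_norm (x - y); have := ler_norm (y - x); rewrite distrC.
  by have [x0|x0] := leP x 0; have [y0|y0] := leP y 0 => k1 k2; apply/andP; split; lra.
move=> /(_ lip); apply: contc_ext => v.
by rewrite /bump mulcconj -rmorphM/=.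
Qed.

(** The dbar derivative found here is the derivative of lam * bump^2 with respect to lam: a change
    of scale of the kernel is dbar-exact, with a compactly supported primitive. *)
Lemma wirtinger_conj_bump2 lam w u : exists a,
  wirtinger (fun v => (v - w)^*%C * bump2 lam w v) u a
   (bump lam w u ^+ 2 - 2 * lam * bump lam w u * normc (u - w) ^+ 2)%:C%C.
Proof.
have h2 := wirtinger_mul (wirtinger_subr_conj w u) (wirtinger_bump2 lam w u).
eexists; apply: wirtinger_eq h2; first by reflexivity.
have -> : 1 * bump2 lam w u + (u - w)^*%C * (- (2 * lam * bump lam w u)%:C%C * (u - w)) =
  bump2 lam w u - (2 * lam * bump lam w u)%:C%C * ((u - w) * (u - w)^*%C) by ring.
by rewrite mulcconj -rmorphM -rmorphB.
Qed.

(** With h = w' - w, the linear term is -2 Re(conj h * dbar bump2), so that moving the centre is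
    also exact to first order. *)
Lemma bump2_shift lam w w' u (D : R) : 0 < lam -> normc (u - w) <= D -> normc (w' - w) <= D ->
  `|bump lam w' u ^+ 2 - bump lam w u ^+ 2 -
    4 * lam * bump lam w u * complex.Re ((w' - w)^*%C * (u - w))| <=
  (9 * lam ^+ 2 * D ^+ 2 + 2 * lam) * normc (w' - w) ^+ 2.
Proof.
move=> l0 hD hD'; set h := w' - w in hD' *; set v := u - w in hD *.
have D0 : 0 <= D by exact: le_trans (normc_ge0 _) hD.
have e1 : normc (u - w') ^+ 2 = normc v ^+ 2 - 2 * complex.Re (h^*%C * v) + normc h ^+ 2.
  have -> : u - w' = v - h by rewrite /v /h; ring.
  move: v h {hD hD'} => [a b] [c d]; rewrite !sqr_normc ReM/= ; ring.
pose y := lam * (2 * complex.Re (h^*%C * v) - normc h ^+ 2).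
have e2 : 1 - lam * normc (u - w') ^+ 2 = 1 - lam * normc v ^+ 2 + y by rewrite e1 /y; ring.
rewrite /bump -/v e2; have := pos_sqr_remainder (1 - lam * normc v ^+ 2) y.
set X := 1 - lam * normc v ^+ 2; set m := Num.max 0 (X + y); set k := Num.max 0 X.
have k0 : 0 <= k by rewrite le_max lexx.
have k1 : k <= 1 by have := bump_le1 w u (ltW l0).
have hn := normc_ge0 h.
have hRe : `|complex.Re (h^*%C * v)| <= normc h * D.
  by rewrite (le_trans (normRe_le _))// normcM normc_conj ler_wpM2l.
(* 9 = 3^2, from 2 |h| D + |h|^2 <= 3 D |h|. *)
have y2 : y ^+ 2 <= 9 * lam ^+ 2 * D ^+ 2 * normc h ^+ 2.
  have yb : `|y| <= 3 * lam * D * normc h.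
    rewrite /y normrM gtr0_norm// (le_trans (ler_wpM2l (ltW l0) (ler_normB _ _)))//.
    rewrite normrM [`|2|]ger0_norm// [`|normc h ^+ 2|]ger0_norm ?exprn_ge0//.
    have -> : 3 * lam * D * normc h = lam * (2 * (normc h * D) + normc h * D) by ring.
    rewrite ler_wpM2l ?(ltW l0)//; apply: lerD; first by rewrite ler_pM2l.
    by rewrite expr2 ler_wpM2l.
  rewrite -real_normK ?num_real//.
  have -> : 9 * lam ^+ 2 * D ^+ 2 * normc h ^+ 2 = (3 * lam * D * normc h) ^+ 2 by ring.
  by rewrite lerXn2r ?nnegrE ?mulr_ge0// ltW.
move=> hr; have -> : m ^+ 2 - k ^+ 2 - 4 * lam * k * complex.Re (h^*%C * v) =
  (m ^+ 2 - k ^+ 2 - 2 * k * y) - 2 * k * lam * normc h ^+ 2 by rewrite /y; ring.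
rewrite (le_trans (ler_normB _ _))// [leRHS]mulrDl; apply: lerD; first exact: le_trans hr y2.
rewrite ger0_norm ?mulr_ge0 ?exprn_ge0 ?(ltW l0)//.
rewrite ler_wpM2r ?exprn_ge0// -mulrA ler_pM2l// ler_piMl// ltW//.
Qed.

(** The linear term is (lam' - lam) times the dbar derivative of [wirtinger_conj_bump2]. *)
Lemma bump2_scale lam lam' w u (D : R) : 0 <= lam -> 0 <= lam' -> normc (u - w) <= D ->
  `|lam' * bump lam' w u ^+ 2 - lam * bump lam w u ^+ 2 -
    (lam' - lam) * (bump lam w u ^+ 2 - 2 * lam * bump lam w u * normc (u - w) ^+ 2)| <=
  (2 * D ^+ 2 + lam' * D ^+ 4) * (lam' - lam) ^+ 2.
Proof.
move=> l0 l0' hD; set v := normc (u - w) in hD *.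
have v0 : 0 <= v by exact: normc_ge0.
have v2 : v ^+ 2 <= D ^+ 2 by rewrite lerXn2r ?nnegrE// (le_trans v0).
have v4 : v ^+ 4 <= D ^+ 4 by rewrite lerXn2r ?nnegrE// (le_trans v0).
pose dl := lam' - lam; pose y := - dl * v ^+ 2; rewrite -/dl.
have e2 : 1 - lam' * v ^+ 2 = 1 - lam * v ^+ 2 + y by rewrite /y /dl; ring.
rewrite /bump -/v e2; have := pos_sqr_remainder (1 - lam * v ^+ 2) y.
have k1 := bump_le1 w u l0.
rewrite /bump -/v in k1; set k := Num.max 0 (1 - lam * v ^+ 2) in k1 *.
set m := Num.max 0 _; have k0 : 0 <= k by rewrite le_max lexx.
move=> hr.
have -> : lam' * m ^+ 2 - lam * k ^+ 2 - dl * (k ^+ 2 - 2 * lam * k * v ^+ 2) =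
   lam' * (m ^+ 2 - k ^+ 2 - 2 * k * y) - 2 * k * v ^+ 2 * dl ^+ 2.
  by rewrite /y /dl; ring.
rewrite (le_trans (ler_normB _ _))// [leRHS]mulrDl [leRHS]addrC; apply: lerD.
  rewrite normrM ger0_norm// -[leRHS]mulrA ler_wpM2l// (le_trans hr)//.
  have -> : y ^+ 2 = v ^+ 4 * dl ^+ 2 by rewrite /y; ring.
  by rewrite ler_wpM2r// sqr_ge0.
have nn : 0 <= 2 * k * v ^+ 2 * dl ^+ 2 by rewrite mulr_ge0 ?sqr_ge0// mulr_ge0 ?sqr_ge0// mulr_ge0.
rewrite ger0_norm// ler_wpM2r ?sqr_ge0//.
by rewrite -mulrA ler_pM2l// (le_trans _ v2)// ler_piMl// exprn_ge0.
Qed.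

(** Over n equal steps the quadratic terms add up to A / n. So A, into which the energy will enter,
    disappears from the conclusion. *)
Lemma quadratic_path (phi : R -> R) (A E : R) :
  (forall x y, 0 <= x <= 1 -> 0 <= y <= 1 ->
    `|phi y - phi x| <= A * (y - x) ^+ 2 + E * `|y - x|) ->
  `|phi 1 - phi 0| <= E.
Proof.
move=> h; apply/ler_addgt0Pr => e e0.
pose n := (Num.bound (`|A| / e)).+1.
have n0 : 0 < n%:R :> R by rewrite ltr0n.
have An : A / n%:R <= e.
  rewrite ler_pdivrMr// mulrC -ler_pdivrMr// (@le_trans _ _ (`|A| / e))//.
    by rewrite ler_pM2r ?invr_gt0// ler_norm.
  have k0 : 0 <= `|A| / e by rewrite divr_ge0// ltW.
  rewrite (le_trans (ltW (archi_boundP k0)))// ler_nat.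
  by rewrite /n leqnSn.
have main k : (k <= n)%N -> `|phi (k%:R / n%:R) - phi 0| <= k%:R * (A / n%:R ^+ 2 + E / n%:R).
  elim: k => [|k IH] kn; first by rewrite !mul0r subrr normr0.
  have -> : phi (k.+1%:R / n%:R) - phi 0 =
    (phi (k.+1%:R / n%:R) - phi (k%:R / n%:R)) + (phi (k%:R / n%:R) - phi 0) by ring.
  rewrite (le_trans (ler_normD _ _))// -[k.+1%:R]natr1 [leRHS]mulrDl mul1r [leRHS]addrC.
  apply: lerD; last by apply: IH; exact: ltnW.
  have in01 j : (j <= n)%N -> 0 <= (j%:R / n%:R : R) <= 1.
    by move=> jn; rewrite divr_ge0 ?ler_pdivrMr ?mul1r ?ler_nat// ler0n.
  rewrite (le_trans (h _ _ (in01 _ (ltnW kn)) _))//.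
    by have := in01 _ kn; rewrite -natr1.
  have -> : (k%:R + 1) / n%:R - k%:R / n%:R = n%:R^-1 :> R by rewrite mulrDl mul1r addrC addKr.
  by rewrite gtr0_norm ?invr_gt0// exprVn.
have := main n (leqnn _); rewrite divff ?gt_eqF//.
have -> : n%:R * (A / n%:R ^+ 2 + E / n%:R) = A / n%:R + E.
  by field; rewrite gt_eqF.
by move=> /le_trans; apply; rewrite addrC lerD2l.
Qed.

End PositivePartSquare.

(** * The valence integral in the half-plane *)

Section Strip.
Variable R : realType.
Local Notation C := R[i].
Variables (f : Cplx R -> Cplx R) (f1 f2 : C -> C) (Bf : R).
Hypothesis fw : forall z : C, normc z < 1 -> wirtinger (f : C -> C) z (f1 z) 0.
Hypothesis f1w : forall z : C, normc z < 1 -> wirtinger f1 z (f2 z) 0.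
Hypothesis fB : forall z : C, normc z < 1 -> normc (f z) <= Bf.

(* f and f1 = f' in the coordinate log z on the half-plane Re z < 0. The area of
   an image is a conformal invariant, so energy is the Jacobian of stripF. *)
Definition stripF (z : C) : C := f (cexp z).
Definition stripD (z : C) : C := f1 (cexp z) * cexp z.
Definition energy (z : C) : R := normc (stripD z) ^+ 2.

Local Notation rints T s g := (rdint T s 0 (2 * pi) g).

Lemma normc_cexp_lt1 (z : C) : complex.Re z < 0 -> normc (cexp z) < 1.
Proof. by rewrite normc_cexp expR_lt1. Qed.

Lemma stripF_le (z : C) : complex.Re z < 0 -> normc (stripF z) <= Bf.
Proof. by move=> /normc_cexp_lt1; exact: fB. Qed.

Lemma wirtinger_stripF (z : C) : complex.Re z < 0 -> wirtinger stripF z (stripD z) 0.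
Proof.
move=> /normc_cexp_lt1 z1; rewrite -(mulr0 (f1 (cexp z))).
exact: wirtinger_holo_comp (wirtinger_cexp z) (fw z1).
Qed.

Lemma wirtinger_stripD (z : C) : complex.Re z < 0 -> exists a, wirtinger stripD z a 0.
Proof.
move=> /normc_cexp_lt1 z1.
have h1 := wirtinger_holo_comp (wirtinger_cexp z) (f1w z1).
eexists; apply: wirtinger_eq (wirtinger_mul h1 (wirtinger_cexp z)); first by reflexivity.
by ring.
Qed.

Lemma contc_stripF (z : C) : complex.Re z < 0 -> contc stripF z.
Proof. by move=> /wirtinger_stripF; exact: wirtinger_cont. Qed.

Lemma contc_stripD (z : C) : complex.Re z < 0 -> contc stripD z.
Proof. by move=> /wirtinger_stripD[a]; exact: wirtinger_cont. Qed.

Lemma rect_Re_lt0 T s (z : C) : s < 0 -> rect T s 0 (2 * pi) z -> complex.Re z < 0.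
Proof. by move=> s0 [/andP[_ h] _]; exact: le_lt_trans s0. Qed.

Lemma cont_energy T s : s < 0 -> cont_rectR T s 0 (2 * pi) energy.
Proof.
move=> s0 z /(rect_Re_lt0 s0) z0; have h := contc_normc (contc_stripD z0).
apply: contc_ext (contc_mul h h) => w.
by rewrite -rmorphM.
Qed.

Lemma cont_comp_strip (g : C -> C) T s : s < 0 -> (forall u, contc g u) ->
  cont_rect T s 0 (2 * pi) (fun z => g (stripF z)).
Proof.
by move=> s0 gc z /(rect_Re_lt0 s0) z0; apply: contc_comp (contc_stripF z0) (gc _).
Qed.

Lemma stripD_decay : exists2 K : R, 0 <= K &
  forall z : C, complex.Re z <= -1 -> normc (stripD z) <= K * expR (complex.Re z).
Proof.
have e1 : expR (-1) < 1 :> R by rewrite expR_lt1 oppr_lt0 ltr01.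
have [B B0 hB] := bounded_inside (f := f1 : Cplx R -> Cplx R) f1w (expR_ge0 (-1)) e1.
exists B => // z hz; rewrite normcM normc_cexp ler_wpM2r ?expR_ge0//.
by apply: hB; rewrite normc_cexp ler_expR.
Qed.

(* On the left boundary Re z = T the derivative of stripF decays like expR T, so
   the integral of dbar Psi over the image is negligible when Psi vanishes on
   the values taken on Re z = s. *)
Lemma flux_push (K : R) (Psi B : C -> C) (P T s : R) :
  (forall z : C, complex.Re z <= -1 -> normc (stripD z) <= K * expR (complex.Re z)) ->
  0 <= P ->
  (forall u, exists a, wirtinger Psi u a (B u)) -> (forall u, contc B u) ->
  T <= -1 -> T < s -> s < 0 ->
  (forall y, Psi (stripF (mkc s y)) = 0) ->
  (forall y, normc (Psi (stripF (mkc T y))) <= P) ->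
  normc (dint T s 0 (2 * pi) (fun z => B (stripF z) * (energy z)%:C%C)) <=
    2 * pi * (P * (K * expR T)).
Proof.
move=> hK P0 /choice[A hA] Bc T1 Ts s0 hs hT.
have re0 (z : C) : T <= complex.Re z <= s -> complex.Re z < 0.
  by move=> /andP[_ h]; exact: le_lt_trans s0.
pose psi z := Psi (stripF z) * stripD z.
have /choice[al hal] : forall z, exists a, T <= complex.Re z <= s ->
    wirtinger psi z a (B (stripF z) * (energy z)%:C%C).
  move=> z; case: (boolP (T <= complex.Re z <= s)) => [hz|_]; last by exists 0.
  have z0 := re0 z hz; have [a ha] := wirtinger_stripD z0.
  have h := wirtinger_mul (wirtinger_precomp_holo (wirtinger_stripF z0) (hA _)) ha.
  eexists => _; apply: wirtinger_eq h; first by reflexivity.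
  by rewrite mulr0 addr0 -mulrA [_^*%C * _]mulrC mulcconj.
have bc z : T <= complex.Re z <= s -> contc (fun z => B (stripF z) * (energy z)%:C%C) z.
  move=> hz; have z0 := re0 z hz; apply: contc_mul.
    exact: contc_comp (contc_stripF z0) (Bc _).
  have h := contc_normc (contc_stripD z0).
  by apply: contc_ext (contc_mul h h) => w; rewrite -rmorphM.
have per x : T <= x <= s -> psi (mkc x 0) = psi (mkc x (2 * pi)).
  by move=> _; rewrite /psi /stripF /stripD -cexp_per.
have fl := flux Ts hal bc per.
have c0 : circ psi s = 0.
  rewrite (@circ_ext _ _ (fun=> 0)); last by move=> y; rewrite /psi hs mul0r.
  by rewrite circ_cst mulr0.
rewrite c0 sub0r in fl.
have : normc (circ psi T) <= 2 * (2 * pi) * (P * (K * expR T)).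
  apply: circ_le => y _.
    apply: wirtinger_cont (hal _ _); rewrite /= lexx ltW//.
  rewrite /psi normcM; apply: ler_pM; rewrite ?normc_ge0//.
  exact: hK.
by rewrite -normcN fl normcM (normc_nat R 2) -(mulrA 2) ler_pM2l.
Qed.

Lemma distr3_le (x1 x2 x3 x4 : R) : x1 <= x2 + x3 + x4 -> x2 + x3 <= x1 + x4 ->
  `|x1 - x2 - x3| <= x4.
Proof. by rewrite ler_norml; lra. Qed.

Lemma rdint_abs3 (g1 g2 g3 g4 : C -> R) T s : T <= s -> s < 0 ->
  cont_rectR T s 0 (2 * pi) g1 -> cont_rectR T s 0 (2 * pi) g2 ->
  cont_rectR T s 0 (2 * pi) g3 -> cont_rectR T s 0 (2 * pi) g4 ->
  (forall z, rect T s 0 (2 * pi) z -> `|g1 z - g2 z - g3 z| <= g4 z) ->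
  `|rints T s g1 - rints T s g2 - rints T s g3| <= rints T s g4.
Proof.
move=> Ts s0 c1 c2 c3 c4 h; have p0 := ltW (pi2_gt0 R).
have c23 := cont_rectR_add c2 c3.
have k1 : rints T s g1 <= rints T s (fun z => g2 z + g3 z + g4 z).
  apply: rdint_le => //; first exact: cont_rectR_add.
  move=> z /h; move: (g1 z) (g2 z) (g3 z) (g4 z) => x1 x2 x3 x4.
  by rewrite ler_norml => /andP[_]; lra.
have k2 : rints T s (fun z => g2 z + g3 z) <= rints T s (fun z => g1 z + g4 z).
  apply: rdint_le => //; first exact: cont_rectR_add.
  move=> z /h; move: (g1 z) (g2 z) (g3 z) (g4 z) => x1 x2 x3 x4.
  by rewrite ler_norml => /andP[]; lra.
rewrite (rdintD Ts p0 c23 c4) (rdintD Ts p0 c2 c3) in k1.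
rewrite (rdintD Ts p0 c2 c3) (rdintD Ts p0 c1 c4) in k2.
exact: distr3_le k1 k2.
Qed.

(* The integral, over the image counted with multiplicity, of a kernel of
   radius lam^(-1/2) around w whose mass pi / 3 does not depend on lam: a
   smoothed number of preimages of w. *)
Definition valence_int T s lam w : R :=
  rints T s (fun z => lam * bump lam w (stripF z) ^+ 2 * energy z).

Lemma cont_bump_strip lam w T s : s < 0 ->
  cont_rectR T s 0 (2 * pi) (fun z => bump lam w (stripF z)).
Proof.
by move=> s0; apply: (@cont_comp_strip (fun u => (bump lam w u)%:C%C)) => // u; exact: contc_bump.
Qed.

Lemma cont_valence lam w T s : s < 0 ->
  cont_rectR T s 0 (2 * pi) (fun z => lam * bump lam w (stripF z) ^+ 2 * energy z).
Proof.
move=> s0; apply: cont_rectR_mul; last exact: cont_energy.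
have h := cont_bump_strip lam w (T := T) s0.
by apply: cont_rectR_mul; [exact: cont_rectR_cst|exact: (cont_rectR_mul h h)].
Qed.

Lemma contc_bump_sub (lam : R) (w u : C) : contc (fun v => - (2 * lam * bump lam w v)%:C%C * (v - w)) u.
Proof.
apply: contc_mul; last by apply: contc_sub (contc_id _) (contc_cst _ _).
apply: contc_opp; have h := contc_mul (contc_cst (2 * lam)%:C%C u) (contc_bump lam w u).
by apply: contc_ext h => v; rewrite -rmorphM.
Qed.

Lemma contc_bump_rad (lam : R) (w u : C) :
  contc (fun v => (bump lam w v ^+ 2 - 2 * lam * bump lam w v * normc (v - w) ^+ 2)%:C%C) u.
Proof.
have h1 := contc_bump lam w u.
have h2 : contc (fun v : C => (normc (v - w))%:C%C) u.
  by apply: contc_normc; apply: contc_sub (contc_id _) (contc_cst _ _).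
have h3 := contc_sub (contc_mul h1 h1)
  (contc_mul (contc_mul (contc_cst (2 * lam)%:C%C u) h1) (contc_mul h2 h2)).
by apply: contc_ext h3 => v; rewrite -!rmorphM -rmorphB.
Qed.

Lemma cont_Re_strip (g : C -> C) T s : s < 0 -> (forall u, contc g u) ->
  cont_rectR T s 0 (2 * pi) (fun z => complex.Re (g (stripF z) * (energy z)%:C%C)).
Proof.
move=> s0 gc z hz; apply: (@contc_real1 _ id) => //.
by apply: contc_mul; [exact: (cont_comp_strip s0 gc hz)|exact: (cont_energy s0 hz)].
Qed.

Section Moves.
Variables (K T s : R).
Hypothesis hK : forall z : C, complex.Re z <= -1 -> normc (stripD z) <= K * expR (complex.Re z).
Hypotheses (T1 : T <= -1) (Ts : T < s) (s0 : s < 0).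

Local Notation A := (rints T s energy).

(** The linear term of [bump2_shift] integrates to a quantity that [flux_push] bounds by a multiple
    of e^T, since the bump vanishes on the values taken on Re z = s; the remainder costs the energy
    A. *)
Lemma valence_shift (lam W : R) (w w' : C) : 0 < lam -> 0 < Bf -> normc w <= W -> normc w' <= W ->
  (forall y, bump lam w (stripF (mkc s y)) = 0) ->
  `|valence_int T s lam w' - valence_int T s lam w| <=
  lam * (9 * lam ^+ 2 * (Bf + 2 * W) ^+ 2 + 2 * lam) * A * normc (w' - w) ^+ 2 +
  2 * lam * (2 * pi * (K * expR T)) * normc (w' - w).
Proof.
move=> l0 Bf0 hw hw' hs; pose h := w' - w; pose D := Bf + 2 * W.
have p0 := ltW (pi2_gt0 R).
pose B u : C := - (2 * lam * bump lam w u)%:C%C * (u - w).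
have Bc u : contc B u by exact: contc_bump_sub.
pose g3 z := - (2 * lam) * complex.Re (h^*%C * (B (stripF z)) * (energy z)%:C%C).
have hBc u : contc (fun u => h^*%C * B u) u by apply: contc_mul (contc_cst _ _) (Bc u).
have c3 : cont_rectR T s 0 (2 * pi) g3.
  by apply: cont_rectR_mul; [exact: cont_rectR_cst|exact: (cont_Re_strip s0 hBc)].
pose c := lam * (9 * lam ^+ 2 * D ^+ 2 + 2 * lam) * normc h ^+ 2.
have := @rdint_abs3 (fun z => lam * bump lam w' (stripF z) ^+ 2 * energy z)
   (fun z => lam * bump lam w (stripF z) ^+ 2 * energy z) g3 (fun z => c * energy z) T s
   (ltW Ts) s0 (cont_valence _ _ s0) (cont_valence _ _ s0) c3
   (cont_rectR_mul (cont_rectR_cst _) (cont_energy s0)).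
move=> main; have {}main : `|valence_int T s lam w' - valence_int T s lam w - rints T s g3| <= c * A.
  rewrite -rdintZ//; [|exact: ltW|exact: cont_energy].
  apply: main => z hz; have z0 := rect_Re_lt0 s0 hz; have Fz := stripF_le z0.
  have d1 : normc (stripF z - w) <= D.
    rewrite (le_trans (normcB _ _))// /D; have := normc_ge0 w; lra.
  have d2 : normc (w' - w) <= D by rewrite (le_trans (normcB _ _))// /D; lra.
  have := bump2_shift l0 d1 d2; rewrite -/h => key.
  have E0 : 0 <= energy z by rewrite exprn_ge0// normc_ge0.
  have -> : lam * bump lam w' (stripF z) ^+ 2 * energy z -
    lam * bump lam w (stripF z) ^+ 2 * energy z - g3 z =
    lam * energy z * (bump lam w' (stripF z) ^+ 2 - bump lam w (stripF z) ^+ 2 -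
     4 * lam * bump lam w (stripF z) * complex.Re (h^*%C * (stripF z - w))).
    by rewrite /g3 /B !ReM !ImM ?ReN ?ImN/=; ring.
  have lE : 0 <= lam * energy z by rewrite mulr_ge0// ltW.
  rewrite normrM (ger0_norm lE).
  have -> : c * energy z = lam * energy z *
     ((9 * lam ^+ 2 * D ^+ 2 + 2 * lam) * normc h ^+ 2) by rewrite /c; ring.
  exact: ler_wpM2l lE _ _ key.
have e3 : `|rints T s g3| <= 2 * lam * (2 * pi * (K * expR T)) * normc h.
  have cRe : cont_rectR T s 0 (2 * pi)
      (fun z => complex.Re (h^*%C * (B (stripF z)) * (energy z)%:C%C)).
    exact: (cont_Re_strip s0 hBc).
  rewrite rdintZ ?(ltW Ts)//.
  have -> : rints T s (fun z => complex.Re (h^*%C * (B (stripF z)) * (energy z)%:C%C)) =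
     complex.Re (h^*%C * dint T s 0 (2 * pi) (fun z => B (stripF z) * (energy z)%:C%C)).
    have hc : cont_rect T s 0 (2 * pi) (fun z => B (stripF z) * (energy z)%:C%C).
      move=> v hv; apply: contc_mul; [exact: (cont_comp_strip s0 Bc hv)|exact: (cont_energy s0 hv)].
    rewrite -(dintZ h^*%C (ltW Ts) p0 hc).
    by apply: rint_ext => x _; apply: rint_ext => y _; rewrite mulrA.
  have l20 : 0 < 2 * lam by rewrite mulr_gt0.
  rewrite normrM normrN (gtr0_norm l20).
  rewrite -(mulrA (2 * lam)) ler_pM2l//.
  rewrite (le_trans (normRe_le _))// normcM normc_conj mulrC ler_wpM2r ?normc_ge0//.
  have := @flux_push K (bump2 lam w) B 1 T s hK ler01.
  rewrite mul1r; apply => //.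
  - by move=> u; eexists; exact: wirtinger_bump2.
  - by move=> y; rewrite /bump2 hs expr0n.
  - move=> y; rewrite /bump2 normc_real ger0_norm ?exprn_ge0 ?bump_ge0//.
    by rewrite exprn_ile1 ?bump_ge0 ?bump_le1// ltW.
have := ler_normD (valence_int T s lam w' - valence_int T s lam w - rints T s g3) (rints T s g3).
rewrite subrK => /le_trans; apply; apply: lerD => //.
by apply: le_trans main _; rewrite /c /D -/h -mulrA [normc h ^+ 2 * _]mulrC mulrA.
Qed.

(** Here the primitive is conj(u - w) * bump2, of modulus at most Bf + |w| on Re z = T. The bound L
    makes the quadratic coefficient uniform along a path of scales. *)
Lemma valence_scale (lam lam' L : R) (w : C) : 0 < lam -> lam <= L -> 0 < lam' -> lam' <= L ->
  0 < Bf -> (forall y, bump lam w (stripF (mkc s y)) = 0) ->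
  `|valence_int T s lam' w - valence_int T s lam w| <=
  (2 * (Bf + normc w) ^+ 2 + L * (Bf + normc w) ^+ 4) * A * (lam' - lam) ^+ 2 +
  2 * pi * ((Bf + normc w) * (K * expR T)) * `|lam' - lam|.
Proof.
move=> l0 lL l0' lL' Bf0 hs; pose D := Bf + normc w; pose dl := lam' - lam.
have p0 := ltW (pi2_gt0 R).
have D0 : 0 <= D by rewrite addr_ge0 ?normc_ge0// ltW.
pose B u : C := (bump lam w u ^+ 2 - 2 * lam * bump lam w u * normc (u - w) ^+ 2)%:C%C.
have Bc u : contc B u by exact: contc_bump_rad.
pose g3 z := dl * complex.Re (B (stripF z) * (energy z)%:C%C).
have c3 : cont_rectR T s 0 (2 * pi) g3.
  by apply: cont_rectR_mul; [exact: cont_rectR_cst|exact: (cont_Re_strip s0 Bc)].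
pose c := (2 * D ^+ 2 + L * D ^+ 4) * dl ^+ 2.
have := @rdint_abs3 (fun z => lam' * bump lam' w (stripF z) ^+ 2 * energy z)
   (fun z => lam * bump lam w (stripF z) ^+ 2 * energy z) g3 (fun z => c * energy z) T s
   (ltW Ts) s0 (cont_valence _ _ s0) (cont_valence _ _ s0) c3
   (cont_rectR_mul (cont_rectR_cst _) (cont_energy s0)).
move=> main; have {}main : `|valence_int T s lam' w - valence_int T s lam w - rints T s g3| <= c * A.
  rewrite -rdintZ//; [|exact: ltW|exact: cont_energy].
  apply: main => z hz; have z0 := rect_Re_lt0 s0 hz; have Fz := stripF_le z0.
  have d1 : normc (stripF z - w) <= D.
    by rewrite (le_trans (normcB _ _))// /D lerD2r.
  have := bump2_scale (ltW l0) (ltW l0') d1; rewrite -/dl => key.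
  have E0 : 0 <= energy z by rewrite exprn_ge0// normc_ge0.
  have -> : lam' * bump lam' w (stripF z) ^+ 2 * energy z -
    lam * bump lam w (stripF z) ^+ 2 * energy z - g3 z =
    energy z * (lam' * bump lam' w (stripF z) ^+ 2 - lam * bump lam w (stripF z) ^+ 2 -
     dl * (bump lam w (stripF z) ^+ 2 - 2 * lam * bump lam w (stripF z) * normc (stripF z - w) ^+ 2)).
    by rewrite /g3 /B ReM/= mulr0 subr0; ring.
  rewrite normrM ger0_norm// [c * _]mulrC ler_wpM2l// (le_trans key)//.
  by rewrite /c ler_wpM2r ?sqr_ge0// lerD2l ler_wpM2r// exprn_ge0.
have e3 : `|rints T s g3| <= 2 * pi * (D * (K * expR T)) * `|dl|.
  have cRe : cont_rectR T s 0 (2 * pi) (fun z => complex.Re (B (stripF z) * (energy z)%:C%C)).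
    exact: (cont_Re_strip s0 Bc).
  rewrite rdintZ ?(ltW Ts)//.
  have -> : rints T s (fun z => complex.Re (B (stripF z) * (energy z)%:C%C)) =
     complex.Re (dint T s 0 (2 * pi) (fun z => B (stripF z) * (energy z)%:C%C)) by [].
  rewrite normrM mulrC ler_wpM2r// (le_trans (normRe_le _))//.
  apply: (@flux_push K (fun u => (u - w)^*%C * bump2 lam w u) B D T s hK) => //.
  - by move=> u; exact: wirtinger_conj_bump2.
  - by move=> y; rewrite /bump2 hs expr0n mulr0.
  - move=> y; rewrite normcM normc_conj /bump2 normc_real ger0_norm ?exprn_ge0 ?bump_ge0//.
    rewrite (le_trans (ler_piMr (normc_ge0 _) _))//.
      by rewrite exprn_ile1 ?bump_ge0 ?bump_le1// ltW.
    rewrite (le_trans (normcB _ _))// /D lerD2r; apply: stripF_le => /=.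
    exact: lt_trans Ts s0.
have := ler_normD (valence_int T s lam' w - valence_int T s lam w - rints T s g3) (rints T s g3).
rewrite subrK => /le_trans; apply; apply: lerD => //.
by apply: le_trans main _; rewrite /c -/D -/dl -mulrA [dl ^+ 2 * _]mulrC mulrA.
Qed.

(** [valence_shift] is applied along the segment from w0 to w1, and [quadratic_path] removes its
    energy term. *)
Lemma valence_move_shift (lam : R) (w0 w1 : C) : 0 < lam -> 0 < Bf ->
  (forall t y, 0 <= t <= 1 -> bump lam (w0 + t%:C%C * (w1 - w0)) (stripF (mkc s y)) = 0) ->
  `|valence_int T s lam w1 - valence_int T s lam w0| <=
  2 * lam * (2 * pi * (K * expR T)) * normc (w1 - w0).
Proof.
move=> l0 Bf0 hs; pose w t := w0 + t%:C%C * (w1 - w0).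
pose W := normc w0 + normc (w1 - w0).
have hW t : 0 <= t <= 1 -> normc (w t) <= W.
  move=> /andP[t0 t1]; rewrite (le_trans (normcD _ _))// /W lerD2l normcM normc_real ger0_norm//.
  by rewrite ler_piMl// normc_ge0.
pose q := lam * (9 * lam ^+ 2 * (Bf + 2 * W) ^+ 2 + 2 * lam) * A.
have := @quadratic_path R (fun t => valence_int T s lam (w t)) (q * normc (w1 - w0) ^+ 2)
  (2 * lam * (2 * pi * (K * expR T)) * normc (w1 - w0)).
have -> : w 1 = w1 by rewrite /w rmorph1 mul1r addrC subrK.
have -> : w 0 = w0 by rewrite /w rmorph0 mul0r addr0.
apply => x y hx hy.
have := @valence_shift lam W (w x) (w y) l0 Bf0 (hW _ hx) (hW _ hy) (fun y => hs x y hx).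
have -> : w y - w x = (y - x)%:C%C * (w1 - w0) by rewrite /w rmorphB/=; ring.
rewrite normcM normc_real -/q => /le_trans; apply.
rewrite le_eqVlt; apply/orP; left; apply/eqP.
rewrite exprMn (real_normK (num_real (y - x))).
by move: (pi : R) => p; ring.
Qed.

Lemma valence_move_scale (lam0 lam1 : R) (w : C) : 0 < lam0 -> lam0 <= lam1 -> 0 < Bf ->
  (forall y, bump lam0 w (stripF (mkc s y)) = 0) ->
  `|valence_int T s lam1 w - valence_int T s lam0 w| <=
  2 * pi * ((Bf + normc w) * (K * expR T)) * (lam1 - lam0).
Proof.
move=> l0 l01 Bf0 hs; pose l t := lam0 + t * (lam1 - lam0).
have hl t : 0 <= t <= 1 -> lam0 <= l t <= lam1.
  by move=> /andP[t0 t1]; rewrite /l; apply/andP; split; nra.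
(* A larger parameter means a smaller support. *)
have hb lam y : lam0 <= lam -> bump lam w (stripF (mkc s y)) = 0.
  move=> ll; apply/max_idPl.
  have /max_idPl := hs y; rewrite !subr_le0 => /le_trans; apply.
  by rewrite ler_wpM2r// exprn_ge0// normc_ge0.
pose q := (2 * (Bf + normc w) ^+ 2 + lam1 * (Bf + normc w) ^+ 4) * A.
have := @quadratic_path R (fun t => valence_int T s (l t) w) (q * (lam1 - lam0) ^+ 2)
  (2 * pi * ((Bf + normc w) * (K * expR T)) * (lam1 - lam0)).
have -> : l 1 = lam1 by rewrite /l mul1r addrC subrK.
have -> : l 0 = lam0 by rewrite /l mul0r addr0.
apply => x y /hl/andP[x1 x2] /hl/andP[y1 y2].
have := @valence_scale (l x) (l y) lam1 w (lt_le_trans l0 x1) x2 (lt_le_trans l0 y1) y2 Bf0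
  (fun y => hb _ y x1).
have -> : l y - l x = (y - x) * (lam1 - lam0) by rewrite /l; ring.
rewrite -/q normrM [`|lam1 - lam0|]ger0_norm ?subr_ge0// => /le_trans; apply.
rewrite le_eqVlt; apply/orP; left; apply/eqP.
by move: (pi : R) => p; ring.
Qed.

End Moves.

End Strip.

(** * Limit and local constancy of the valence *)

Section ValenceBound.
Variable R : realType.
Local Notation C := R[i].
Variables (f : Cplx R -> Cplx R) (f1 f2 : C -> C) (Bf : R).
Hypothesis fw : forall z : C, normc z < 1 -> wirtinger (f : C -> C) z (f1 z) 0.
Hypothesis f1w : forall z : C, normc z < 1 -> wirtinger f1 z (f2 z) 0.
Hypothesis fB : forall z : C, normc z < 1 -> normc (f z) <= Bf.
Hypothesis Bf0 : 0 < Bf.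

Local Notation F := (stripF f).
Local Notation E := (energy f1).
Local Notation Cl := (cluster_set f).
Local Notation V T s lam w := (valence_int f f1 T s lam w).
Local Notation rints T s g := (rdint T s 0 (2 * pi) g).

Lemma strip_avoids (S : set C) (a b c d : R) : a <= b -> c <= d ->
  (forall w, S w -> rect a b c d w) ->
  (forall p, rect a b c d p -> ~ Cl p \/
     exists2 e : R, 0 < e & forall w, normc (w - p) < e -> ~ S w) ->
  exists2 s0 : R, -1 < s0 < 0 & forall z : C, s0 <= complex.Re z < 0 -> ~ S (F z).
Proof.
move=> ab cd Sr h; have [r /andP[r0 r1] hr] := eventually_avoids ab cd h.
have m0 : 0 < (1 + r) / 2 by rewrite divr_gt0// ltr_pwDl.
(* The first entry forces |e^z| > r, the second keeps the abscissa above -1. *)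
exists (Num.max (ln ((1 + r) / 2)) (- 2^-1)).
  rewrite lt_max gt_max ln_lt0 ?m0/=; last by lra.
  by apply/andP; split; [apply/orP; right|]; lra.
move=> z /andP[]; rewrite ge_max => /andP[z1 _] z0 hS.
apply: (hr (cexp z)) => //; [exact: normc_cexp_lt1| |exact: Sr].
rewrite normc_cexp; have : expR (ln ((1 + r) / 2)) <= expR (complex.Re z) by rewrite ler_expR.
by rewrite lnK//; apply: lt_le_trans; lra.
Qed.

Definition admissible (w : C) (rho : R) :=
  0 < rho /\ forall u, normc (u - w) <= rho -> ~ Cl u.

Lemma strip_avoids_disc w rho : admissible w rho ->
  exists2 s0 : R, -1 < s0 < 0 & forall z : C, s0 <= complex.Re z < 0 -> rho < normc (F z - w).
Proof.
move=> [r0 hr]; pose S : set C := [set u | normc (u - w) <= rho].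
have xx : complex.Re w - rho <= complex.Re w + rho by lra.
have yy : complex.Im w - rho <= complex.Im w + rho by lra.
have [||s0 hs h] := @strip_avoids S _ _ _ _ xx yy.
- move=> u hu; have h1 := le_trans (normRe_le (u - w)) hu.
  have h2 := le_trans (normIm_le (u - w)) hu.
  by move: h1 h2; rewrite ReD ImD ReN ImN !ler_norml => /andP[? ?] /andP[? ?];
    split; apply/andP; split; lra.
- move=> p _; have [hp|hp] := leP (normc (p - w)) rho; first by left; exact: hr.
  right; exists (normc (p - w) - rho); first by rewrite subr_gt0.
  move=> u hu; rewrite /S /= => hu'; have := normcD (p - u) (u - w).
  by rewrite addrA subrK normcBC; lra.
- by exists s0 => // z /h; rewrite /S /= => /negP; rewrite -ltNge.
Qed.

(** The parameter for which [bump] has support of radius rho. *)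
Definition lamr (rho : R) := (rho ^+ 2)^-1.

Lemma lamr_gt0 rho : 0 < rho -> 0 < lamr rho.
Proof. by move=> r0; rewrite invr_gt0 exprn_gt0. Qed.

Lemma bump_outside rho w u : 0 < rho -> rho <= normc (u - w) -> bump (lamr rho) w u = 0.
Proof.
move=> r0 h; apply: bump_eq0; rewrite /lamr mulrC ler_pdivlMr ?exprn_gt0// mul1r.
by rewrite lerXn2r ?nnegrE ?normc_ge0// ltW.
Qed.

Lemma energy_ge0 z : 0 <= E z.
Proof. by rewrite exprn_ge0// normc_ge0. Qed.

Lemma valence_integrand_ge0 lam w z : 0 <= lam -> 0 <= lam * bump lam w (F z) ^+ 2 * E z.
Proof.
by move=> l0; rewrite mulr_ge0 ?energy_ge0// mulr_ge0// exprn_ge0// bump_ge0.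
Qed.

Lemma rints_mono (g : C -> R) T' T s s' : T' <= T -> T <= s -> s <= s' -> s' < 0 ->
  cont_rectR T' s' 0 (2 * pi) g -> (forall z, 0 <= g z) -> rints T s g <= rints T' s' g.
Proof.
move=> h1 h2 h3 h4 gc g0; have p0 := ltW (pi2_gt0 R).
have Ts' := le_trans h2 h3.
rewrite (rdint_catx h1 Ts' p0 gc).
have gc' : cont_rectR T s' 0 (2 * pi) g by apply: cont_rect_sub gc.
rewrite (rdint_catx h2 h3 p0 gc').
rewrite -[leLHS]add0r; apply: lerD; first by apply: rdint_ge0 => z _.
by rewrite lerDl; apply: rdint_ge0 => z _.
Qed.

Lemma valence_mono lam w T' T s s' : 0 <= lam -> T' <= T -> T <= s -> s <= s' -> s' < 0 ->
  V T s lam w <= V T' s' lam w.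
Proof.
move=> l0 h1 h2 h3 h4; apply: rints_mono => //; first exact: (cont_valence fw f1w).
by move=> z; exact: valence_integrand_ge0.
Qed.

Lemma valence_stable rho w s0 T s : 0 < rho ->
  (forall z : C, s0 <= complex.Re z < 0 -> rho < normc (F z - w)) ->
  T <= s0 -> s0 <= s -> s < 0 -> V T s (lamr rho) w = V T s0 (lamr rho) w.
Proof.
move=> r0 h Ts ss s00; have p0 := ltW (pi2_gt0 R).
rewrite /valence_int (rdint_catx Ts ss p0); last exact: (cont_valence fw f1w).
rewrite [X in _ + X](_ : _ = 0) ?addr0//.
rewrite (@rdint_ext _ _ _ _ _ _ (fun=> 0)); first by rewrite rdint_cst// mulr0.
move=> z [/andP[z1 z2] _]; rewrite bump_outside//; last first.
  by apply/ltW/h; rewrite z1 (le_lt_trans z2).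
by rewrite expr0n mulr0 mul0r.
Qed.

(** To the left of -1 the energy is at most K^2 |e^z|^2. This majorant is its own dbar derivative,
    so [flux] evaluates its integral by two circle integrals, bounded uniformly in T. *)
Lemma energy_bounded s : -1 < s -> s < 0 -> exists2 M : R, 0 <= M &
  forall T, T <= -1 -> rints T s E <= M.
Proof.
move=> s1 s0; have [K K0 hK] := stripD_decay f1w; have p0 := ltW (pi2_gt0 R).
have m10 : -1 < 0 :> R by rewrite oppr_lt0 ltr01.
have E0 : 0 <= rints (-1) s E by apply: rdint_ge0 => z _; exact: energy_ge0.
exists (K ^+ 2 * (2 * (2 * pi)) + rints (-1) s E).
  by rewrite addr_ge0// mulr_ge0 ?sqr_ge0// mulr_ge0.
move=> T T1; rewrite (rdint_catx T1 (ltW s1) p0 (cont_energy f1w s0)) lerD2r.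
pose e2 (z : C) := expR (complex.Re z) ^+ 2.
have e2E z : cexp z * (cexp z)^*%C = (e2 z)%:C%C :> C by rewrite mulcconj normc_cexp.
have e2c z : contc (fun z => cexp z * (cexp z)^*%C : C) z.
  exact: contc_mul (contc_cexp _) (contc_conj (contc_cexp _)).
have e2r : cont_rectR T (-1) 0 (2 * pi) e2.
  by move=> z _; apply: contc_ext (e2c z) => w; rewrite e2E.
apply: (@le_trans _ _ (rints T (-1) (fun z => K ^+ 2 * e2 z))).
  apply: rdint_le => //; first exact: (cont_energy f1w m10).
    by apply: cont_rectR_mul => //; exact: cont_rectR_cst.
  move=> z [/andP[_ z1] _]; have := hK z z1 => h.
  by rewrite /energy /e2 -exprMn lerXn2r// ?nnegrE ?normc_ge0// mulr_ge0// expR_ge0.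
rewrite (rdintZ _ T1 p0 e2r) ler_wpM2l ?sqr_ge0//.
(* [flux] asks for a strip of positive width; at T = -1 the integral is over a point and
   vanishes. *)
move: T1; rewrite le_eqVlt => /predU1P[->|T1].
  by rewrite /rdint [rint (-1) _ _]/rint set_itv1 Rintegral_set1 mulr_ge0.
pose al (z : C) := cexp z * (cexp z)^*%C + cexp z * 0^*%C.
have w1 z : wirtinger (fun z => cexp z * (cexp z)^*%C : C) z (al z) (cexp z * (cexp z)^*%C).
  apply: wirtinger_eq (wirtinger_mul (wirtinger_cexp z) (wirtinger_conj (wirtinger_cexp z))) => //.
  by rewrite mul0r add0r.
have := flux T1 (fun z _ => w1 z) (fun z _ => e2c z).
move=> /(_ (fun x _ => congr1 (fun u => u * u^*%C) (cexp_per x))) fl.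
have cb t : t <= 0 -> normc (circ (fun z => cexp z * (cexp z)^*%C : C) t) <= 2 * (2 * pi) * 1.
  move=> t0; apply: circ_le => // y _.
  rewrite e2E normc_real /e2/= ger0_norm ?exprn_ge0 ?expR_ge0//.
  by rewrite exprn_ile1 ?expR_ge0// expR_le1.
have -> : rints T (-1) e2 = complex.Re (dint T (-1) 0 (2 * pi) (fun z => cexp z * (cexp z)^*%C)).
  by apply: rint_ext => x _; apply: rint_ext => y _; rewrite e2E.
rewrite (le_trans (ler_norm _))// (le_trans (normRe_le _))//.
have n2 : normc (2 : C) = 2 by exact: normc_nat.
rewrite -(ler_pM2l (ltr0Sn R 1)) -{1}n2 -normcM -fl (le_trans (normcB _ _))//.
rewrite mulr2n mulrDl mul1r -[2 * (2 * pi)]mulr1.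
by apply: lerD; apply: cb => //; exact: ltW (lt_trans T1 m10).
Qed.

(* g T s --> kap as T tends to -oo and s to 0 from the left *)
Definition lim_strip (g : R -> R -> R) (kap : R) := forall e : R, 0 < e ->
  exists T0 s0, [/\ T0 <= -1, -1 < s0 < 0 &
    forall T s, T <= T0 -> s0 <= s -> s < 0 -> `|g T s - kap| <= e].

Lemma lim_strip_uniq g k k' : lim_strip g k -> lim_strip g k' -> k = k'.
Proof.
move=> h h'; apply/eqP; rewrite -subr_eq0 -normr_eq0 eq_le normr_ge0 andbT.
apply/ler_addgt0Pr => e e0; rewrite add0r; have e2 : 0 < e / 2 by rewrite divr_gt0.
have [T [s [T1 /andP[s1 s0] k1]]] := h _ e2.
have [T' [s' [T1' /andP[s1' s0'] k2]]] := h' _ e2.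
have := k1 (Num.min T T') (Num.max s s'); rewrite ge_min lexx le_max lexx gt_max s0 s0'.
move=> /(_ isT isT isT) {}k1.
have := k2 (Num.min T T') (Num.max s s'); rewrite ge_min lexx orbT le_max lexx orbT gt_max s0 s0'.
move=> /(_ isT isT isT) {}k2.
move: k1 k2; move: (g _ _) => x k1 k2.
have -> : k - k' = (x - k') - (x - k) by ring.
by rewrite (le_trans (ler_normB _ _))//; lra.
Qed.

Lemma lim_strip_transfer g g' k (K s1 : R) : 0 <= K -> -1 < s1 < 0 ->
  (forall T s, T <= -1 -> s1 <= s -> s < 0 -> `|g' T s - g T s| <= K * expR T) ->
  lim_strip g k -> lim_strip g' k.
Proof.
move=> K0 /andP[s11 s10] hg hk e e0; have e2 : 0 < e / 2 by rewrite divr_gt0.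
have [T [s [T1 /andP[s1' s0] k1]]] := hk _ e2.
have K1 : 0 < K + 1 by rewrite ltr_pwDr.
have q0 : 0 < e / 2 / (K + 1) by rewrite divr_gt0.
exists (Num.min T (ln (e / 2 / (K + 1)))), (Num.max s s1); split.
- by rewrite ge_min T1.
- by rewrite lt_max s1' gt_max s0 s10.
move=> T' s'; rewrite le_min ge_max => /andP[TT Tl] /andP[ss ss1] s'0.
have h1 := k1 T' s' TT ss s'0.
have h2 := hg T' s' (le_trans TT T1) ss1 s'0.
have h3 : K * expR T' <= e / 2.
  have : expR T' <= e / 2 / (K + 1) by rewrite -[leRHS]lnK// ler_expR.
  rewrite ler_pdivlMr// mulrC => /(le_trans _); apply.
  by rewrite ler_wpM2r ?expR_ge0// lerDl.
move: h1 h2; move: (g' _ _) (g _ _) => x y h1 h2.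
have -> : x - k = (x - y) + (y - k) by ring.
by rewrite (le_trans (ler_normD _ _))//; lra.
Qed.

Definition valence_lim w rho kap := lim_strip (fun T s => V T s (lamr rho) w) kap.

(** Beyond s0 the integral no longer depends on s; it increases as T decreases and is bounded by
    [energy_bounded], so the limit is a supremum. *)
Lemma valence_lim_ex w rho : admissible w rho -> exists kap, valence_lim w rho kap.
Proof.
move=> adm; have [rho0 _] := adm.
have [s0 /andP[s01 s00] hs] := strip_avoids_disc adm.
have l0 := ltW (lamr_gt0 rho0); have p0 := ltW (pi2_gt0 R).
have [M M0 hM] := energy_bounded s01 s00.
pose X := [set x | exists2 T, T <= -1 & x = V T s0 (lamr rho) w].
have Ts0 T : T <= -1 -> T <= s0 by move=> h; exact: le_trans (ltW s01).
have Xb : has_ubound X.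
  exists (lamr rho * M) => _ [T T1 ->].
  apply: (@le_trans _ _ (rints T s0 (fun z => lamr rho * E z))).
    apply: rdint_le => //; [exact: Ts0|exact: (cont_valence fw f1w)| |].
      by apply: cont_rectR_mul; [exact: cont_rectR_cst|exact: (cont_energy f1w)].
    move=> z _; rewrite ler_wpM2r ?energy_ge0// ler_piMr//.
    by rewrite exprn_ile1 ?bump_ge0 ?bump_le1.
  rewrite rdintZ//; [|exact: Ts0|exact: (cont_energy f1w)].
  by rewrite ler_wpM2l// hM.
have Xn : X !=set0 by exists (V (-1) s0 (lamr rho) w), (-1).
have hsup : has_sup X by split.
exists (sup X) => e e0.
have [_ [T0 T01 ->] hT0] := sup_adherent e0 hsup.
exists T0, s0; split => //; first by rewrite s01.
move=> T s TT ss s0'; rewrite (valence_stable rho0 hs)//; last first.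
  by apply: Ts0; exact: le_trans T01.
have h1 : V T s0 (lamr rho) w <= sup X.
  by apply: ub_le_sup => //; exists T => //; exact: le_trans T01.
have h2 : V T0 s0 (lamr rho) w <= V T s0 (lamr rho) w.
  by apply: valence_mono => //; exact: Ts0.
by move: h1 h2 hT0; move: (V T s0 _ _) (V T0 s0 _ _) => x y h1 h2 h3;
  rewrite ler_norml; apply/andP; split; lra.
Qed.

Lemma valence_le_lim w rho kap T s : 0 < rho -> valence_lim w rho kap -> T <= s -> s < 0 ->
  V T s (lamr rho) w <= kap.
Proof.
move=> rho0 hk Ts s0; apply/ler_addgt0Pr => e e0.
have [T0 [s1 [T01 /andP[s11 s10] k1]]] := hk e e0.
have := k1 (Num.min T0 T) (Num.max s1 s); rewrite ge_min lexx le_max lexx gt_max s10 s0.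
move=> /(_ isT isT isT) k.
have : V T s (lamr rho) w <= V (Num.min T0 T) (Num.max s1 s) (lamr rho) w.
  apply: valence_mono; rewrite ?(ltW (lamr_gt0 rho0))//.
  - by rewrite ge_min lexx orbT.
  - by rewrite le_max lexx orbT.
  - by rewrite gt_max s10.
by move: k; move: (V _ _ _ _) (V _ _ _ _) => x y; rewrite ler_norml => /andP[]; lra.
Qed.

Lemma admissible_le w rho rho' : 0 < rho' -> rho' <= rho -> admissible w rho -> admissible w rho'.
Proof. by move=> h1 h2 [h3 h4]; split => // u hu; apply: h4; exact: le_trans h2. Qed.

Lemma valence_lim_scale w rho rho' kap : admissible w rho -> 0 < rho' -> rho' <= rho ->
  valence_lim w rho kap <-> valence_lim w rho' kap.
Proof.
move=> adm rho'0 rr; have [rho0 _] := adm.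
have [s0 /andP[s01 s00] hs] := strip_avoids_disc adm.
have [K K0 hK] := stripD_decay f1w; have p0 := ltW (pi2_gt0 R).
have ll : lamr rho <= lamr rho'.
  by rewrite /lamr lef_pV2 ?posrE ?exprn_gt0// lerXn2r ?nnegrE// ltW.
have D0 : 0 <= Bf + normc w by rewrite addr_ge0 ?normc_ge0// ltW.
pose c := 2 * pi * ((Bf + normc w) * K) * (lamr rho' - lamr rho).
have c0 : 0 <= c by rewrite mulr_ge0 ?subr_ge0// mulr_ge0// mulr_ge0.
have main T s : T <= -1 -> s0 <= s -> s < 0 ->
    `|V T s (lamr rho') w - V T s (lamr rho) w| <= c * expR T.
  move=> T1 ss s0'; have Ts : T < s by rewrite (le_lt_trans T1)// (lt_le_trans s01).
  have bz y : bump (lamr rho) w (F (mkc s y)) = 0.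
    by apply: bump_outside => //; apply/ltW/hs; rewrite /= ss.
  have := valence_move_scale fw f1w fB hK T1 Ts s0' (lamr_gt0 rho0) ll Bf0 bz.
  move=> /le_trans; apply; rewrite /c; move: (pi : R) => p.
  by rewrite le_eqVlt; apply/orP; left; apply/eqP; ring.
have s0I : -1 < s0 < 0 by rewrite s01.
pose g r T s := V T s (lamr r) w.
split.
  exact: (@lim_strip_transfer (g rho) (g rho') kap c s0 c0 s0I main).
apply: (@lim_strip_transfer (g rho') (g rho) kap c s0 c0 s0I) => T s T1 ss s0'.
by rewrite distrC; exact: main.
Qed.

(** Bumps of radius rho centred on the segment from w0 to w1 stay in the disc of radius 2 rho, which
    F leaves near the boundary. The change is O(e^T). *)
Lemma valence_lim_shift w0 w1 rho kap : admissible w0 (2 * rho) -> normc (w1 - w0) <= rho ->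
  valence_lim w0 rho kap -> valence_lim w1 rho kap.
Proof.
move=> adm w01; have [rho20 _] := adm; have rho0 : 0 < rho by lra.
have [s0 /andP[s01 s00] hs] := strip_avoids_disc adm.
have [K K0 hK] := stripD_decay f1w; have p0 := ltW (pi2_gt0 R).
pose c := 2 * lamr rho * (2 * pi * K) * normc (w1 - w0).
have c0 : 0 <= c.
  by have lp := ltW (lamr_gt0 rho0); rewrite !mulr_ge0 ?normc_ge0 ?pi_ge0.
have s0I : -1 < s0 < 0 by rewrite s01.
pose g w T s := V T s (lamr rho) w.
apply: (@lim_strip_transfer (g w0) (g w1) kap c s0 c0 s0I) => T s T1 ss s0'.
have Ts : T < s by rewrite (le_lt_trans T1)// (lt_le_trans s01).
have bz t y : 0 <= t <= 1 -> bump (lamr rho) (w0 + t%:C%C * (w1 - w0)) (F (mkc s y)) = 0.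
  move=> /andP[t0 t1]; apply: bump_outside => //.
  have k1 : 2 * rho < normc (F (mkc s y) - w0) by apply: hs; rewrite /= ss.
  have k2 : normc (t%:C%C * (w1 - w0)) <= rho.
    rewrite normcM normc_real ger0_norm// (le_trans _ w01)// ler_piMl// normc_ge0//.
  have := normc_lerB (F (mkc s y) - w0) (t%:C%C * (w1 - w0)); rewrite opprD addrA.
  by lra.
have := valence_move_shift fw f1w fB hK T1 Ts s0' (lamr_gt0 rho0) Bf0 bz.
move=> /le_trans; apply; rewrite /c; move: (pi : R) => p.
by rewrite le_eqVlt; apply/orP; left; apply/eqP; ring.
Qed.

Lemma admissible_ex w : ~ Cl w -> exists rho, admissible w rho.
Proof.
move=> /not_cluster_open[d d0 h]; exists (d / 2); split; first by rewrite divr_gt0.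
by move=> u hu; apply: h; lra.
Qed.

Lemma admissible_shift w w' rho : admissible w rho -> normc (w' - w) <= rho / 2 ->
  admissible w' (rho / 2).
Proof.
move=> [r0 hr] h; split; first by rewrite divr_gt0.
move=> u hu; apply: hr; have := normcD (u - w') (w' - w); rewrite addrA subrK; lra.
Qed.

Lemma valence_fun_ex : exists c : C -> R, forall w rho, admissible w rho -> valence_lim w rho (c w).
Proof.
suff /choice[c hc] : forall w, exists k, forall rho, admissible w rho -> valence_lim w rho k.
  by exists c.
move=> w; have [hw|hw] := pselect (Cl w).
  exists 0 => rho [r0 h]; exfalso; apply: (h w) => //.
  by rewrite subrr normc0 ltW.
have [rho adm] := admissible_ex hw; have [k hk] := valence_lim_ex adm.
exists k => rho' adm'; have [rho0 _] := adm; have [rho0' _] := adm'.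
(* Two admissible radii are compared through the smaller one, which makes the limit a function of w
   alone. *)
have m0 : 0 < Num.min rho rho' by rewrite lt_min rho0.
have m1 : Num.min rho rho' <= rho by rewrite ge_min lexx.
have m2 : Num.min rho rho' <= rho' by rewrite ge_min lexx orbT.
exact: (proj2 (valence_lim_scale k adm' m0 m2) (proj1 (valence_lim_scale k adm m0 m1) hk)).
Qed.

(** The part of the component where c = c(x) is relatively open, and relatively closed because the
    set where c differs from c(x) is open too. *)
Lemma locally_constant_component (c : C -> R) (x : Cplx R) :
  (forall w, ~ Cl w -> exists2 d : R, 0 < d & forall w', normc (w' - w) < d -> c w' = c w) ->
  ~ Cl x -> forall y, connected_component (~` Cl) x y -> c y = c x.
Proof.
move=> hc hx; pose U : set (Cplx R) := [set w | ~ Cl w /\ c w = c x].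
pose U' : set (Cplx R) := [set w | ~ Cl w /\ c w <> c x].
have op (P : R -> Prop) : open ([set w | ~ Cl w /\ P (c w)] : set (Cplx R)).
  rewrite openE => w [nw Pw]; have [d d0 hd] := hc w nw.
  have [d' d0' hd'] := not_cluster_open nw.
  apply/nbhs_ballP; exists ((Num.min d d')%:C%C : Cplx R); first by rewrite /= ltcR lt_min d0.
  move=> w'; rewrite /ball/= normC_def ltcR normcBC lt_min => /andP[h1 h2].
  by split; [exact: hd'|rewrite hd].
have cK := @component_connected (Cplx R) (~` Cl) x.
have sK : connected_component (~` Cl) x `<=` ~` Cl by exact: connected_component_sub.
suff KU : connected_component (~` Cl) x `&` U = connected_component (~` Cl) x.
  by move=> y; rewrite -KU => -[_ []].
apply: cK.
- by exists x; split => //; exact: connected_component_refl.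
- by exists U => //; exact: op (fun v => v = c x).
exists (~` U'); first by apply: open_closedC; exact: op (fun v => v <> c x).
rewrite predeqE => y; split => [[h1 [h2 h3]]|[h1 h2]].
  by split; [exact: h1|case=> _ h4; exact: h4 h3].
split; first exact: h1.
split; first exact: (sK y h1).
by apply/not_notP => h; apply: h2; split; [exact: (sK y h1)|exact: h].
Qed.

(** The limit takes one value per component, hence finitely many values, and it dominates the
    integrals over all strips by monotonicity. *)
Lemma valence_bound : finite_set (components (~` Cl)) ->
  exists2 N : R, 0 <= N & forall w rho, admissible w rho ->
    forall T s, T <= s -> s < 0 -> V T s (lamr rho) w <= N.
Proof.
move=> fin; have [c hc] := valence_fun_ex.
have lc w : ~ Cl w -> exists2 d : R, 0 < d & forall w', normc (w' - w) < d -> c w' = c w.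
  move=> nw; have [rho adm] := admissible_ex nw; have [rho0 hr] := adm.
  have r2 : 0 < rho / 2 by rewrite divr_gt0.
  exists (rho / 2) => // w' hw'.
  have adm1 : admissible w (2 * (rho / 2)) by rewrite mulrC divfK.
  have adm2 : admissible w (rho / 2) by apply: admissible_le adm => //; lra.
  have adm3 := admissible_shift adm (ltW hw').
  have lim1 := valence_lim_shift adm1 (ltW hw') (hc _ _ adm2).
  exact: (lim_strip_uniq (hc _ _ adm3) lim1).
have [N N0 hN] : exists2 N : R, 0 <= N & forall w, ~ Cl w -> c w <= N.
  have /finite_seqP[l hl] := fin.
  have hb A : A \in l -> exists b, forall w, A w -> c w <= b.
    move=> Al; have : components (~` Cl) A by rewrite hl.
    move=> [x hx <-]; exists (c x) => w hw.
    by rewrite (locally_constant_component lc hx hw).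
  have [N N0 hN] : exists2 N : R, 0 <= N & forall A, A \in l -> forall w, A w -> c w <= N.
    elim: l hb {hl} => [|A l IH] hb; first by exists 0.
    have [|N N0 hN] := IH; first by move=> B Bl; apply: hb; rewrite in_cons Bl orbT.
    have [b hbA] := hb A (mem_head _ _).
    exists (Num.max N b); first by rewrite le_max N0.
    move=> B; rewrite in_cons => /predU1P[->|Bl] w hw; rewrite le_max; apply/orP; [right|left].
      exact: hbA.
    exact: hN Bl _ hw.
  exists N => // w hw; have : components (~` Cl) (connected_component (~` Cl) w) by exists w.
  by rewrite hl => /hN; apply; exact: connected_component_refl.
exists N => // w rho adm T s Ts s0; have [rho0 hr] := adm.
apply: le_trans (valence_le_lim rho0 (hc _ _ adm) Ts s0) _; apply: hN.
by apply: hr; rewrite subrr normc0 ltW.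
Qed.

End ValenceBound.

(** * Cut-off functions *)

Section AreaBound.
Variable R : realType.
Local Notation C := R[i].
Variables (f : Cplx R -> Cplx R) (f1 f2 : C -> C) (N : R).
Hypothesis fw : forall z : C, normc z < 1 -> wirtinger (f : C -> C) z (f1 z) 0.
Hypothesis f1w : forall z : C, normc z < 1 -> wirtinger f1 z (f2 z) 0.
Hypothesis N0 : 0 <= N.

Local Notation F := (stripF f).
Local Notation E := (energy f1).
Local Notation Cl := (cluster_set f).
Local Notation V T s lam w := (valence_int f f1 T s lam w).
Local Notation rints T s g := (rdint T s 0 (2 * pi) g).

Hypothesis hN : forall w rho, admissible f w rho ->
  forall T s, T <= s -> s < 0 -> V T s (lamr rho) w <= N.

Lemma grid_point (x r d : R) (j : nat) : 0 < d -> r = j%:R * d -> `|x| <= 2 * r ->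
  exists2 k : nat, (k < (4 * j).+1)%N & `|x - (- 2 * r + k%:R * d)| <= d.
Proof.
move=> d0 rE hx; pose y := (x + 2 * r) / d.
have y0 : 0 <= y by rewrite divr_ge0 ?(ltW d0)//; move: hx; rewrite ler_norml; lra.
have /andP[k1 k2] := truncn_itv y0.
have yd : y * d = x + 2 * r by rewrite /y divfK// gt_eqF.
exists (Num.truncn y).
  rewrite ltnS -(ler_nat R) (le_trans k1)// /y ler_pdivrMr// natrM.
  move: hx; rewrite ler_norml => /andP[_ hx]; rewrite -mulrA -rE; lra.
have e1 : (Num.truncn y)%:R * d <= y * d by rewrite ler_pM2r.
have e2 : y * d < (Num.truncn y).+1%:R * d by rewrite ltr_pM2r.
rewrite -natr1 mulrDl mul1r in e2.
by rewrite ler_norml; lra.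
Qed.

(** In the square of half-side d the kernel of radius 2 d is at least 1 / (16 d^2): lam = 1 / (4
    d^2), and the squared bump is at least 1/4 since |u - w|^2 <= 2 d^2. *)
Lemma bump_near (d : R) (w u : C) : 0 < d -> `|complex.Re (u - w)| <= d ->
  `|complex.Im (u - w)| <= d -> 1 <= 16 * d ^+ 2 * (lamr (2 * d) * bump (lamr (2 * d)) w u ^+ 2).
Proof.
move=> d0 h1 h2; have n2 : normc (u - w) ^+ 2 <= 2 * d ^+ 2.
  rewrite sqr_normc -(real_normK (num_real (complex.Re _))) -(real_normK (num_real (complex.Im _))).
  have k1 : `|complex.Re (u - w)| ^+ 2 <= d ^+ 2 by rewrite lerXn2r ?nnegrE// ltW.
  have k2 : `|complex.Im (u - w)| ^+ 2 <= d ^+ 2 by rewrite lerXn2r ?nnegrE// ltW.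
  lra.
have lE : lamr (2 * d) = (4 * d ^+ 2)^-1 by rewrite /lamr; congr (_^-1); ring.
have dd : 0 < 4 * d ^+ 2 by rewrite mulr_gt0// exprn_gt0.
have b : 2^-1 <= bump (lamr (2 * d)) w u.
  rewrite le_max; apply/orP; right; rewrite lE.
  have : (4 * d ^+ 2)^-1 * normc (u - w) ^+ 2 <= 2^-1.
    by rewrite mulrC ler_pdivrMr//; lra.
  lra.
have b2 : 4^-1 <= bump (lamr (2 * d)) w u ^+ 2.
  have -> : 4^-1 = 2^-1 ^+ 2 :> R by field.
  by rewrite lerXn2r ?nnegrE ?bump_ge0.
rewrite lE in b2; rewrite mulrA lE; have -> : 16 * d ^+ 2 / (4 * d ^+ 2) = 4 by field; rewrite gt_eqF.
lra.
Qed.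

(** The part of the image in S, counted with multiplicity, has area O(N r^2). S is covered by
    kernels centred on a grid of mesh d = r / j; there are at most (4 j + 1)^2 <= 25 j^2 of them,
    each costing 16 d^2 B N, and 25 * 16 = 400. *)
Lemma area_bound (S : set C) (c0 : C) (r et B T s : R) (g : C -> R) : 0 < r -> 0 < et -> 0 <= B ->
  T <= s -> s < 0 -> cont_rectR T s 0 (2 * pi) g ->
  (forall u, S u -> normc (u - c0) <= 2 * r) ->
  (forall u v, S u -> normc (v - u) < et -> ~ Cl v) ->
  (forall z, rect T s 0 (2 * pi) z -> S (F z) -> g z <= B * E z) ->
  (forall z, rect T s 0 (2 * pi) z -> ~ S (F z) -> g z <= 0) ->
  rints T s g <= 400 * N * B * r ^+ 2.
Proof.
move=> r0 et0 B0 Ts s0 gc Sr Set_ gS gN; have p0 := ltW (pi2_gt0 R).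
(* This j gives 4 d < et: a point of S is within 2 d of its grid point, so the disc of radius 2 d
   around the latter stays within et of S and is admissible. *)
pose j := (Num.bound (4 * r / et)).+1; have j0 : 0 < j%:R :> R by rewrite ltr0n.
pose d := r / j%:R; have d0 : 0 < d by rewrite divr_gt0.
have rE : r = j%:R * d by rewrite /d mulrC divfK// gt_eqF.
have det : 4 * d < et.
  have k0 : 0 <= 4 * r / et by rewrite divr_ge0 ?(ltW et0)// mulr_ge0// ltW.
  have : 4 * r / et < j%:R by rewrite (lt_le_trans (archi_boundP k0))// ler_nat leqnSn.
  rewrite ltr_pdivrMr// => h; rewrite /d mulrA ltr_pdivrMr//; lra.
pose pt (k : nat * nat) : C := c0 + mkc (- 2 * r + k.1%:R * d) (- 2 * r + k.2%:R * d).
pose ks := [seq k <- allpairs pair (iota 0 (4 * j).+1) (iota 0 (4 * j).+1) |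
             `[< admissible f (pt k) (2 * d) >]].
pose h k z := 16 * d ^+ 2 * B * (lamr (2 * d) * bump (lamr (2 * d)) (pt k) (F z) ^+ 2 * E z).
have hc k : cont_rectR T s 0 (2 * pi) (h k).
  by apply: cont_rectR_mul; [exact: cont_rectR_cst|exact: (cont_valence fw f1w)].
have d20 : 0 < 2 * d by rewrite mulr_gt0.
have h0 k z : 0 <= h k z.
  rewrite mulr_ge0//; first by rewrite mulr_ge0// mulr_ge0// sqr_ge0.
  by apply: valence_integrand_ge0; rewrite ltW// lamr_gt0.
have E0 z : 0 <= E z by exact: energy_ge0.
have ghs z : rect T s 0 (2 * pi) z -> g z <= \sum_(k <- ks) h k z.
  move=> hz; have [Sz|nSz] := pselect (S (F z)); last first.
    by rewrite (le_trans (gN z hz nSz))// sumr_ge0.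
  have hn := Sr _ Sz.
  have [k1 k1j hk1] := grid_point d0 rE (le_trans (normRe_le _) hn).
  have [k2 k2j hk2] := grid_point d0 rE (le_trans (normIm_le _) hn).
  have e1 : complex.Re (F z - pt (k1, k2)) = complex.Re (F z - c0) - (- 2 * r + k1%:R * d).
    by rewrite /pt !ReD !ReN ReD/=; ring.
  have e2 : complex.Im (F z - pt (k1, k2)) = complex.Im (F z - c0) - (- 2 * r + k2%:R * d).
    by rewrite /pt !ImD !ImN ImD/=; ring.
  rewrite -e1 in hk1; rewrite -e2 in hk2.
  have adm : admissible f (pt (k1, k2)) (2 * d).
    split => // u hu; apply: (Set_ (F z)) => //; apply: le_lt_trans det.
    have -> : u - F z = (u - pt (k1, k2)) - (F z - pt (k1, k2)) by ring.
    rewrite (le_trans (normcB _ _))//.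
    have := normc_le_ReIm (F z - pt (k1, k2)); lra.
  have kin : (k1, k2) \in ks.
    rewrite mem_filter; apply/andP; split; first exact/asboolP.
    by apply/allpairsP; exists (k1, k2); rewrite !mem_iota.
  apply: (@le_trans _ _ (h (k1, k2) z)).
    rewrite (le_trans (gS z hz Sz))// /h.
    have := bump_near d0 hk1 hk2; set X := lamr _ * _ => hX.
    have -> : 16 * d ^+ 2 * B * (X * E z) = (16 * d ^+ 2 * X) * (B * E z) by ring.
    by rewrite ler_peMl// mulr_ge0.
  by rewrite (big_rem _ kin)/= lerDl sumr_ge0.
apply: (@le_trans _ _ (rints T s (fun z => \sum_(k <- ks) h k z))).
  by apply: rdint_le => //; exact: cont_rectR_sum.
rewrite rdint_sum//.
apply: (@le_trans _ _ (\sum_(k <- ks) 16 * d ^+ 2 * B * N)).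
  rewrite big_seq [leRHS]big_seq; apply: ler_sum => k; rewrite mem_filter => /andP[/asboolP adm _].
  rewrite rdintZ//; last exact: (cont_valence fw f1w).
  rewrite ler_wpM2l//; first by rewrite mulr_ge0// mulr_ge0// sqr_ge0.
  exact: hN.
rewrite big_const_seq count_predT iter_addr addr0.
have sz : (size ks)%:R <= 25 * j%:R ^+ 2 :> R.
  have : (size ks <= (4 * j).+1 * (4 * j).+1)%N.
    by rewrite size_filter (leq_trans (count_size _ _))// size_allpairs !size_iota.
  rewrite -(ler_nat R) => /le_trans; apply; rewrite natrM -natr1 natrM.
  have j1 : 1 <= j%:R :> R by rewrite ler1n.
  nra.
rewrite -[_ *+ size ks]mulr_natl rE.
have -> : 400 * N * B * (j%:R * d) ^+ 2 = 25 * j%:R ^+ 2 * (16 * d ^+ 2 * B * N) by ring.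
by rewrite ler_wpM2r// mulr_ge0// mulr_ge0// mulr_ge0// sqr_ge0.
Qed.

End AreaBound.

(** * The cut-off function of a finite family of discs *)

Section CutOff.
Variable R : realType.
Local Notation C := R[i].
Implicit Types (l : seq (C * R)) (u w : C).

Definition in_cover l u := exists2 p, p \in l & normc (u - p.1) < p.2.

(* The bump of radius 2 * p.2 is at least 3/4 on the disc p, whence the factor
   16/9 = (3/4)^(-2): eta_sum >= 1 on the covered set, where chi vanishes. *)
Definition eta_sum l u : R := \sum_(p <- l) 16 / 9 * bump (lamr (2 * p.2)) p.1 u ^+ 2.

Definition cut_root l u : R := Num.max 0 (1 - eta_sum l u).

Definition chi l u : R := cut_root l u ^+ 2.

Definition dbar_chi l u : C := 2 * (cut_root l u)%:C%C *
  \sum_(p <- l) (16 / 9)%:C%C * ((2 * lamr (2 * p.2) * bump (lamr (2 * p.2)) p.1 u)%:C%C * (u - p.1)).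

Lemma eta_sum_ge0 l u : 0 <= eta_sum l u.
Proof. by apply: sumr_ge0 => p _; rewrite mulr_ge0 ?sqr_ge0// divr_ge0. Qed.

Lemma cut_root_ge0 l u : 0 <= cut_root l u.
Proof. by rewrite le_max lexx. Qed.

Lemma cut_root_le1 l u : cut_root l u <= 1.
Proof. by rewrite ge_max ler01/= gerBl eta_sum_ge0. Qed.

Lemma chi_ge0 l u : 0 <= chi l u.
Proof. by rewrite sqr_ge0. Qed.

Lemma chi_le1 l u : chi l u <= 1.
Proof. by rewrite exprn_ile1 ?cut_root_ge0 ?cut_root_le1. Qed.

(** Since 1 - (1 - x)^2 <= 2 x; the right side is a sum over the discs, to be estimated disc by
    disc. *)
Lemma one_sub_chi_le l u : 1 - chi l u <= 2 * eta_sum l u.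
Proof.
rewrite /chi /cut_root; have := eta_sum_ge0 l u; move: (eta_sum l u) => x x0.
by case: (leP 0 (1 - x)) => h; nra.
Qed.

Lemma cut_root_in_cover l u : (forall p, p \in l -> 0 < p.2) -> in_cover l u -> cut_root l u = 0.
Proof.
move=> hl [p pl hp]; apply/max_idPl; rewrite subr_le0 /eta_sum (big_rem _ pl)/=.
have p0 := hl p pl.
have : 1 <= 16 / 9 * bump (lamr (2 * p.2)) p.1 u ^+ 2.
  have b : 3 / 4 <= bump (lamr (2 * p.2)) p.1 u.
    rewrite le_max; apply/orP; right.
    have : lamr (2 * p.2) * normc (u - p.1) ^+ 2 <= 1 / 4.
      rewrite /lamr mulrC ler_pdivrMr ?exprn_gt0 ?mulr_gt0//.
      have : normc (u - p.1) ^+ 2 <= p.2 ^+ 2 by rewrite lerXn2r ?nnegrE ?normc_ge0// ltW.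
      by nra.
    lra.
  have : (3 / 4) ^+ 2 <= bump (lamr (2 * p.2)) p.1 u ^+ 2.
    by rewrite lerXn2r ?nnegrE ?bump_ge0// divr_ge0.
  lra.
move=> /le_trans; apply; rewrite lerDl sumr_ge0// => q _.
by rewrite mulr_ge0 ?sqr_ge0// divr_ge0.
Qed.

Lemma conj_realM (x : R) (z : C) : (x%:C%C * z)^*%C = x%:C%C * z^*%C.
Proof. by case: z => a b; apply: complexP; rewrite /=; ring. Qed.

Lemma wirtinger_chi l u : exists a, wirtinger (fun v => (chi l v)%:C%C) u a (dbar_chi l u).
Proof.
pose t p : C := (16 / 9)%:C%C * ((2 * lamr (2 * p.2) * bump (lamr (2 * p.2)) p.1 u)%:C%C * (u - p.1)).
pose t' p : C := (16 / 9)%:C%C * ((2 * lamr (2 * p.2) * bump (lamr (2 * p.2)) p.1 u)%:C%C * (u - p.1)^*%C).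
have tc p : (t' p)^*%C = t p by rewrite /t' /t !conj_realM conjcK.
have h p : wirtinger (fun v => - (16 / 9)%:C%C * bump2 (lamr (2 * p.2)) p.1 v) u (t' p) (t p).
  apply: wirtinger_eq (wirtinger_scale (- (16 / 9)%:C%C) (wirtinger_bump2 (lamr (2 * p.2)) p.1 u)).
    by rewrite /t'; ring.
  by rewrite /t; ring.
have h1 := wirtinger_add (wirtinger_cst 1 u) (wirtinger_sum l h).
have ReE v : complex.Re (1 + \sum_(p <- l) - (16 / 9)%:C%C * bump2 (lamr (2 * p.2)) p.1 v) = 1 - eta_sum l v.
  rewrite ReD/= /eta_sum; congr (_ + _).
  elim: l {h1} => [|q l IH]; first by rewrite !big_nil oppr0.
  by rewrite !big_cons ReD IH opprD ReM ReN/= mulr0 subr0 mulNr.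
have h2 := wirtinger_comp h1 (wirtinger_pos_sqr _).
eexists; apply: wirtinger_ext (wirtinger_eq _ _ h2); first by move=> v; rewrite ReE.
  by reflexivity.
rewrite ReE -/(cut_root l u) !add0r rmorph_sum/=.
under [X in _ + _ * X]eq_bigr do rewrite tc.
change (dbar_chi l u) with (2 * (cut_root l u)%:C%C * \sum_(p <- l) t p).
by ring.
Qed.

Lemma contc_cut_root l u : contc (fun v => (cut_root l v)%:C%C) u.
Proof.
have h1 : contc (fun v => 1 - \sum_(p <- l) (16 / 9)%:C%C * bump2 (lamr (2 * p.2)) p.1 v) u.
  apply: contc_sub (contc_cst _ _) _.
  have w p : wirtinger (fun v => (16 / 9)%:C%C * bump2 (lamr (2 * p.2)) p.1 v) u _ _ :=
    wirtinger_scale _ (wirtinger_bump2 _ _ _).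
  exact: wirtinger_cont (wirtinger_sum l w).
have lip (x y : R) : `|Num.max 0 x - Num.max 0 y| <= `|x - y|.
  rewrite ler_norml; have := ler_norm (x - y); have := ler_norm (y - x); rewrite distrC.
  by have [x0|x0] := leP x 0; have [y0|y0] := leP y 0 => k1 k2; apply/andP; split; lra.
have := contc_real1 lip h1; apply: contc_ext => v.
rewrite /cut_root ReD ReN /=; congr ((Num.max 0 (_ - _))%:C%C).
rewrite /eta_sum; elim: l {h1} => [|q l IH]; first by rewrite !big_nil.
by rewrite !big_cons ReD IH ReM/= mul0r subr0.
Qed.

Lemma contc_chi l u : contc (fun v => (chi l v)%:C%C) u.
Proof.
have h := contc_cut_root l u; apply: contc_ext (contc_mul h h) => v.
by rewrite -rmorphM.
Qed.

Lemma contc_sum (I : Type) (s : seq I) (g : I -> C -> C) u : (forall i, contc (g i) u) ->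
  contc (fun v => \sum_(i <- s) g i v) u.
Proof.
move=> h; elim: s => [|i s IH].
  by apply: contc_ext (contc_cst 0 u) => v; rewrite big_nil.
by apply: contc_ext (contc_add (h i) IH) => v; rewrite big_cons.
Qed.

Lemma contc_dbar_chi l u : contc (dbar_chi l) u.
Proof.
apply: contc_mul; first exact: contc_mul (contc_cst _ _) (contc_cut_root l u).
apply: contc_sum => p; apply: contc_mul (contc_cst _ _) _; apply: contc_mul.
  have h := contc_mul (contc_cst (2 * lamr (2 * p.2))%:C%C u) (contc_bump (lamr (2 * p.2)) p.1 u).
  by apply: contc_ext h => v; rewrite -rmorphM.
exact: contc_sub (contc_id _) (contc_cst _ _).
Qed.

(** The share of p in the modulus of [dbar_chi]. Keeping the factor [cut_root] makes each share
    vanish on all the discs, so that only values at a positive distance from the cluster set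
    count. *)
Definition dchi_term l (p : C * R) u : R := 2 * cut_root l u *
  (16 / 9 * (2 * lamr (2 * p.2) * bump (lamr (2 * p.2)) p.1 u * normc (u - p.1))).

Lemma normc_dbar_chi_le l u : (forall p, p \in l -> 0 < p.2) ->
  normc (dbar_chi l u) <= \sum_(p <- l) dchi_term l p u.
Proof.
move=> hl; rewrite /dbar_chi !normcM (normc_nat R 2) normc_real ger0_norm ?cut_root_ge0//.
rewrite /dchi_term -[leRHS]mulr_sumr; apply: ler_wpM2l; first by rewrite mulr_ge0 ?cut_root_ge0.
rewrite (le_trans (normc_sum_le _ _ _))// big_seq [leRHS]big_seq; apply: ler_sum => p pl.
rewrite !normcM !normc_real ger0_norm ?divr_ge0// ger0_norm// mulr_ge0 ?bump_ge0//.
by rewrite mulr_ge0// ltW// lamr_gt0// mulr_gt0// hl.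
Qed.

(** On the support lam |u - p.1| <= 1 / (2 p.2), with prefactor 64/9, rounded up to 8. *)
Lemma dchi_term_le l p u : 0 < p.2 -> dchi_term l p u <= 4 / p.2.
Proof.
move=> p0; have p20 : 0 < 2 * p.2 by rewrite mulr_gt0.
have l0 := ltW (lamr_gt0 p20).
have [h|h] := leP (2 * p.2) (normc (u - p.1)).
  by rewrite /dchi_term bump_outside// mulr0 mul0r !mulr0 divr_ge0// ltW.
have b1 := bump_le1 p.1 u l0; have b0 := bump_ge0 (lamr (2 * p.2)) p.1 u.
have e : lamr (2 * p.2) * normc (u - p.1) <= (2 * p.2)^-1.
  apply: (@le_trans _ _ (lamr (2 * p.2) * (2 * p.2))); first by rewrite ler_wpM2l// ltW.
  by rewrite /lamr expr2 invfM -mulrA mulVf ?mulr1// gt_eqF.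
have e0 : 0 <= lamr (2 * p.2) * normc (u - p.1) by rewrite mulr_ge0 ?normc_ge0.
rewrite /dchi_term.
have -> : 2 * cut_root l u * (16 / 9 * (2 * lamr (2 * p.2) * bump (lamr (2 * p.2)) p.1 u *
   normc (u - p.1))) = 64 / 9 * (cut_root l u * (bump (lamr (2 * p.2)) p.1 u *
   (lamr (2 * p.2) * normc (u - p.1)))) by field.
have -> : 4 / p.2 = 8 * (1 * (1 * (2 * p.2)^-1)) by field; rewrite gt_eqF.
have k : cut_root l u * (bump (lamr (2 * p.2)) p.1 u * (lamr (2 * p.2) * normc (u - p.1))) <=
    1 * (1 * (2 * p.2)^-1).
  apply: ler_pM; [exact: cut_root_ge0|exact: mulr_ge0|exact: cut_root_le1|].
  exact: ler_pM.
have := mulr_ge0 (cut_root_ge0 l u) (mulr_ge0 b0 e0); lra.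
Qed.

Lemma contc_dchi_term l p u : contc (fun v => (dchi_term l p v)%:C%C) u.
Proof.
have h1 := contc_mul (contc_cst 2%:C%C u) (contc_cut_root l u).
have h2 := contc_mul (contc_cst (2 * lamr (2 * p.2))%:C%C u) (contc_bump (lamr (2 * p.2)) p.1 u).
have h3 : contc (fun v : C => (normc (v - p.1))%:C%C) u.
  by apply: contc_normc; exact: contc_sub (contc_id _) (contc_cst _ _).
have h4 := contc_mul h1 (contc_mul (contc_cst (16 / 9)%:C%C u) (contc_mul h2 h3)).
by apply: contc_ext h4 => v; rewrite -!rmorphM.
Qed.

End CutOff.

(** * Covers of the cluster set and energy estimates *)

Section Covers.
Variable R : realType.
Local Notation C := R[i].
Variables (f : Cplx R -> Cplx R) (Bf : R).
Hypothesis Bf0 : 0 < Bf.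
Local Notation Cl := (cluster_set f).
Hypothesis ClB : forall w, Cl w -> normc w <= Bf.

Definition good_cover (M eps : R) (l : seq (C * R)) :=
  [/\ forall p, p \in l -> 0 < p.2 < eps, forall u, Cl u -> in_cover l u &
      \sum_(p <- l) p.2 <= M].

Lemma cluster_in_rect u : Cl u -> rect (- Bf) Bf (- Bf) Bf u.
Proof.
by move=> /ClB h; split; rewrite -ler_norml (le_trans _ h)// ?normRe_le// normIm_le.
Qed.

(** Bisection of a square containing the cluster set, which is closed, extracts a finite subcover;
    its empty discs are then discarded to make all radii positive. *)
Lemma good_cover_ex : (linear_measure Cl < +oo)%E ->
  exists2 M : R, 0 <= M & forall eps, 0 < eps -> exists l, good_cover M eps l.
Proof.
move=> /linear_measure_cover[M M0 hM]; exists M => // eps eps0.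
have [c [rho [[h1 h2] hs]]] := hM eps eps0.
have rho0 n : 0 <= rho n by have [] := h1 n.
have [n hn] : exists n, forall u, rect (- Bf) Bf (- Bf) Bf u -> Cl u ->
    exists2 k, (k < n)%N & normc (u - c k) < rho k.
  pose Q x1 x2 y1 y2 := exists n, forall u, rect x1 x2 y1 y2 u -> Cl u ->
    exists2 k, (k < n)%N & normc (u - c k) < rho k.
  suff : Q (- Bf) Bf (- Bf) Bf by [].
  have BB : - Bf <= Bf by have B0 := Bf0; lra.
  apply: rect_ind => //.
    move=> x1 x2 y1 y2 _ _ _ _ _ _ mx my [n1 k1] [n2 k2] [n3 k3] [n4 k4].
    exists (n1 + n2 + n3 + n4)%N.
    apply: rect_quarters => u hu cu;
      [have [k kn hk] := k1 u hu cu|have [k kn hk] := k2 u hu cu|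
       have [k kn hk] := k3 u hu cu|have [k kn hk] := k4 u hu cu]; exists k => //.
    - by rewrite -!addnA ltn_addr.
    - by rewrite -!addnA ltn_addl// ltn_addr.
    - by rewrite ltn_addr// ltn_addl.
    - by rewrite ltn_addl.
  move=> p _; have [cp|ncp] := pselect (Cl p).
    have [k _ /= hk] := h2 p cp; exists (rho k - normc (p - c k)); first by rewrite subr_gt0.
    move=> x1 x2 y1 y2 _ _ _ _ _ hz; exists k.+1 => u /hz hu _; exists k => //.
    have := normcD (u - p) (p - c k); rewrite addrA subrK; lra.
  have [d d0 hd] := not_cluster_open ncp; exists d => // x1 x2 y1 y2 _ _ _ _ _ hz.
  by exists 0%N => u /hz hu cu; case: (hd u hu cu).
exists [seq (c k, rho k) | k <- iota 0 n & 0 < rho k]; split.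
- move=> p /mapP[k]; rewrite mem_filter => /andP[rk _] ->; rewrite /= rk/=.
  have [_] := h1 k; have := rho0 k; lra.
- move=> u cu; have [k kn hk] := hn u (cluster_in_rect cu) cu.
  exists (c k, rho k) => //; apply/mapP; exists k => //.
  by rewrite mem_filter mem_iota/= kn andbT (le_lt_trans (normc_ge0 _) hk).
rewrite big_map big_filter/=; have hsum := disc_cover_sum_le rho0 hs n.
rewrite (le_trans _ hsum)//.
rewrite big_mkcond/=; apply: ler_sum => k _; case: ifP => _.
  have := rho0 k; lra.
by rewrite mulr_ge0.
Qed.

(** A Lebesgue number of the cover: it supplies the distance [et] that [area_bound] asks for. *)
Lemma cover_dist (l : seq (C * R)) : (forall u, Cl u -> in_cover l u) ->
  exists2 et : R, 0 < et & forall u v, ~ in_cover l u -> normc (v - u) < et -> ~ Cl v.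
Proof.
move=> hl; have [et et0 h] : exists2 et : R, 0 < et & forall v, rect (- Bf) Bf (- Bf) Bf v ->
    Cl v -> forall u, normc (v - u) < et -> in_cover l u.
  pose Q x1 x2 y1 y2 := exists2 et : R, 0 < et & forall v, rect x1 x2 y1 y2 v ->
    Cl v -> forall u, normc (v - u) < et -> in_cover l u.
  suff : Q (- Bf) Bf (- Bf) Bf by [].
  have BB : - Bf <= Bf by have B0 := Bf0; lra.
  apply: rect_ind => //.
    move=> x1 x2 y1 y2 _ _ _ _ _ _ mx my [r1 r10 k1] [r2 r20 k2] [r3 r30 k3] [r4 r40 k4].
    exists (Num.min (Num.min r1 r2) (Num.min r3 r4)); first by rewrite !lt_min r10 r20 r30.
    apply: rect_quarters => v hv cv u; rewrite !lt_min => /andP[/andP[? ?] /andP[? ?]];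
      by [exact: (k1 v hv cv)|exact: (k2 v hv cv)|exact: (k3 v hv cv)|exact: (k4 v hv cv)].
  move=> p _; have [cp|ncp] := pselect (Cl p).
    have [q ql hq] := hl p cp; pose e := (q.2 - normc (p - q.1)) / 2.
    have e0 : 0 < e by rewrite divr_gt0// subr_gt0.
    exists e; first exact: e0.
    move=> x1 x2 y1 y2 _ _ _ _ _ hz; exists e; first exact: e0.
    move=> v /hz hv _ u hu; exists q; first exact: ql.
    have := normcD (p - q.1) (u - v).
    have := normcD (p - q.1 + (u - v)) (v - p).
    have -> : p - q.1 + (u - v) + (v - p) = u - q.1 by ring.
    have ee : e + e = q.2 - normc (p - q.1) by rewrite /e; field.
    rewrite [normc (u - v)]normcBC; lra.
  have [d d0 hd] := not_cluster_open ncp; exists d => // x1 x2 y1 y2 _ _ _ _ _ hz.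
  exists 1; first exact: ltr01.
  by move=> v /hz hv cv; case: (hd v hv cv).
exists et; first exact: et0.
by move=> u v nu uv cv; exact: nu (h v (cluster_in_rect cv) cv u uv).
Qed.

End Covers.

Section EnergyEstimates.
Variable R : realType.
Local Notation C := R[i].
Variables (f : Cplx R -> Cplx R) (f1 f2 : C -> C) (Bf N : R).
Hypothesis fw : forall z : C, normc z < 1 -> wirtinger (f : C -> C) z (f1 z) 0.
Hypothesis f1w : forall z : C, normc z < 1 -> wirtinger f1 z (f2 z) 0.
Hypothesis fB : forall z : C, normc z < 1 -> normc (f z) <= Bf.
Hypothesis Bf0 : 0 < Bf.
Hypothesis N0 : 0 <= N.

Local Notation F := (stripF f).
Local Notation E := (energy f1).
Local Notation Cl := (cluster_set f).
Local Notation V T s lam w := (valence_int f f1 T s lam w).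
Local Notation rints T s g := (rdint T s 0 (2 * pi) g).

Hypothesis ClB : forall w, Cl w -> normc w <= Bf.
Hypothesis hN : forall w rho, admissible f w rho ->
  forall T s, T <= s -> s < 0 -> V T s (lamr rho) w <= N.

Lemma cont_comp_stripR (g : C -> R) T s : s < 0 -> (forall u, contc (fun v => (g v)%:C%C) u) ->
  cont_rectR T s 0 (2 * pi) (fun z => g (F z)).
Proof. by move=> s0 gc; exact: (cont_comp_strip fw s0 gc). Qed.

Lemma chi_energy_le M eps l T s : good_cover f M eps l -> T <= s -> s < 0 ->
  rints T s (fun z => chi l (F z) * E z) <= 400 * N * 1 * Bf ^+ 2.
Proof.
move=> [hl1 hl2 _] Ts s0; have [et et0 het] := cover_dist Bf0 ClB hl2.
have E0 z : 0 <= E z by exact: energy_ge0.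
apply: (@area_bound _ f f1 f2 N fw f1w N0 hN (fun u => ~ in_cover l u /\ normc u <= Bf) 0 Bf et) => //.
- apply: cont_rectR_mul; last exact: (cont_energy f1w).
  by apply: cont_comp_stripR => // u; exact: contc_chi.
- by move=> u [_ h]; rewrite subr0; have B0 := Bf0; lra.
- by move=> u v [h _]; exact: het h.
- by move=> z _ _; rewrite ler_wpM2r// chi_le1.
move=> z hz h; have [hi|hi] := pselect (in_cover l (F z)).
  rewrite /chi cut_root_in_cover ?expr0n ?mul0r//.
  by move=> p /hl1 /andP[].
by exfalso; apply: h; split => //; apply: (stripF_le fB); exact: (rect_Re_lt0 s0 hz).
Qed.

(** A derivative of size 4 / p.2 over an image area 400 N p.2^2 leaves a bound linear in the radius,
    which can be summed over the cover. *)
Lemma dchi_energy_le M eps l p T s : good_cover f M eps l -> p \in l -> T <= s -> s < 0 ->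
  rints T s (fun z => dchi_term l p (F z) * E z) <= 1600 * N * p.2.
Proof.
move=> [hl1 hl2 _] pl Ts s0; have [et et0 het] := cover_dist Bf0 ClB hl2.
have E0 z : 0 <= E z by exact: energy_ge0.
have /andP[p0 _] := hl1 p pl.
have -> : 1600 * N * p.2 = 400 * N * (4 / p.2) * p.2 ^+ 2 by field; rewrite gt_eqF.
apply: (@area_bound _ f f1 f2 N fw f1w N0 hN
   (fun u => ~ in_cover l u /\ normc (u - p.1) <= 2 * p.2) p.1 p.2 et) => //.
- by rewrite divr_ge0// ltW.
- apply: cont_rectR_mul; last exact: (cont_energy f1w).
  by apply: cont_comp_stripR => // u; exact: contc_dchi_term.
- by move=> u [].
- by move=> u v [h _]; exact: het h.
- by move=> z _ _; rewrite ler_wpM2r// dchi_term_le.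
move=> z hz h; have [hi|hi] := pselect (in_cover l (F z)).
  rewrite /dchi_term cut_root_in_cover ?mulr0 ?mul0r//.
  by move=> q /hl1 /andP[].
have [hd|hd] := leP (normc (F z - p.1)) (2 * p.2); first by exfalso; apply: h; split.
by rewrite /dchi_term bump_outside ?mulr_gt0 ?(ltW hd)// mulr0 mul0r !mulr0 mul0r.
Qed.

Lemma cexp_small_increment : exists2 d : R, 0 < d &
  forall h : C, normc h < d -> normc h / 2 <= normc (cexp h - 1) <= 2 * normc h.
Proof.
have e0 : 0 < 1 / 2 :> R by rewrite divr_gt0.
have [d d0 hd] := wirtinger_cexp (0 : C) e0; exists d => // h /hd.
have -> : cexp (0 : C) = 1 by rewrite /cexp/= expR0 expi0 mulr1.
rewrite add0r mul0r addr0 mul1r => k.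
have := normc_lerB h (cexp h - 1); have := normc_lerB (cexp h - 1) h.
rewrite [normc (h - _)]normcBC => k1 k2; have := normc_ge0 h => h0.
by apply/andP; split; lra.
Qed.

(** One factor 1/2 is lost in comparing e^z' - e^z with z' - z, another in absorbing the Taylor
    remainder of f; e^(-1) is the least value of |e^z| for Re z >= -1. *)
Lemma strip_separation (s eps : R) : -1 < s -> s < 0 -> 0 < eps ->
  exists2 d : R, 0 < d & forall z z' : C, -1 <= complex.Re z <= s ->
    -1 <= complex.Re z' <= s -> normc (z' - z) < d -> eps < normc (stripD f1 z) ->
    eps / 4 * expR (-1) * normc (z' - z) <= normc (F z' - F z).
Proof.
move=> s1 s0 eps0; have r1 : expR s < 1 by rewrite expR_lt1.
have [L L0 [g2 hL]] := taylor_holomorphic fw (expR_ge0 s) r1.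
have [d d0 hd] := cexp_small_increment.
(* The second bound makes L |e^z' - e^z| at most eps / 2. *)
exists (Num.min d (eps / (4 * (L + 1)))).
  by rewrite lt_min d0 divr_gt0// mulr_gt0// ltr_pwDr.
move=> z z' /andP[z1 z2] /andP[z1' z2'] hz hD; move: hz; rewrite lt_min => /andP[/hd/andP[k1 k2] k3].
pose a := cexp z; pose b := cexp z'.
have ar : normc a <= expR s by rewrite normc_cexp ler_expR.
have br : normc b <= expR s by rewrite normc_cexp ler_expR.
have ba : b - a = a * (cexp (z' - z) - 1).
  by rewrite /a /b mulrBr mulr1 -cexpD [z + (_ - _)]addrC subrK.
have a1 : normc a <= 1 by rewrite (le_trans ar)// ltW.
have a2 : expR (-1) <= normc a by rewrite normc_cexp ler_expR.
have [t _] := hL a b ar br.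
set x := normc (z' - z) in k1 k2 k3 *; have x0 : 0 <= x by exact: normc_ge0.
have ba1 : normc (b - a) <= 2 * x.
  rewrite ba normcM (le_trans _ k2)// ler_piMl ?normc_ge0//.
have ba2 : expR (-1) * (x / 2) <= normc (b - a).
  by rewrite ba normcM; apply: ler_pM; rewrite ?expR_ge0 ?divr_ge0.
have e1 : eps <= normc (f1 a).
  apply: ltW; apply: lt_le_trans hD _; rewrite /stripD normcM.
  by rewrite ler_piMr ?normc_ge0.
have Lx : L * normc (b - a) <= eps / 2.
  have q : x * (4 * (L + 1)) < eps by rewrite -ltr_pdivlMr// mulr_gt0// ltr_pwDr.
  have : L * normc (b - a) <= L * (2 * x) by rewrite ler_wpM2l.
  nra.
have n0 := normc_ge0 (b - a).
have t1 : normc ((b - a) * f1 a) - L * normc (b - a) ^+ 2 <= normc (f b - f a).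
  have := normc_lerB ((b - a) * f1 a) (f b - f a); rewrite normcBC; lra.
have t2 : normc (b - a) * (eps / 2) <= normc (f b - f a).
  apply: le_trans t1; rewrite normcM expr2 [L * _]mulrA.
  have : normc (b - a) * eps <= normc (b - a) * normc (f1 a) by rewrite ler_wpM2l.
  have : L * normc (b - a) * normc (b - a) <= eps / 2 * normc (b - a) by rewrite ler_wpM2r.
  lra.
apply: le_trans t2.
have -> : eps / 4 * expR (-1) * x = expR (-1) * (x / 2) * (eps / 2) by field.
by rewrite ler_wpM2r// divr_ge0// ltW.
Qed.

(* Where |f'| > eps the map is injective at a uniform scale with a Lipschitz
   inverse, so a small disc has a preimage of comparable area. *)
Lemma null_estimate (s eps : R) : -1 < s -> s < 0 -> 0 < eps ->
  exists2 K : R, 0 <= K & forall (c0 : C) (rho Bm : R) (g : C -> R), 0 < rho -> 0 <= Bm ->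
    cont_rectR (-1) s 0 (2 * pi) g ->
    (forall z, rect (-1) s 0 (2 * pi) z -> g z <= Bm) ->
    (forall z, rect (-1) s 0 (2 * pi) z -> g z != 0 ->
       normc (F z - c0) <= 2 * rho /\ eps < normc (stripD f1 z)) ->
    rints (-1) s g <= K * Bm * rho ^+ 2.
Proof.
move=> s1 s0 eps0; have p0 := ltW (pi2_gt0 R); have [d d0 hd] := strip_separation s1 s0 eps0.
pose Hyp (c0 : C) (rho Bm : R) (g : C -> R) := [/\ 0 < rho, 0 <= Bm,
    cont_rectR (-1) s 0 (2 * pi) g,
    (forall z, rect (-1) s 0 (2 * pi) z -> g z <= Bm) &
    (forall z, rect (-1) s 0 (2 * pi) z -> g z != 0 ->
       normc (F z - c0) <= 2 * rho /\ eps < normc (stripD f1 z))].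
(* K is chosen before the disc and g, so the constants of the four quarters can be added. *)
pose Q x1 x2 y1 y2 := exists2 K : R, 0 <= K & x1 <= x2 -> y1 <= y2 -> forall c0 rho Bm g, Hyp c0 rho Bm g ->
    rdint x1 x2 y1 y2 g <= K * (Bm * rho ^+ 2).
suff : Q (-1) s 0 (2 * pi).
  move=> [K K0 hK]; exists K => // c0 rho Bm g h1 h2 h3 h4 h5.
  by rewrite -mulrA; apply: (hK (ltW s1) p0 c0).
apply: rect_ind => //; first exact: ltW.
  move=> x1 x2 y1 y2 ax xx xb cy yy yd mx my [K1 K10 h1] [K2 K20 h2] [K3 K30 h3] [K4 K40 h4].
  have hx1 : x1 <= mx by rewrite /mx; lra.
  have hx2 : mx <= x2 by rewrite /mx; lra.
  have hy1 : y1 <= my by rewrite /my; lra.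
  have hy2 : my <= y2 by rewrite /my; lra.
  exists (K1 + K2 + K3 + K4); first by rewrite !addr_ge0.
  move=> _ _ c0 rho Bm g hg; have [_ _ gc _ _] := hg.
  have gc' : cont_rectR x1 x2 y1 y2 g by apply: cont_rect_sub gc.
  have gc1 : cont_rectR x1 mx y1 y2 g by apply: cont_rect_sub gc'.
  have gc2 : cont_rectR mx x2 y1 y2 g by apply: cont_rect_sub gc'.
  rewrite (rdint_catx hx1 hx2 yy gc') (rdint_caty hx1 hy1 hy2 gc1) (rdint_caty hx2 hy1 hy2 gc2).
  have q1 := h1 hx1 hy1 _ _ _ _ hg; have q2 := h2 hx2 hy1 _ _ _ _ hg.
  have q3 := h3 hx1 hy2 _ _ _ _ hg; have q4 := h4 hx2 hy2 _ _ _ _ hg.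
  have -> : (K1 + K2 + K3 + K4) * (Bm * rho ^+ 2) = K1 * (Bm * rho ^+ 2) + K3 * (Bm * rho ^+ 2) +
     (K2 * (Bm * rho ^+ 2) + K4 * (Bm * rho ^+ 2)) by ring.
  by apply: lerD; apply: lerD.
move=> p _; exists (d / 2); first by rewrite divr_gt0.
move=> x1 x2 y1 y2 ax xb cy yd hp hz.
(* Two points of the support have images within 4 rho, hence lie within 16 e rho / eps of each other
   by [strip_separation]; 17 makes the contradiction strict. *)
pose q := 17 * expR 1 / eps; have q0 : 0 < q by rewrite divr_gt0// mulr_gt0// expR_gt0.
exists (4 * q ^+ 2); first by rewrite mulr_ge0// sqr_ge0.
move=> xx yy c0 rho Bm g [rho0 Bm0 gc gB gs].
have gc' : cont_rectR x1 x2 y1 y2 g by apply: cont_rect_sub gc.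
have inr z : rect x1 x2 y1 y2 z -> rect (-1) s 0 (2 * pi) z by exact: rect_sub.
have gB' z : rect x1 x2 y1 y2 z -> g z <= Bm by move=> /inr; exact: gB.
have [[z0 [hz0 gz0]]|none] := pselect (exists z, rect x1 x2 y1 y2 z /\ g z != 0); last first.
  (* If g vanishes on the rectangle, the support estimate applies with radius 0 and an arbitrary
     centre. *)
  have zero z : rect x1 x2 y1 y2 z -> 0 <= normc (z - 0) -> g z = 0.
    by move=> h _; apply/eqP/negP => /negP h'; apply: none; exists z.
  have := rdint_small_support xx yy (lexx 0) Bm0 gc' gB' zero; rewrite mulr0 mul0r => /le_trans; apply.
  by rewrite mulr_ge0// mulr_ge0// sqr_ge0.
have [k1 k2] := gs z0 (inr _ hz0) gz0.
have supp z : rect x1 x2 y1 y2 z -> q * rho <= normc (z - z0) -> g z = 0.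
  move=> h hq; apply/eqP/negP => /negP gz; have [k3 _] := gs z (inr _ h) gz.
  have zz : normc (z - z0) < d.
    have -> : z - z0 = (z - p) - (z0 - p) by ring.
    have := normcB (z - p) (z0 - p); have := hz z h; have := hz z0 hz0; lra.
  have [r1 _] := inr _ hz0; have [r2 _] := inr _ h.
  have := hd z0 z r1 r2 zz k2.
  have : normc (F z - F z0) <= 4 * rho.
    have -> : F z - F z0 = (F z - c0) - (F z0 - c0) by ring.
    have := normcB (F z - c0) (F z0 - c0); lra.
  move=> h1 h2; have h3 := le_trans h2 h1.
  have e1 : 0 < expR (-1) :> R by exact: expR_gt0.
  have h4 : eps / 4 * expR (-1) * (q * rho) <= 4 * rho.
    by apply: le_trans h3; rewrite ler_wpM2l// mulr_ge0 ?ltW// divr_gt0.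
  have qE : eps / 4 * expR (-1) * (q * rho) = 17 / 4 * rho.
    rewrite /q expRN; field; rewrite !gt_eqF ?expR_gt0//.
  rewrite qE in h4; lra.
have qr0 : 0 <= q * rho by rewrite mulr_ge0// ltW.
have := rdint_small_support xx yy qr0 Bm0 gc' gB' supp.
by have -> : 2 * (q * rho) * (2 * (q * rho) * Bm) = 4 * q ^+ 2 * (Bm * rho ^+ 2) by ring.
Qed.

End EnergyEstimates.

Section DirichletAndCircles.
Variable R : realType.
Local Notation C := R[i].
Variables (f : Cplx R -> Cplx R) (f1 f2 : C -> C) (Bf N M : R).
Hypothesis fw : forall z : C, normc z < 1 -> wirtinger (f : C -> C) z (f1 z) 0.
Hypothesis f1w : forall z : C, normc z < 1 -> wirtinger f1 z (f2 z) 0.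
Hypothesis fB : forall z : C, normc z < 1 -> normc (f z) <= Bf.
Hypothesis Bf0 : 0 < Bf.
Hypothesis N0 : 0 <= N.
Hypothesis M0 : 0 <= M.

Local Notation F := (stripF f).
Local Notation E := (energy f1).
Local Notation Cl := (cluster_set f).
Local Notation V T s lam w := (valence_int f f1 T s lam w).
Local Notation rints T s g := (rdint T s 0 (2 * pi) g).

Hypothesis ClB : forall w, Cl w -> normc w <= Bf.
Hypothesis hN : forall w rho, admissible f w rho ->
  forall T s, T <= s -> s < 0 -> V T s (lamr rho) w <= N.
Hypothesis hcov : forall eps, 0 < eps -> exists l, good_cover f M eps l.

Lemma one_sub_chi_ge0 l (u : C) : 0 <= 1 - chi l u.
Proof. by rewrite subr_ge0 chi_le1. Qed.

Lemma cont_one_sub_chi l T s : s < 0 -> cont_rectR T s 0 (2 * pi) (fun z => 1 - chi l (F z)).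
Proof.
move=> s0; apply: (cont_comp_stripR (g := fun u => 1 - chi l u) fw s0) => u.
apply: contc_ext (contc_sub (contc_cst 1 u) (contc_chi l u)) => v.
by rewrite rmorphB rmorph1.
Qed.

Lemma cont_one_sub_chi_energy l T s : s < 0 ->
  cont_rectR T s 0 (2 * pi) (fun z => (1 - chi l (F z)) * E z).
Proof.
by move=> s0; apply: cont_rectR_mul; [exact: cont_one_sub_chi|exact: (cont_energy f1w)].
Qed.

(** Truncating the energy at ep^2 confines the term to points with |F'| > ep, where [null_estimate]
    applies, and keeps it continuous. *)
Definition null_term (ep : R) (p : C * R) (z : C) : R :=
  2 * (16 / 9 * bump (lamr (2 * p.2)) p.1 (F z) ^+ 2) * Num.max 0 (E z - ep ^+ 2).

Lemma null_split (x e et y : R) : 0 <= x -> x <= 1 -> x <= 2 * et -> 0 <= y -> 0 <= e ->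
  x * y <= e + 2 * et * Num.max 0 (y - e).
Proof. by move=> x0 x1 xe y0 e0; case: (leP 0 (y - e)) => h; nra. Qed.

Lemma one_sub_chi_energy_le_terms ep l z : (1 - chi l (F z)) * E z <=
  ep ^+ 2 + \sum_(p <- l) null_term ep p z.
Proof.
have -> : \sum_(p <- l) null_term ep p z = 2 * eta_sum l (F z) * Num.max 0 (E z - ep ^+ 2).
  by rewrite /null_term -mulr_suml -mulr_sumr.
apply: null_split; rewrite ?sqr_ge0 ?one_sub_chi_ge0 ?one_sub_chi_le//.
by rewrite gerBl chi_ge0.
Qed.

Lemma cont_null_term ep p T s : s < 0 -> cont_rectR T s 0 (2 * pi) (null_term ep p).
Proof.
move=> s0; have h1 : cont_rectR T s 0 (2 * pi) (fun z => bump (lamr (2 * p.2)) p.1 (F z)).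
  exact: (cont_bump_strip fw).
have h2 : cont_rectR T s 0 (2 * pi) (fun z => Num.max 0 (E z - ep ^+ 2)).
  have lip (x y : R) : `|Num.max 0 (x - ep ^+ 2) - Num.max 0 (y - ep ^+ 2)| <= `|x - y|.
    rewrite ler_norml; have := ler_norm (x - y); have := ler_norm (y - x); rewrite distrC.
    by have [x0|x0] := leP (x - ep ^+ 2) 0; have [y0|y0] := leP (y - ep ^+ 2) 0 => k1 k2;
      apply/andP; split; lra.
  by move=> z hz; have := contc_real1 lip (cont_energy f1w s0 hz).
apply: cont_rectR_mul h2; apply: cont_rectR_mul; first exact: cont_rectR_cst.
apply: cont_rectR_mul; [exact: cont_rectR_cst|exact: (cont_rectR_mul h1 h1)].
Qed.

Lemma null_term_support ep p z : 0 < p.2 -> 0 <= ep -> null_term ep p z != 0 ->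
  normc (F z - p.1) <= 2 * p.2 /\ ep < normc (stripD f1 z).
Proof.
move=> p0 ep0 h; split.
  rewrite leNgt; apply/negP => hd; move: h; rewrite /null_term bump_outside ?mulr_gt0 ?(ltW hd)//.
  by rewrite expr0n !mulr0 mul0r eqxx.
rewrite ltNge; apply/negP => hd; move: h; rewrite /null_term.
have -> : Num.max 0 (E z - ep ^+ 2) = 0.
  by apply/max_idPl; rewrite subr_le0 /energy lerXn2r ?nnegrE ?normc_ge0.
by rewrite mulr0 eqxx.
Qed.

Lemma null_term_le ep p z B : 0 < p.2 -> normc (stripD f1 z) <= B -> null_term ep p z <= 4 * B ^+ 2.
Proof.
move=> p0 hB; have l0 : 0 <= lamr (2 * p.2) by rewrite ltW// lamr_gt0// mulr_gt0.
have b1 := bump_le1 p.1 (F z) l0; have b0 := bump_ge0 (lamr (2 * p.2)) p.1 (F z).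
have b2 : bump (lamr (2 * p.2)) p.1 (F z) ^+ 2 <= 1 by rewrite exprn_ile1.
have b3 : 0 <= bump (lamr (2 * p.2)) p.1 (F z) ^+ 2 by rewrite sqr_ge0.
have e1 : E z <= B ^+ 2 by rewrite /energy lerXn2r ?nnegrE ?normc_ge0// (le_trans _ hB) ?normc_ge0.
have m1 : Num.max 0 (E z - ep ^+ 2) <= B ^+ 2.
  by rewrite ge_max sqr_ge0/=; have := sqr_ge0 ep; lra.
have m0 : 0 <= Num.max 0 (E z - ep ^+ 2) by rewrite le_max lexx.
rewrite /null_term; move: b2 b3 m0 m1.
move: (bump _ _ _ ^+ 2) (Num.max _ _) (B ^+ 2) => x m b x1 x0 m0 m1; nra.
Qed.

(** The energy below ep^2 contributes at most e / 2. The disc p contributes K Bm p.2^2 <= K Bm eps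
    p.2, and these sum to at most K Bm eps M: this is how the zero area of the cluster set enters.
    Here eps depends on s through K and Bm. *)
Lemma one_sub_chi_energy_fixed (s e : R) : -1 < s -> s < 0 -> 0 < e ->
  exists2 eps : R, 0 < eps & forall l, good_cover f M eps l ->
    rints (-1) s (fun z => (1 - chi l (F z)) * E z) <= e.
Proof.
move=> s1 s0 e0; have p0 := pi_gt0 R; have p20 := ltW (pi2_gt0 R).
(* Then ep^2 <= ep <= e / (4 pi), and the strip has area at most 2 pi. *)
pose ep : R := Num.min 1 (e / (4 * pi)).
have ep0 : 0 < ep by rewrite lt_min ltr01 divr_gt0// mulr_gt0.
have ep1 : ep <= 1 by rewrite ge_min lexx.
have ep2 : ep <= e / (4 * pi) by rewrite ge_min lexx orbT.
have epq : 2 * pi * ep ^+ 2 <= e / 2.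
  have h1 : ep ^+ 2 <= e / (4 * pi).
    by apply: le_trans ep2; rewrite expr2 ler_piMl// ltW.
  have -> : e / 2 = 2 * pi * (e / (4 * pi)).
    by move: p0; move: (pi : R) => p p0; field; rewrite gt_eqF.
  by rewrite ler_wpM2l.
have [K K0 hK] := null_estimate fw s1 s0 ep0.
have [|B B0 hB] := @bounded_rect _ (-1) s 0 (2 * pi) (stripD f1) (ltW s1) p20.
  by move=> z hz; apply: (contc_stripD f1w); exact: rect_Re_lt0 hz.
pose Bm := 4 * B ^+ 2; have Bm0 : 0 <= Bm by rewrite mulr_ge0// sqr_ge0.
have KBM : 0 <= K * Bm * M by rewrite !mulr_ge0.
pose eps := e / (2 * (K * Bm * M + 1)).
have eps0 : 0 < eps by rewrite divr_gt0// mulr_gt0// ltr_pwDr.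
exists eps => // l [hl1 hl2 hl3].
have step : rints (-1) s (fun z => (1 - chi l (F z)) * E z) <=
   rints (-1) s (fun z => ep ^+ 2 + \sum_(p <- l) null_term ep p z).
  apply: rdint_le; [exact: ltW|exact: p20|exact: cont_one_sub_chi_energy| |].
    apply: cont_rectR_add; [exact: cont_rectR_cst|apply: cont_rectR_sum => p; exact: cont_null_term].
  by move=> z _; exact: one_sub_chi_energy_le_terms.
apply: (le_trans step).
have cs : cont_rectR (-1) s 0 (2 * pi) (fun z => \sum_(p <- l) null_term ep p z).
  by apply: cont_rectR_sum => p; exact: cont_null_term.
rewrite (rdintD (ltW s1) p20 (cont_rectR_cst _) cs) (rdint_cst _ (ltW s1) p20).
rewrite (rdint_sum _ (ltW s1) p20 (fun p => cont_null_term ep p s0)).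
have t1 : (s - -1) * (2 * pi - 0) * ep ^+ 2 <= e / 2.
  apply: le_trans epq; rewrite subr0 -mulrA ler_piMl//.
    by rewrite mulr_ge0// sqr_ge0.
  by rewrite opprK; have := s0; lra.
have t2 : \sum_(p <- l) rints (-1) s (null_term ep p) <= \sum_(p <- l) K * Bm * eps * p.2.
  rewrite big_seq [leRHS]big_seq; apply: ler_sum => p pl.
  have /andP[pp pe] := hl1 p pl.
  apply: (@le_trans _ _ (K * Bm * p.2 ^+ 2)).
    apply: (hK p.1 p.2 Bm) => //.
    - exact: cont_null_term.
    - by move=> z hz; apply: null_term_le => //; exact: hB.
    - by move=> z hz; apply: null_term_support => //; exact: ltW.
  rewrite expr2 mulrA ler_wpM2r ?(ltW pp)// ler_wpM2l ?mulr_ge0//; exact: ltW.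
have t3 : \sum_(p <- l) K * Bm * eps * p.2 <= e / 2.
  rewrite -mulr_sumr (@le_trans _ _ (K * Bm * eps * M))//.
    by rewrite ler_wpM2l// mulr_ge0 ?(ltW eps0)// mulr_ge0.
  have -> : K * Bm * eps * M = K * Bm * M * eps by ring.
  rewrite /eps mulrA ler_pdivrMr ?mulr_gt0 ?ltr_pwDr//.
  have -> : e / 2 * (2 * (K * Bm * M + 1)) = e * (K * Bm * M) + e by field.
  by rewrite mulrC lerDl ltW.
have -> : e = e / 2 + e / 2 by field.
exact: lerD t1 (le_trans t2 t3).
Qed.

Lemma energy_split l s : -1 < s -> s < 0 -> rints (-1) s E =
  rints (-1) s (fun z => chi l (F z) * E z) + rints (-1) s (fun z => (1 - chi l (F z)) * E z).
Proof.
move=> s1 s0; rewrite -(rdintD (ltW s1) (ltW (pi2_gt0 R))).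
- by apply: rdint_ext => z _; ring.
- apply: cont_rectR_mul; last exact: (cont_energy f1w).
  by apply: (cont_comp_stripR fw s0) => u; exact: contc_chi.
- exact: cont_one_sub_chi_energy.
Qed.

(** The cover is chosen for each s separately, but the resulting bound does not depend on it. *)
Lemma dirichlet_bounded : forall s, -1 < s -> s < 0 -> rints (-1) s E <= 400 * N * 1 * Bf ^+ 2 + 1.
Proof.
move=> s s1 s0; have [eps eps0 heps] := one_sub_chi_energy_fixed s1 s0 ltr01.
have [l hl] := hcov eps0; rewrite (energy_split l s1 s0); apply: lerD; last exact: heps.
exact: (chi_energy_le fw f1w fB Bf0 N0 ClB hN hl (ltW s1) s0).
Qed.

(** Since the energies are bounded, some s0 captures all but e / 2 of their supremum; the
    fixed-strip estimate handles the part up to s0, and beyond it 1 - chi <= 1 is enough. *)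
Lemma one_sub_chi_energy_uniform (e : R) : 0 < e ->
  exists2 eps : R, 0 < eps & forall l, good_cover f M eps l -> forall s, -1 < s -> s < 0 ->
    rints (-1) s (fun z => (1 - chi l (F z)) * E z) <= e.
Proof.
move=> e0; have p20 := ltW (pi2_gt0 R); have e2 : 0 < e / 2 by rewrite divr_gt0.
pose X := [set x | exists s, [/\ -1 < s, s < 0 & x = rints (-1) s E]].
have h1 : -1 < - 2^-1 :> R by lra.
have h2 : - 2^-1 < 0 :> R by lra.
have hsup : has_sup X.
  split; first by exists (rints (-1) (- 2^-1) E), (- 2^-1).
  exists (400 * N * 1 * Bf ^+ 2 + 1) => _ [s [s1 s0 ->]]; exact: dirichlet_bounded.
have [_ [s0 [s01 s00 ->]] hs0] := sup_adherent e2 hsup.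
have [eps eps0 heps] := one_sub_chi_energy_fixed s01 s00 e2.
have fin (a b c d : R) : b - e / 2 < a -> c <= e / 2 -> a + d <= b -> c + d <= e by lra.
exists eps => // l hl s s1 s_0; have w0 := heps l hl.
have nn z : 0 <= (1 - chi l (F z)) * E z by rewrite mulr_ge0 ?one_sub_chi_ge0 ?energy_ge0.
have cw t : t < 0 -> cont_rectR (-1) t 0 (2 * pi) (fun z => (1 - chi l (F z)) * E z).
  exact: cont_one_sub_chi_energy.
have [ss|ss] := leP s s0.
  apply: (@le_trans _ _ (rints (-1) s0 (fun z => (1 - chi l (F z)) * E z))).
    exact: rints_mono (lexx _) (ltW s1) ss s00 (cw _ s00) nn.
  by apply: le_trans w0 _; rewrite ler_pdivrMr// ler_pMr// ler1n.
rewrite (rdint_catx (ltW s01) (ltW ss) p20 (cw _ s_0)).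
have tail : rints s0 s (fun z => (1 - chi l (F z)) * E z) <= rints s0 s E.
  apply: rdint_le; [exact: ltW|exact: p20|exact: cont_one_sub_chi_energy|exact: (cont_energy f1w)|].
  move=> z _; rewrite ler_piMl ?energy_ge0//.
  by rewrite gerBl chi_ge0.
have ub : rints (-1) s0 E + rints s0 s E <= sup X.
  rewrite -(rdint_catx (ltW s01) (ltW ss) p20 (cont_energy f1w s_0)).
  by apply: ub_le_sup; [case: hsup|exists s].
by apply: le_trans (lerD (lexx _) tail) _; exact: fin hs0 w0 ub.
Qed.

Lemma dbar_chi_energy_le l eps T s : good_cover f M eps l -> T <= s -> s < 0 ->
  rints T s (fun z => normc (dbar_chi l (F z)) * E z) <= 1600 * N * M.
Proof.
move=> hl Ts s0; have p20 := ltW (pi2_gt0 R); have [hl1 hl2 hl3] := hl.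
have ct p : cont_rectR T s 0 (2 * pi) (fun z => dchi_term l p (F z) * E z).
  apply: cont_rectR_mul; last exact: (cont_energy f1w).
  by apply: (cont_comp_stripR fw s0) => u; exact: contc_dchi_term.
apply: (@le_trans _ _ (rints T s (fun z => \sum_(p <- l) dchi_term l p (F z) * E z))).
  apply: rdint_le; [exact: Ts|exact: p20| |exact: cont_rectR_sum|].
    apply: cont_rectR_mul; last exact: (cont_energy f1w).
    by apply: cont_rectR_normc; apply: (cont_comp_strip fw s0) => u; exact: contc_dbar_chi.
  move=> z _; rewrite -mulr_suml ler_wpM2r ?energy_ge0//.
  by apply: normc_dbar_chi_le => p /hl1/andP[].
rewrite (rdint_sum _ Ts p20 ct).
apply: (@le_trans _ _ (\sum_(p <- l) 1600 * N * p.2)).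
  rewrite big_seq [leRHS]big_seq; apply: ler_sum => p pl.
  exact: (dchi_energy_le fw f1w Bf0 N0 ClB hN hl pl Ts s0).
rewrite -mulr_sumr; apply: ler_wpM2l; last exact: hl3.
by apply: mulr_ge0; [exact: ler0n|exact: N0].
Qed.

Lemma strip_eventually_in_cover l eps : good_cover f M eps l ->
  exists2 s0 : R, -1 < s0 < 0 & forall z : C, s0 <= complex.Re z < 0 -> in_cover l (F z).
Proof.
move=> [hl1 hl2 _]; have BB : - Bf <= Bf by have B0 := Bf0; lra.
have [||s0 hs h] := @strip_avoids _ f [set u | ~ in_cover l u /\ normc u <= Bf] _ _ _ _ BB BB.
- by move=> u [_ h]; split; rewrite -ler_norml (le_trans _ h)// ?normRe_le// normIm_le.
- move=> p _; have [cp|ncp] := pselect (Cl p); last by left.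
  right; have [q ql hq] := hl2 p cp; exists (q.2 - normc (p - q.1)); first by rewrite subr_gt0.
  move=> w hw [nw _]; apply: nw; exists q; first exact: ql.
  have := normcD (w - p) (p - q.1); rewrite addrA subrK; lra.
exists s0; first exact: hs.
move=> z hz; apply/not_notP => nz; apply: (h z hz); split; first exact: nz.
by apply: (stripF_le fB); case/andP: hz.
Qed.

(** Exchanges the first power of |F'| in the term with dbar G for the energy, at the price of a
    small constant d. *)
Lemma normc_le_energy (x y d : R) : 0 < d -> 0 <= x -> x <= 1 -> 0 <= y ->
  x * y <= d + d^-1 * (x * y ^+ 2).
Proof.
move=> d0 x0 x1 y0; have [h|h] := leP y d.
  rewrite (@le_trans _ _ d)//; first by nra.
  by rewrite lerDl mulr_ge0 ?invr_ge0 ?(ltW d0)// mulr_ge0// sqr_ge0.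
rewrite (@le_trans _ _ (d^-1 * (x * y ^+ 2)))//; last by rewrite lerDr ltW.
rewrite mulrC -[leLHS]mulr1 -mulrA; have -> : d^-1 * (x * y ^+ 2) = y * (x * (y / d)) by ring.
rewrite ler_wpM2l// ler_wpM2l// ler_pdivlMr// mul1r ltW//.
Qed.

Theorem circ_weighted_bound : exists2 K0 : R, 0 <= K0 &
  forall (G ga gb : C -> C) (Cg : R), 0 <= Cg ->
    (forall z, complex.Re z < 0 -> wirtinger G z (ga z) (gb z)) ->
    (forall z, complex.Re z < 0 -> contc gb z) ->
    (forall z, complex.Re z < 0 -> normc (G z) <= 2) ->
    (forall z, complex.Re z < 0 -> normc (gb z) <= Cg) ->
    (forall x, G (mkc x 0) = G (mkc x (2 * pi))) ->
    exists2 s1 : R, -1 < s1 < 0 & forall s, s1 <= s -> s < 0 ->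
      normc (circ (fun z => G z * stripD f1 z) s) <= K0.
Proof.
have p20 := ltW (pi2_gt0 R); have p0 := pi_gt0 R.
have m10 : -1 < 0 :> R by lra.
have [|B B0 hB] := @bounded_rect _ (-1) (-1) 0 (2 * pi) (stripD f1) (lexx _) p20.
  by move=> z hz; apply: (contc_stripD f1w); exact: rect_Re_lt0 hz.
(* The first summand is the circle Re z = -1. In the second, 4 is the 2 of [flux] times the 2 of
   [normc_dint_le], the inner 2 bounds |G|, and 1 is the budget for the term with dbar G. *)
pose K0 := 2 * (2 * pi) * (2 * B) + 4 * (2 * (1600 * N * M) + 1).
have NM : 0 <= 1600 * N * M.
  by apply: mulr_ge0 M0; apply: mulr_ge0 N0; exact: ler0n.
have K00 : 0 <= K0.
  rewrite /K0; move: (1600 * N * M) NM => x x0; apply: addr_ge0; first by rewrite !mulr_ge0// ltW.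
  by apply: mulr_ge0 => //; apply: addr_ge0 => //; apply: mulr_ge0.
exists K0; first exact: K00.
move=> G ga gb Cg Cg0 Gw gbc GB gB Gper.
(* With this d, the constant part Cg d over an area at most 2 pi is below 1/2; the tolerance d / (2
   (Cg + 1)) for the energy does the same for the part with Cg / d. *)
pose d := (8 * pi * (Cg + 1))^-1.
have C1 : 0 < Cg + 1 by rewrite ltr_pwDr.
have arith (x1 x2 x3 x4 x5 x6 : R) : x1 <= 2 * x2 -> x2 <= 2 * x3 + (x4 + x5) ->
   x3 <= x6 -> x4 <= 1 / 2 -> x5 <= 1 / 2 -> 2 * x1 <= 4 * (2 * x6 + 1).
  by lra.
have frac4 : Cg / (4 * (Cg + 1)) <= 1 / 2 by rewrite ler_pdivrMr ?mulr_gt0//; lra.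
have frac2 : Cg / (2 * (Cg + 1)) <= 1 / 2 by rewrite ler_pdivrMr ?mulr_gt0//; lra.
have d0 : 0 < d by rewrite invr_gt0 !mulr_gt0.
have e0 : 0 < d / (2 * (Cg + 1)) by rewrite divr_gt0// mulr_gt0.
have ibound s : -1 < s -> s < 0 -> (s - -1) * (2 * pi - 0) * (Cg * d) <= 1 / 2.
  move=> m1s s0; rewrite subr0 opprK.
  have Cd : 0 <= Cg * d by exact: mulr_ge0 (ltW d0).
  apply: (@le_trans _ _ (1 * (2 * pi) * (Cg * d))).
    by apply: ler_wpM2r => //; apply: ler_wpM2r => //; lra.
  rewrite mul1r /d; move: p0; move: (pi : R) => p p0.
  have -> : 2 * p * (Cg * (8 * p * (Cg + 1))^-1) = Cg / (4 * (Cg + 1)).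
    by field; rewrite !gt_eqF.
  exact: frac4.
have [eps eps0 heps] := one_sub_chi_energy_uniform e0.
(* The cover is chosen after G and its bound Cg, which is why K0 is free of them. *)
have [l hl] := hcov eps0.
have [s1 hs1 hin] := strip_eventually_in_cover hl; have /andP[s11 s10] := hs1.
exists s1; first exact: hs1.
move=> s s1s s0; have m1s : -1 < s by exact: lt_le_trans s1s.
have [hl1 _ _] := hl; have lpos p : p \in l -> 0 < p.2 by move=> /hl1/andP[].
pose H z : C := (1 - chi l (F z))%:C%C.
pose phi z := H z * (G z * stripD f1 z).
pose bet z := - (dbar_chi l (F z) * (energy f1 z)%:C%C) * G z + H z * (gb z * stripD f1 z).
have re0 (z : C) : -1 <= complex.Re z <= s -> complex.Re z < 0.
  by move=> /andP[_ h]; exact: le_lt_trans s0.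
have /choice[al hal] : forall z, exists a, -1 <= complex.Re z <= s -> wirtinger phi z a (bet z).
  move=> z; case: (boolP (-1 <= complex.Re z <= s)) => [hz|_]; last by exists 0.
  have z0 := re0 z hz; have [a ha] := wirtinger_stripD f1w z0.
  have [a' ha'] := wirtinger_chi l (F z).
  have k1 := wirtinger_precomp_holo (wirtinger_stripF fw z0) ha'.
  have k2 := wirtinger_sub (wirtinger_cst 1 z) k1.
  have k3 := wirtinger_mul k2 (wirtinger_mul (Gw z z0) ha).
  eexists => _; apply: wirtinger_ext (wirtinger_eq _ _ k3); [|reflexivity|].
    by move=> v; rewrite /phi /H rmorphB rmorph1.
  rewrite /bet /H /energy -mulcconj rmorphB rmorph1; ring.
have cH z : complex.Re z < 0 -> contc H z.
  move=> z0; apply: contc_ext (contc_sub (contc_cst 1 z)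
    (contc_comp (contc_stripF fw z0) (contc_chi l _))) => v.
  by rewrite /H rmorphB rmorph1.
have cE z : complex.Re z < 0 -> contc (fun z => (energy f1 z)%:C%C) z.
  move=> z0; have h := contc_normc (contc_stripD f1w z0).
  by apply: contc_ext (contc_mul h h) => v; rewrite -rmorphM.
have bc z : -1 <= complex.Re z <= s -> contc bet z.
  move=> /re0 z0; apply: contc_add.
    apply: contc_mul; last exact: wirtinger_cont (Gw z z0).
    apply: contc_opp; apply: contc_mul (cE z z0).
    exact: contc_comp (contc_stripF fw z0) (contc_dbar_chi l _).
  apply: contc_mul; first exact: cH.
  by apply: contc_mul; [exact: gbc|exact: (contc_stripD f1w)].
have per x : -1 <= x <= s -> phi (mkc x 0) = phi (mkc x (2 * pi)).
  by move=> _; rewrite /phi /H /stripF /stripD Gper -cexp_per.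
have fl := flux m1s hal bc per.
have phis : circ phi s = circ (fun z => G z * stripD f1 z) s.
  apply: circ_ext => y; rewrite /phi /H /chi cut_root_in_cover ?expr0n ?subr0 ?mul1r//.
  by apply: hin; rewrite /= s1s.
have phiT : normc (circ phi (-1)) <= 2 * (2 * pi) * (2 * B).
  apply: circ_le => y hy.
    by apply: wirtinger_cont (hal _ _); rewrite /= lexx ltW.
  have x1 := one_sub_chi_ge0 l (F (mkc (-1) y)).
  have x2 : 1 - chi l (F (mkc (-1) y)) <= 1 by rewrite gerBl chi_ge0.
  rewrite /phi /H normcM normc_real (ger0_norm x1) normcM.
  have k : normc (G (mkc (-1) y)) * normc (stripD f1 (mkc (-1) y)) <= 2 * B.
    apply: ler_pM; rewrite ?normc_ge0//; first exact: GB.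
    by apply: hB; split; rewrite /= ?lexx.
  apply: le_trans k; rewrite ler_piMl// mulr_ge0 ?normc_ge0//.
have crect : cont_rect (-1) s 0 (2 * pi) bet by move=> z [hz _]; exact: bc.
pose g1 z := normc (dbar_chi l (F z)) * E z.
pose g2 z := (1 - chi l (F z)) * E z.
have c1 : cont_rectR (-1) s 0 (2 * pi) g1.
  apply: cont_rectR_mul; last exact: (cont_energy f1w).
  by apply: cont_rectR_normc; apply: (cont_comp_strip fw s0) => u; exact: contc_dbar_chi.
have c2 : cont_rectR (-1) s 0 (2 * pi) g2 by exact: cont_one_sub_chi_energy.
have c3 : cont_rectR (-1) s 0 (2 * pi) (fun z => Cg * d + Cg * d^-1 * g2 z).
  apply: cont_rectR_add; first exact: cont_rectR_cst.
  by apply: cont_rectR_mul; [exact: cont_rectR_cst|exact: c2].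
have c4 : cont_rectR (-1) s 0 (2 * pi) (fun z => 2 * g1 z).
  by apply: cont_rectR_mul; [exact: cont_rectR_cst|exact: c1].
have ptw z : rect (-1) s 0 (2 * pi) z ->
    normc (bet z) <= 2 * g1 z + (Cg * d + Cg * d^-1 * g2 z).
  move=> hz; have z0 : complex.Re z < 0 by exact: rect_Re_lt0 hz.
  rewrite /bet (le_trans (normcD _ _))//; apply: lerD.
    rewrite normcM normcN normcM normc_real (ger0_norm (energy_ge0 f1 z)) mulrC.
    by rewrite ler_wpM2r ?mulr_ge0 ?normc_ge0 ?energy_ge0//; exact: GB.
  have x1 := one_sub_chi_ge0 l (F z).
  have x2 : 1 - chi l (F z) <= 1 by rewrite gerBl chi_ge0.
  rewrite /H normcM normc_real (ger0_norm x1) normcM.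
  have k := normc_le_energy d0 x1 x2 (normc_ge0 (stripD f1 z)).
  rewrite mulrCA.
  have -> : Cg * d + Cg * d^-1 * g2 z = Cg * (d + d^-1 * ((1 - chi l (F z)) * normc (stripD f1 z) ^+ 2)).
    by rewrite /g2 /energy; ring.
  by apply: ler_pM => //; [exact: normc_ge0|rewrite mulr_ge0 ?normc_ge0|exact: gB].
have i1 : rints (-1) s g1 <= 1600 * N * M by exact: (dbar_chi_energy_le hl (ltW m1s) s0).
have i2 : rints (-1) s g2 <= d / (2 * (Cg + 1)) by exact: heps.
have i3 : rints (-1) s (fun z => normc (bet z)) <=
    2 * rints (-1) s g1 + ((s - -1) * (2 * pi - 0) * (Cg * d) + Cg * d^-1 * rints (-1) s g2).
  have c5 : cont_rectR (-1) s 0 (2 * pi) (fun z => Cg * d^-1 * g2 z).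
    by apply: cont_rectR_mul; [exact: cont_rectR_cst|exact: c2].
  have q1 : rints (-1) s (fun z => 2 * g1 z) = 2 * rints (-1) s g1 := rdintZ 2 (ltW m1s) p20 c1.
  have q2 : rints (-1) s (fun z => Cg * d^-1 * g2 z) = Cg * d^-1 * rints (-1) s g2 :=
    rdintZ (Cg * d^-1) (ltW m1s) p20 c2.
  have q3 := rdint_cst (Cg * d) (ltW m1s) p20.
  have q4 : rints (-1) s (fun z => Cg * d + Cg * d^-1 * g2 z) =
      rints (-1) s (fun=> Cg * d) + rints (-1) s (fun z => Cg * d^-1 * g2 z) :=
    rdintD (ltW m1s) p20 (cont_rectR_cst (Cg * d)) c5.
  have q5 : rints (-1) s (fun z => 2 * g1 z + (Cg * d + Cg * d^-1 * g2 z)) =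
      rints (-1) s (fun z => 2 * g1 z) + rints (-1) s (fun z => Cg * d + Cg * d^-1 * g2 z) :=
    rdintD (ltW m1s) p20 c4 c3.
  have := rdint_le (ltW m1s) p20 (cont_rectR_normc crect) (cont_rectR_add c4 c3) ptw.
  by rewrite q5 q1 q4 q2 q3.
have i4 := ibound s m1s s0.
have i5 : Cg * d^-1 * rints (-1) s g2 <= 1 / 2.
  apply: (@le_trans _ _ (Cg * d^-1 * (d / (2 * (Cg + 1))))).
    by rewrite ler_wpM2l// mulr_ge0// invr_ge0 ltW.
  have -> : Cg * d^-1 * (d / (2 * (Cg + 1))) = Cg / (2 * (Cg + 1)).
    by field; rewrite !gt_eqF.
  exact: frac2.
have i6 := normc_dint_le (ltW m1s) p20 crect.
have i7 := arith _ _ _ _ _ _ i6 i3 i1 i4 i5.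
rewrite -phis.
have -> : circ phi s = circ phi (-1) + 2 * dint (-1) s 0 (2 * pi) bet.
  by rewrite -fl addrC subrK.
rewrite (le_trans (normcD _ _))// /K0; apply: lerD; first exact: phiT.
by rewrite normcM (normc_nat R 2); exact: i7.
Qed.

End DirichletAndCircles.

(** * The Poisson kernel *)

Section RiemannSums.
Variable R : realType.
Local Notation C := R[i].

Lemma riemann_sum (g : R -> R) (L e : R) n : 0 <= L -> (0 < n)%N -> cont_itv 0 L g ->
  (forall x y, 0 <= x <= L -> 0 <= y <= L -> `|x - y| <= L / n%:R -> `|g x - g y| <= e) ->
  `|rint 0 L g - \sum_(k < n) L / n%:R * g (k%:R * (L / n%:R))| <= L * e.
Proof.
move=> L0 n0 gc hg; set h := L / n%:R.
have nR : 0 < n%:R :> R by rewrite ltr0n.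
have h0 : 0 <= h by rewrite divr_ge0// ltW.
have nh : n%:R * h = L by rewrite mulrC divfK// gt_eqF.
have mh m : (m <= n)%N -> m%:R * h <= L by move=> mn; rewrite -nh ler_wpM2r// ler_nat.
suff H m : (m <= n)%N ->
    `|rint 0 (m%:R * h) g - \sum_(k < m) h * g (k%:R * h)| <= m%:R * h * e.
  by have := H n (leqnn n); rewrite nh.
elim: m => [_|m IH mn].
  rewrite big_ord0 subr0 !mul0r.
  have := @rint_bound _ 0 0 g (g 0) 0 (lexx _) (cont_itv_sub (lexx _) L0 gc).
  rewrite subr0 !mul0r subr0; apply => x /andP[x0 x1].
  have -> : x = 0 by apply/eqP; rewrite eq_le x0 x1.
  by rewrite subrr normr0.
have m0 : 0 <= m%:R * h by rewrite mulr_ge0.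
have step : m.+1%:R * h = m%:R * h + h by rewrite -natr1 mulrDl mul1r.
have mm : m%:R * h <= m.+1%:R * h by rewrite step lerDl.
have mL := mh _ mn.
rewrite (rint_cat m0 mm); last by apply: cont_itv_sub gc.
rewrite big_ord_recr/=.
have := @rint_bound _ (m%:R * h) (m.+1%:R * h) g (g (m%:R * h)) e mm (cont_itv_sub m0 mL gc).
rewrite step addrAC subrr add0r => hb.
have {}hb : `|rint (m%:R * h) (m%:R * h + h) g - h * g (m%:R * h)| <= h * e.
  apply: hb => x /andP[x1 x2]; apply: hg.
  - by rewrite (le_trans m0)//= (le_trans x2)// -step.
  - by rewrite m0/= (le_trans mm).
  - by rewrite ger0_norm ?subr_ge0// lerBlDl.
rewrite mulrDl opprD addrACA (le_trans (ler_normD _ _))//; apply: lerD hb.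
exact: IH (ltnW mn).
Qed.

Lemma riemann_circle (psi : C -> C) (s e : R) : (forall y, contc psi (mkc s y)) -> 0 < e ->
  exists n0 : nat, forall n, (n0 < n)%N ->
  `|rint 0 (2 * pi) (fun y => complex.Re (psi (mkc s y))) -
    \sum_(k < n) 2 * pi / n%:R * complex.Re (psi (mkc s (k%:R * (2 * pi / n%:R))))|
  <= 2 * pi * e.
Proof.
move=> pc e0; have p20 := pi2_gt0 R.
have cr : cont_rect s s 0 (2 * pi) psi.
  move=> [x y] [/= hx _]; have -> : x = s by apply/eqP; rewrite eq_le andbC.
  exact: pc.
have [r r0 hr] := uniform_cont_rect (lexx s) (ltW p20) cr e0.
exists (Num.truncn (2 * pi / r)) => n hn.
have nlt : 2 * pi / r < n%:R by rewrite -truncn_lt_nat// divr_ge0// ltW.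
have nR : 0 < n%:R :> R by apply: le_lt_trans nlt; rewrite divr_ge0// ltW.
apply: (@riemann_sum (fun y => complex.Re (psi (mkc s y)))).
- exact: ltW.
- by rewrite -(ltr_nat R).
- exact: cont_seg_Re (circ_cont_seg pc).
move=> x y xp yp xy; rewrite -ReN -ReD (le_trans (normRe_le _))// ltW//; apply: hr.
  by apply: rect_mkc => //; rewrite lexx.
rewrite mkcB subrr (le_lt_trans (normc_mkc_le _ _))// normr0 add0r (le_lt_trans xy)//.
by rewrite ltr_pdivrMr// [r * _]mulrC -ltr_pdivrMr.
Qed.

End RiemannSums.

Section PoissonKernel.
Variable R : realType.
Local Notation C := R[i].
Implicit Types z w a : C.

Definition geo z : C := (1 - z)^-1.

Lemma one_sub_normc z (r : R) : normc z <= r -> 1 - r <= normc (1 - z).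
Proof. by move=> h; have := normc_lerB 1 z; rewrite (normc_nat R 1); lra. Qed.

Lemma one_sub_neq0 z : normc z < 1 -> 1 - z != 0.
Proof.
by move=> h; rewrite -normc_gt0 (lt_le_trans _ (one_sub_normc (lexx _)))// subr_gt0.
Qed.

Lemma normc_geo_le z (r : R) : r < 1 -> normc z <= r -> normc (geo z) <= (1 - r)^-1.
Proof.
move=> r1 h; have k := one_sub_normc h; have r0 : 0 < 1 - r by rewrite subr_gt0.
by rewrite /geo normcV lef_pV2// posrE (lt_le_trans r0).
Qed.

Lemma geo_lip z w (r : R) : r < 1 -> normc z <= r -> normc w <= r ->
  normc (geo z - geo w) <= (1 - r)^-1 ^+ 2 * normc (z - w).
Proof.
move=> r1 hz hw; have z0 := one_sub_neq0 (le_lt_trans hz r1).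
have w0 := one_sub_neq0 (le_lt_trans hw r1).
have -> : geo z - geo w = geo z * geo w * (z - w) by rewrite /geo; field; rewrite ?z0 ?w0.
have kz := normc_geo_le r1 hz; have kw := normc_geo_le r1 hw.
rewrite normcM ler_wpM2r ?normc_ge0// normcM [leRHS]expr2.
by apply: ler_pM; rewrite ?normc_ge0.
Qed.

Lemma wirtinger_geo z : normc z < 1 -> wirtinger geo z (geo z ^+ 2) 0.
Proof.
move=> z1; have h := wirtinger_sub (wirtinger_cst 1 z) (wirtinger_id z).
apply: wirtinger_eq (wirtinger_holo_comp h (wirtinger_inv (one_sub_neq0 z1))).
  by rewrite /geo exprVn; ring.
by rewrite subrr mulr0.
Qed.

Lemma geo_conj z : geo z^*%C = (geo z)^*%C.
Proof. by rewrite /geo fmorphV rmorphB rmorph1. Qed.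

(* The Poisson kernel 1 / (1 - conj z) + z / (1 - z). *)
Definition poisson z : C := (geo z)^*%C + (geo z - 1).

Lemma poisson_conj z : poisson z^*%C = poisson z.
Proof. by rewrite /poisson geo_conj conjcK; ring. Qed.

(** The kernel equals (1 - |z|^2) / |1 - z|^2, a nonnegative real number. *)
Lemma normc_poisson z : normc z < 1 -> normc (poisson z) = complex.Re (poisson z).
Proof.
move=> z1; have z0 := one_sub_neq0 z1.
have k0 : 0 <= (1 - normc z ^+ 2) * normc (geo z) ^+ 2.
  by rewrite mulr_ge0 ?sqr_ge0// subr_ge0 exprn_ile1 ?normc_ge0// ltW.
suff -> : poisson z = ((1 - normc z ^+ 2) * normc (geo z) ^+ 2)%:C%C.
  by rewrite normc_real ger0_norm.
have c0 : 1 - z^*%C != 0 by apply: one_sub_neq0; rewrite normc_conj.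
have -> : ((1 - normc z ^+ 2) * normc (geo z) ^+ 2)%:C%C =
    (1 - (normc z ^+ 2)%:C%C) * (normc (geo z) ^+ 2)%:C%C.
  by rewrite rmorphM rmorphB rmorph1.
rewrite -!mulcconj /poisson -geo_conj /geo.
by field; rewrite z0 c0.
Qed.

Lemma Re_poisson_lip z w (r : R) : r < 1 -> normc z <= r -> normc w <= r ->
  `|complex.Re (poisson z) - complex.Re (poisson w)| <=
    2 * ((1 - r)^-1 ^+ 2 * normc (z - w)).
Proof.
move=> r1 hz hw; have h := le_trans (normRe_le _) (geo_lip r1 hz hw).
rewrite /poisson !ReD !ReN.
have cj (x : C) : complex.Re x^*%C = complex.Re x by case: x.
rewrite !cj; move: h; rewrite ReD ReN.
move: (complex.Re (geo z)) (complex.Re (geo w)) (complex.Re 1) (_ * _) => x y u B h.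
have -> : x + (x - u) - (y + (y - u)) = 2 * (x - y) by ring.
by rewrite normrM ger0_norm// ler_wpM2l.
Qed.

Lemma normcM_lt1 a w (r : R) : normc a <= 1 -> normc w <= r -> normc (a * w) <= r.
Proof. by move=> ha hw; rewrite normcM (le_trans _ hw)// ler_piMl// normc_ge0. Qed.

(** The real part is 1 + 2 Re q with q holomorphic and q(0) = 0, so only the constant 1 survives
    integration. *)
Lemma poisson_mean a (s : R) : s < 0 -> normc a <= 1 ->
  rint 0 (2 * pi) (fun y => complex.Re (poisson (a * cexp (mkc s y)))) = 2 * pi.
Proof.
move=> s0 ha; pose q w := geo (a * w) - 1.
have qw w : normc w < 1 -> wirtinger q w (geo (a * w) ^+ 2 * a) 0.
  move=> w1; have aw : normc (a * w) < 1 by rewrite (le_lt_trans (normcM_lt1 ha (lexx _))).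
  have k := wirtinger_holo_comp (wirtinger_scale a (wirtinger_id w)) (wirtinger_geo aw).
  apply: wirtinger_eq (wirtinger_sub k (wirtinger_cst 1 w)).
    by rewrite mulr1 subr0.
  by rewrite !mulr0 subrr.
have q0 : q 0 = 0 by rewrite /q mulr0 /geo subr0 invr1 subrr.
have /(congr1 (@complex.Re R)) := circ_holo0 s0 qw q0.
rewrite [LHS]/= => h.
have qc y : contc (fun z => q (cexp z)) (mkc s y).
  apply: contc_comp (contc_cexp _) (wirtinger_cont (qw _ _)).
  by rewrite normc_cexp expR_lt1.
have c1 := cont_seg_Re (circ_cont_seg qc).
rewrite (@rint_ext _ _ _ _ (fun y => 1 + 2 * complex.Re (q (cexp (mkc s y))))); last first.
  move=> y _; rewrite /poisson /q; move: (geo _) => [u v] /=; ring.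
rewrite rintD ?rintZ ?h ?mulr0 ?addr0//; last 2 first.
- exact: cont_itv_cst.
- exact: cont_itv_scale.
by rewrite rint_cst ?(ltW (pi2_gt0 R))// subr0 mulr1.
Qed.

(** The kernel has integral 2 pi and oscillates by at most 1 over one step, so a Riemann sum at most
    doubles the integral. The Lipschitz bound is uniform in |w| <= 1, hence so is n0. *)
Lemma poisson_sum (s : R) : s < 0 -> exists n0 : nat, forall n, (n0 < n)%N ->
  forall w, normc w <= 1 ->
  \sum_(k < n) 2 * pi / n%:R *
    normc (poisson ((cexp (mkc s (k%:R * (2 * pi / n%:R))))^*%C * w)) <= 2 * (2 * pi).
Proof.
move=> s0; have p20 := pi2_gt0 R; pose r := expR s : R.
have r1 : r < 1 by rewrite expR_lt1.
have nr y : normc (cexp (mkc s y)) <= r by rewrite normc_cexp.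
pose M : R := (1 - r)^-1 ^+ 2; have M0 : 0 < M by rewrite exprn_gt0// invr_gt0 subr_gt0.
(* 2 M is the Lipschitz constant of [Re_poisson_lip]. *)
have e0 : 0 < (2 * M)^-1 by rewrite invr_gt0 mulr_gt0.
have cr : cont_rect s s 0 (2 * pi) (@cexp R) by move=> z _; exact: contc_cexp.
have [d d0 hd] := uniform_cont_rect (lexx s) (ltW p20) cr e0.
exists (Num.truncn (2 * pi / d)) => n hn w w1.
have nlt : 2 * pi / d < n%:R by rewrite -truncn_lt_nat// divr_ge0// ltW.
have nR : 0 < n%:R :> R by apply: le_lt_trans nlt; rewrite divr_ge0// ltW.
have wc1 : normc w^*%C <= 1 by rewrite normc_conj.
pose g y := complex.Re (poisson (w^*%C * cexp (mkc s y))).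
have -> : \sum_(k < n) 2 * pi / n%:R *
    normc (poisson ((cexp (mkc s (k%:R * (2 * pi / n%:R))))^*%C * w)) =
    \sum_(k < n) 2 * pi / n%:R * g (k%:R * (2 * pi / n%:R)).
  apply: eq_bigr => k _; rewrite normc_poisson; last first.
    rewrite mulrC (le_lt_trans (normcM_lt1 w1 (lexx _)))// normc_conj.
    exact: le_lt_trans r1.
  have cc (x y : C) : (x^*%C * y)^*%C = y^*%C * x.
    by rewrite -[x in RHS]conjcK -rmorphM mulrC.
  by rewrite /g -poisson_conj cc.
have lip x y : 0 <= x <= 2 * pi -> 0 <= y <= 2 * pi -> `|x - y| < d -> `|g x - g y| <= 1.
  move=> hx hy xy.
  apply: le_trans (Re_poisson_lip r1 (normcM_lt1 wc1 (nr x)) (normcM_lt1 wc1 (nr y))) _.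
  have hs : s <= s <= s by rewrite lexx.
  have k : normc (cexp (mkc s x) - cexp (mkc s y)) < (2 * M)^-1.
    apply: hd; first exact: rect_mkc.
    by rewrite mkcB subrr (le_lt_trans (normc_mkc_le _ _))// normr0 add0r.
  have k2 : normc (w^*%C * cexp (mkc s x) - w^*%C * cexp (mkc s y)) <= (2 * M)^-1.
    by rewrite -mulrBr (normcM_lt1 wc1)// ltW.
  rewrite mulrA (le_trans (ler_wpM2l _ k2))//; first by rewrite mulr_ge0// ltW.
  by rewrite divff// gt_eqF// mulr_gt0.
have gc : cont_itv 0 (2 * pi) g.
  have pc y : contc (fun z => poisson (w^*%C * cexp z)) (mkc s y).
    have gw : contc geo (w^*%C * cexp (mkc s y)).
      by apply: wirtinger_cont (wirtinger_geo (le_lt_trans (normcM_lt1 wc1 (nr y)) r1)).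
    have kc := contc_comp (contc_mul (contc_cst w^*%C _) (contc_cexp (mkc s y))) gw.
    by apply: contc_add (contc_conj kc) (contc_sub kc (contc_cst 1 _)).
  exact: cont_seg_Re (circ_cont_seg pc).
have nn : (0 < n)%N by rewrite -(ltr_nat R).
have hdn : 2 * pi / n%:R < d by rewrite ltr_pdivrMr// [d * _]mulrC -ltr_pdivrMr.
have := riemann_sum (ltW p20) nn gc
  (fun x y hx hy xy => lip x y hx hy (le_lt_trans xy hdn)).
rewrite (poisson_mean s0 wc1) mulr1.
by rewrite ler_distlC => /andP[_ h]; rewrite [leRHS]mulr_natl mulr2n.
Qed.

End PoissonKernel.

(** * Means of the derivative *)

Section HardyBound.
Variable R : realType.
Local Notation C := R[i].
Variables (f1 f2 : C -> C).
Hypothesis f1w : forall z : C, normc z < 1 -> wirtinger f1 z (f2 z) 0.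

Definition zderiv (z : C) : C := z * f1 z.

Lemma wirtinger_zderiv (z : C) : normc z < 1 -> wirtinger zderiv z (f1 z + z * f2 z) 0.
Proof.
move=> z1; apply: wirtinger_eq (wirtinger_mul (wirtinger_id z) (f1w z1)); by ring.
Qed.

(* On |w| = e^s one has conj w = e^(2s) / w, which turns the antiholomorphic part
   of the Poisson kernel into a Cauchy kernel; the holomorphic part contributes
   0 because zderiv vanishes at 0. *)
Lemma circ_poisson_zderiv (a : C) (s : R) : s < 0 -> normc a < 1 ->
  circ (fun z => poisson (a^*%C * cexp z) * stripD f1 z) s =
    (2 * pi)%:C%C * zderiv ((expR (2 * s))%:C%C * a).
Proof.
move=> s0 a1; have ca : normc a^*%C < 1 by rewrite normc_conj.
have ge (w : C) : normc w < 1 -> wirtinger (fun w => geo (a^*%C * w)) w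
    (geo (a^*%C * w) ^+ 2 * a^*%C) 0.
  move=> w1; have aw : normc (a^*%C * w) < 1.
    by rewrite (le_lt_trans (normcM_lt1 (ltW ca) (lexx _))).
  apply: wirtinger_eq (wirtinger_holo_comp (wirtinger_scale a^*%C (wirtinger_id w)) (wirtinger_geo aw)).
    by rewrite mulr1.
  by rewrite !mulr0.
have gs (y : R) : normc (cexp (mkc s y)) < 1 by rewrite normc_cexp expR_lt1.
have gc y : contc (fun z => geo (a^*%C * cexp z)) (mkc s y).
  exact: contc_comp (contc_cexp _) (wirtinger_cont (ge _ (gs y))).
have zc y : contc (fun z => zderiv (cexp z)) (mkc s y).
  exact: contc_comp (contc_cexp _) (wirtinger_cont (wirtinger_zderiv (gs y))).
rewrite (@circ_ext _ _ (fun z => (geo (a^*%C * cexp z))^*%C * zderiv (cexp z) +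
    (geo (a^*%C * cexp z) - 1) * zderiv (cexp z))); last first.
  by move=> y; rewrite /poisson /stripD /zderiv; ring.
rewrite circD; last 2 first.
- by move=> y; apply: contc_mul (contc_conj (gc y)) (zc y).
- by move=> y; apply: contc_mul (contc_sub (gc y) (contc_cst 1 _)) (zc y).
have -> : circ (fun z => (geo (a^*%C * cexp z) - 1) * zderiv (cexp z)) s = 0.
  pose q w := (geo (a^*%C * w) - 1) * zderiv w.
  apply: (@circ_holo0 _ q (fun w => (geo (a^*%C * w) ^+ 2 * a^*%C - 0) * zderiv w +
    (geo (a^*%C * w) - 1) * (f1 w + w * f2 w))) => //.
    move=> w w1.
    apply: wirtinger_eq (wirtinger_mul (wirtinger_sub (ge w w1) (wirtinger_cst 1 w))
      (wirtinger_zderiv w1)) => //.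
    by ring.
  by rewrite /q /zderiv mul0r mulr0.
rewrite addr0.
have es : normc ((expR (2 * s))%:C%C * a) < expR s.
  rewrite normcM normc_real ger0_norm ?expR_ge0//.
  have -> : 2 * s = s + s by ring.
  rewrite expRD -mulrA gtr_pMr ?expR_gt0//.
  rewrite (@le_lt_trans _ _ (normc a))// ler_piMl ?normc_ge0// ltW// expR_lt1//.
rewrite -(cauchy_formula wirtinger_zderiv s0 es); apply: circ_ext => y.
rewrite mulrC; congr (_ * _); rewrite -geo_conj.
have cc : (a^*%C * cexp (mkc s y))^*%C = a * ((expR (2 * s))%:C%C / cexp (mkc s y)).
  rewrite -[a in RHS]conjcK.
  have -> : (expR (2 * s))%:C%C / cexp (mkc s y) = (cexp (mkc s y))^*%C.
    by rewrite cexp_conj expRM_natl.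
  exact: rmorphM.
have n0 := cexp_neq0 (mkc s y).
have n1 : cexp (mkc s y) - (expR (2 * s))%:C%C * a != 0.
  rewrite subr_eq0; apply/eqP => h; move: es.
  by rewrite -h normc_cexp ltxx.
by rewrite cc /geo; field; rewrite n0 n1.
Qed.

Variable K0 : R.
Hypothesis K00 : 0 <= K0.
Hypothesis hK : forall (G ga gb : C -> C) (Cg : R), 0 <= Cg ->
    (forall z, complex.Re z < 0 -> wirtinger G z (ga z) (gb z)) ->
    (forall z, complex.Re z < 0 -> contc gb z) ->
    (forall z, complex.Re z < 0 -> normc (G z) <= 2) ->
    (forall z, complex.Re z < 0 -> normc (gb z) <= Cg) ->
    (forall x, G (mkc x 0) = G (mkc x (2 * pi))) ->
    exists2 s1 : R, -1 < s1 < 0 & forall s, s1 <= s -> s < 0 ->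
      normc (circ (fun z => G z * stripD f1 z) s) <= K0.

(* The weighted circle integrals are bounded uniformly as s tends to 0, and their
   values converge to the sum. *)
Lemma weighted_zderiv_sum n (a h : 'I_n -> C) (r c : R) : 0 <= c -> 0 <= r -> r < 1 ->
  (forall k, normc (a k) <= r) -> (forall k, normc (h k) <= 1) ->
  (forall w, normc w <= 1 -> \sum_k c * normc (poisson ((a k)^*%C * w)) <= 2) ->
  normc (\sum_k (c%:C%C * h k) * ((2 * pi)%:C%C * zderiv (a k))) <= K0.
Proof.
move=> c0 r0 r1 ha hh hP.
have ca k : normc (a k)^*%C <= 1 by rewrite normc_conj (le_trans (ha k))// ltW.
have gs (z : C) : complex.Re z < 0 -> normc (cexp z) < 1 by rewrite normc_cexp expR_lt1.
pose xi k (z : C) := (a k)^*%C * cexp z.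
have xr k (z : C) : complex.Re z < 0 -> normc (xi k z) <= r.
  move=> z0; rewrite /xi mulrC normcM_lt1 ?(ltW (gs z z0))//.
  by rewrite normc_conj.
have xi1 k (z : C) : complex.Re z < 0 -> normc (xi k z) < 1.
  by move=> z0; exact: le_lt_trans (xr k z z0) r1.
have gw k (z : C) : complex.Re z < 0 ->
    wirtinger (fun z => geo (xi k z)) z (geo (xi k z) ^+ 2 * xi k z) 0.
  move=> z0; apply: wirtinger_eq (wirtinger_holo_comp
    (wirtinger_scale (a k)^*%C (wirtinger_cexp z)) (wirtinger_geo (xi1 k z z0))).
    by [].
  by rewrite !mulr0.
pose G z := \sum_k (c%:C%C * h k) * poisson (xi k z).
pose gb z := \sum_k (c%:C%C * h k) * (geo (xi k z) ^+ 2 * xi k z)^*%C.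
have pw k (z : C) : complex.Re z < 0 -> wirtinger (fun z => poisson (xi k z)) z
    (geo (xi k z) ^+ 2 * xi k z) (geo (xi k z) ^+ 2 * xi k z)^*%C.
  move=> z0; have w1 := gw k z z0.
  apply: wirtinger_eq (wirtinger_add (wirtinger_conj w1)
    (wirtinger_sub w1 (wirtinger_cst 1 z))); first by rewrite rmorph0; ring.
  by ring.
have Gw (z : C) : complex.Re z < 0 -> wirtinger G z
    (\sum_k (c%:C%C * h k) * (geo (xi k z) ^+ 2 * xi k z)) (gb z).
  by move=> z0; apply: wirtinger_sum => k; exact: wirtinger_scale (pw k z z0).
have cgk k (z : C) : complex.Re z < 0 -> contc (fun z => (geo (xi k z) ^+ 2 * xi k z)^*%C) z.
  move=> z0; have gc := wirtinger_cont (gw k z z0).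
  apply: contc_conj; apply: contc_mul (contc_mul gc gc) _.
  exact: contc_mul (contc_cst _ _) (contc_cexp z).
have gbc (z : C) : complex.Re z < 0 -> contc gb z.
  move=> z0; rewrite /gb; elim: (index_enum _) => [|k l IH].
    by apply: contc_ext (contc_cst 0 z) => w; rewrite big_nil.
  have kc := contc_mul (contc_cst (c%:C%C * h k) z) (cgk k z z0).
  by apply: contc_ext (contc_add kc IH) => w; rewrite big_cons.
have nch k : normc (c%:C%C * h k) <= c.
  by rewrite normcM normc_real ger0_norm// ler_piMr.
have GB (z : C) : complex.Re z < 0 -> normc (G z) <= 2.
  move=> z0; apply: le_trans (hP (cexp z) (ltW (gs z z0))).
  apply: le_trans (normc_sum_le _ _ _) _; apply: ler_sum => k _.
  by rewrite normcM ler_wpM2r ?normc_ge0.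
pose Cg := \sum_(k < n) c * (1 - r)^-1 ^+ 2.
have r10 : 0 <= (1 - r)^-1 by rewrite invr_ge0 subr_ge0 ltW.
have Cg0 : 0 <= Cg by apply: sumr_ge0 => k _; rewrite mulr_ge0 ?sqr_ge0.
have gbB (z : C) : complex.Re z < 0 -> normc (gb z) <= Cg.
  move=> z0; apply: le_trans (normc_sum_le _ _ _) _; apply: ler_sum => k _.
  rewrite normcM; apply: ler_pM; rewrite ?normc_ge0//.
  rewrite normc_conj mulrC normcM_lt1 ?(ltW (xi1 k z z0))//.
  rewrite normcX lerXn2r ?nnegrE ?normc_ge0//.
  exact: normc_geo_le r1 (xr k z z0).
have Gper x : G (mkc x 0) = G (mkc x (2 * pi)) by rewrite /G /xi -cexp_per.
have [s1 /andP[s11 s10] hs1] := hK Cg0 Gw gbc GB gbB Gper.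
(* The circle integral at s equals S(2 s), because the Poisson integral evaluates [zderiv] at e^(2
   s) a_k; the sum to be bounded is S(0), and S is continuous at 0. *)
pose S (z : C) := \sum_k (c%:C%C * h k) * ((2 * pi)%:C%C * zderiv (cexp z * a k)).
have circG s : s < 0 -> circ (fun z => G z * stripD f1 z) s = S (2 * s)%:C%C.
  move=> s0; rewrite /circ (@cint_ext _ _ _ _ (fun y => \sum_k (c%:C%C * h k) *
      (poisson (xi k (mkc s y)) * stripD f1 (mkc s y)))); last first.
    by move=> y _; rewrite /G mulr_suml; apply: eq_bigr => k _; rewrite mulrA.
  have sc k y : contc (fun z => (c%:C%C * h k) * (poisson (xi k z) * stripD f1 z)) (mkc s y).
    apply: contc_mul (contc_cst _ _) _; apply: contc_mul (wirtinger_cont (pw k (mkc s y) s0)) _.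
    exact: (contc_stripD f1w).
  have [_ ->] := @cint_sum _ 'I_n (index_enum _) 0 (2 * pi) _ (ltW (pi2_gt0 R))
    (fun k => circ_cont_seg (sc k)).
  apply: eq_bigr => k _; rewrite -/(circ (fun z => (c%:C%C * h k) *
    (poisson (xi k z) * stripD f1 z)) s) circZ; last first.
    move=> y; apply: contc_mul (wirtinger_cont (pw k (mkc s y) s0)) _.
    exact: (contc_stripD f1w).
  rewrite circ_poisson_zderiv//; last by rewrite (le_lt_trans (ha k)).
  congr (_ * (_ * zderiv (_ * _))).
  by rewrite /cexp /= /expi cos0 sin0 mulr1.
have Sc : contc S 0.
  rewrite /S; elim: (index_enum _) => [|k l IH].
    by apply: contc_ext (contc_cst 0 0) => w; rewrite big_nil.
  have ak : normc (cexp 0 * a k) < 1.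
    by rewrite normcM normc_cexp expR0 mul1r (le_lt_trans (ha k)).
  have zc := contc_comp (contc_mul (contc_cexp 0) (contc_cst (a k) 0))
    (wirtinger_cont (wirtinger_zderiv ak)).
  have kc := contc_mul (contc_cst (c%:C%C * h k) 0) (contc_mul (contc_cst (2 * pi)%:C%C 0) zc).
  by apply: contc_ext (contc_add kc IH) => w; rewrite big_cons.
have S0 : S 0 = \sum_k (c%:C%C * h k) * ((2 * pi)%:C%C * zderiv (a k)).
  apply: eq_bigr => k _; congr (_ * (_ * zderiv _)).
  by rewrite /cexp expR0 mul1r expi0 mul1r.
rewrite -S0; apply/ler_addgt0Pr => e e0.
have /contcP/(_ e e0)[d d0 hd] := Sc.
pose s := - Num.min (- s1) (d / 4).
have s_0 : s < 0 by rewrite oppr_lt0 lt_min oppr_gt0 s10 divr_gt0.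
have s1s : s1 <= s by rewrite lerNr ge_min lexx.
have sd : normc ((2 * s)%:C%C - 0 : C) < d.
  have hs : - s <= d / 4 by rewrite opprK ge_min lexx orbT.
  by rewrite subr0 normc_real ltr0_norm; lra.
have k1 := hd _ sd; have k2 := hs1 s s1s s_0; rewrite (circG s s_0) in k2.
have k3 := normc_lerB (S 0) (S (2 * s)%:C%C); rewrite normcBC in k3.
move: k1 k2 k3; move: (normc _) (normc _) (normc _) => x1 x2 x3; lra.
Qed.

(** Duality: with weights equal to the conjugate phases of [zderiv] at the sample points, the
    weighted sum becomes the sum of the moduli, while [poisson_sum] keeps |G| <= 2. *)
Lemma zderiv_riemann_le (s : R) : s < 0 -> exists n0 : nat, forall n, (n0 < n)%N ->
  \sum_(k < n) 2 * pi / n%:R * normc (zderiv (cexp (mkc s (k%:R * (2 * pi / n%:R))))) <= K0.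
Proof.
move=> s0; have [n0 hn0] := poisson_sum s0; exists n0 => n hn.
have nR : 0 < n%:R :> R by rewrite ltr0n (leq_ltn_trans _ hn).
pose a (k : 'I_n) := cexp (mkc s (k%:R * (2 * pi / n%:R))).
(* Division by 0 yields 0, so a zero of [zderiv] receives the weight 0 and |h| <= 1 always holds. *)
pose h (k : 'I_n) := (zderiv (a k))^*%C / (normc (zderiv (a k)))%:C%C.
have hz k : h k * zderiv (a k) = (normc (zderiv (a k)))%:C%C.
  rewrite /h; have [->|z0] := eqVneq (zderiv (a k)) 0; first by rewrite mulr0 normc0.
  have nz : (normc (zderiv (a k)))%:C%C != 0 :> C by rewrite -normc_gt0 normc_real normr_gt0 normc_eq0.
  by rewrite mulrAC [_^*%C * _]mulrC mulcconj rmorphXn expr2 mulfK.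
have hh k : normc (h k) <= 1.
  rewrite /h normcM normcV normc_conj normc_real ger0_norm ?normc_ge0//.
  by have [->|z0] := eqVneq (normc (zderiv (a k))) 0; [rewrite mul0r|rewrite divff].
have r1 : expR s < 1 :> R by rewrite expR_lt1.
have ha k : normc (a k) <= expR s by rewrite normc_cexp.
have c0 : 0 <= n%:R^-1 :> R by rewrite invr_ge0.
have p20 := pi2_gt0 R.
have hP w : normc w <= 1 -> \sum_k n%:R^-1 * normc (poisson ((a k)^*%C * w)) <= 2.
  move=> w1; have hs := hn0 n hn w w1.
  rewrite -(ler_pM2l p20) [2 * pi * 2]mulrC; apply: le_trans hs.
  by rewrite mulr_sumr; apply: ler_sum => k _; rewrite [leLHS]mulrA lexx.
have := weighted_zderiv_sum c0 (expR_ge0 s) r1 ha hh hP.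
have -> : \sum_k ((n%:R^-1)%:C%C * h k) * ((2 * pi)%:C%C * zderiv (a k)) =
    (\sum_(k < n) 2 * pi / n%:R * normc (zderiv (a k)))%:C%C.
  rewrite rmorph_sum; apply: eq_bigr => k _.
  have -> : (n%:R^-1)%:C%C * h k * ((2 * pi)%:C%C * zderiv (a k)) =
    (2 * pi)%:C%C * (n%:R^-1)%:C%C * (h k * zderiv (a k)) by ring.
  by rewrite hz -!rmorphM.
by rewrite normc_real; apply: le_trans; exact: ler_norm.
Qed.

Lemma zderiv_rint_le (s : R) : s < 0 ->
  rint 0 (2 * pi) (fun y => normc (zderiv (cexp (mkc s y)))) <= K0.
Proof.
move=> s0; have p20 := pi2_gt0 R; apply/ler_addgt0Pr => e e0.
have e1 : 0 < e / (2 * pi) by rewrite divr_gt0.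
have zc y : contc (fun z => (normc (zderiv (cexp z)))%:C%C) (mkc s y).
  apply: contc_normc; apply: contc_comp (contc_cexp _) (wirtinger_cont (wirtinger_zderiv _)).
  by rewrite normc_cexp expR_lt1.
have [n1 h1] := riemann_circle zc e1; have [n2 h2] := zderiv_riemann_le s0.
have := h1 (n1 + n2).+1; rewrite ltnS leq_addr => /(_ isT).
have := h2 (n1 + n2).+1; rewrite ltnS leq_addl => /(_ isT).
rewrite [2 * pi * (e / _)]mulrC divfK ?gt_eqF//=.
move: (rint _ _ _) (\sum_(_ < _) _) => x y; rewrite ler_distl; lra.
Qed.

Lemma cont_normc_circle (q : C -> C) (r : R) : 0 < r ->
  (forall y, contc q (r%:C%C * expi y)) ->
  cont_itv 0 (2 * pi) (fun y => normc (q (r%:C%C * expi y))).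
Proof.
move=> r0 qc; have e y : r%:C%C * expi y = cexp (mkc (ln r) y).
  by rewrite cexp_mkc lnK ?posrE.
have zc y : contc (fun z => (normc (q (cexp z)))%:C%C) (mkc (ln r) y).
  by apply: contc_normc; apply: contc_comp (contc_cexp _) _; rewrite -e.
have := cont_seg_Re (circ_cont_seg zc).
by congr (cont_itv _ _ _); apply/funext => y; rewrite e.
Qed.

Lemma normc_real_expi (r t : R) : 0 < r -> normc (r%:C%C * expi t) = r.
Proof. by move=> r0; rewrite normcM normc_expi mulr1 normc_real gtr0_norm. Qed.

Lemma cont_normc_deriv_circle (r : R) : 0 < r -> r < 1 ->
  cont_itv 0 (2 * pi) (fun y => normc (f1 (r%:C%C * expi y))).
Proof.
move=> r0 r1; apply: cont_normc_circle => // y; apply: wirtinger_cont (f1w _).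
by rewrite normc_real_expi.
Qed.

Lemma circle_integral_le (r B : R) : 0 < r -> r < 1 ->
  rint 0 (2 * pi) (fun y => normc (f1 (r%:C%C * expi y))) <= B ->
  (circle_integral (f1 : Cplx R -> Cplx R) r <= B%:E)%E.
Proof.
move=> r0 r1; rewrite /rint /Rintegral /circle_integral => h.
rewrite -lee_fin fineK in h; first exact: h.
exact: integrable_fin_num (cont_itv_integrable (cont_normc_deriv_circle r0 r1)).
Qed.

(** For r > 1/2 one has |f'| <= 2 |z f'|, which gives 2 K0; for smaller r the derivative is
    bounded. *)
Lemma circle_integrals_bounded : exists B : R, forall r, 0 < r -> r < 1 ->
  (circle_integral (f1 : Cplx R -> Cplx R) r <= B%:E)%E.
Proof.
have h0 : 0 <= 1 / 2 :> R by rewrite divr_ge0.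
have h1 : 1 / 2 < 1 :> R by lra.
have [B B0 hB] := bounded_inside f1w h0 h1.
have p20 := pi2_gt0 R.
exists (2 * K0 + 2 * pi * B) => r r0 r1; apply: circle_integral_le => //.
have KB : 0 <= 2 * pi * B by rewrite mulr_ge0// ltW.
have gc := cont_normc_deriv_circle r0 r1.
have [rh|rh] := leP r (1 / 2).
  apply: (@le_trans _ _ (2 * pi * B)); last by rewrite lerDr mulr_ge0.
  have -> : 2 * pi * B = rint 0 (2 * pi) (fun=> B) by rewrite rint_cst ?(ltW p20)// subr0.
  apply: rint_le => //; first exact: cont_itv_cst.
  by move=> y _; apply: hB; rewrite normc_real_expi.
have s0 : ln r < 0 by rewrite ln_lt0// r0.
apply: (@le_trans _ _ (2 * K0)); last by rewrite lerDl.
apply: le_trans (ler_wpM2l _ (zderiv_rint_le s0)) => //.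
have zc : cont_itv 0 (2 * pi) (fun y => normc (zderiv (cexp (mkc (ln r) y)))).
  have -> : (fun y => normc (zderiv (cexp (mkc (ln r) y)))) =
      (fun y => normc (zderiv (r%:C%C * expi y))).
    by apply/funext => y; rewrite cexp_mkc lnK ?posrE.
  apply: cont_normc_circle => // y; apply: wirtinger_cont (wirtinger_zderiv _).
  by rewrite normc_real_expi.
rewrite -rintZ//; apply: rint_le => //; first exact: cont_itv_scale.
move=> y _; rewrite cexp_mkc lnK ?posrE// /zderiv normcM normc_real_expi// mulrA.
by rewrite ler_peMl ?normc_ge0//; lra.
Qed.

End HardyBound.

Theorem theorem1p4 (R : realType) (f : Cplx R -> Cplx R) :
  holomorphic_on_disc f ->
  (linear_measure (cluster_set f) < +oo)%E ->
  finite_set (components (~` cluster_set f)) ->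
  hardy_H1 f^`().
Proof.
move=> fholo fmeas fcomp.
have fw z : normc z < 1 -> wirtinger (f : R[i] -> R[i]) z (f^`() z) 0.
  by move=> z1; exact: derivable_wirtinger (fholo z z1).
(* A second derivative as a total function, with the value 0 off the disc. *)
have /choice[f2 hf2] : forall z, exists l, normc z < 1 -> wirtinger (f^`() : R[i] -> R[i]) z l 0.
  move=> z; case: (boolP (normc z < 1)) => [z1|_]; last by exists 0.
  by have [l hl] := holomorphic_deriv fw z1; exists l.
have f1w z : normc z < 1 -> wirtinger (f^`() : R[i] -> R[i]) z (f2 z) 0 by exact: hf2.
split.
  by move=> z z1; have [] := wirtinger_derivable (f1w z z1).
have [Bf Bf0 fB] := bounded_of_linear_measure fw fmeas.
have ClB := cluster_bounded fB.
have [M M0 hcov] := good_cover_ex Bf0 ClB fmeas.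
have [N N0 hN] := valence_bound fw f1w fB Bf0 fcomp.
have [K0 K00 hK] := circ_weighted_bound fw f1w fB Bf0 N0 M0 ClB hN hcov.
have [B hB] := circle_integrals_bounded f1w K00 hK.
apply: (@le_lt_trans _ _ B%:E); last exact: ltry.
apply: ge_ereal_sup => _ [r hr <-].
by move: hr; rewrite /= in_itv/= => /andP[r0 r1]; exact: hB.
Qed.
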